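(* The following Morita inequivalences hold. (1) The group algebra $\mathbb{F}_2S_4$ (which consists of a single block, of weight $2$) is not Morita equivalent to the principal block of $\mathbb{F}_2S_5$, nor to the non-principal block of $\mathbb{F}_2S_7$. (2) The Schur algebra $S_{\mathbb{F}_2}(4,4)$ is not Morita equivalent to the block of $S_{\mathbb{F}_2}(5,5)$ corresponding to the principal block of $\mathbb{F}_2S_5$, nor to the block of $S_{\mathbb{F}_2}(7,7)$ corresponding to the non-principal block of $\mathbb{F}_2S_7$. (3) The principal blocks of $\mathbb{F}_2S_6$ and $\mathbb{F}_2S_7$ (both of weight $3$) are not Morita equivalent. (4) The blocks of $S_{\mathbb{F}_2}(6,6)$ and $S_{\mathbb{F}_2}(7,7)$ corresponding to the principal blocks of $\mathbb{F}_2S_6$ and $\mathbb{F}_2S_7$ are not Morita equivalent.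
   Context: $S_n$ denotes the symmetric group of degree $n$ and $\mathbb{F}_2$ the field with two elements. For a partition $\lambda=(\lambda_1,\dots,\lambda_t)$ of $n$, $M^\lambda=\mathbb{F}_2[S_n/S_\lambda]$ is the permutation module on the cosets of the Young subgroup $S_\lambda=S_{\lambda_1}\times\cdots\times S_{\lambda_t}$. The Young modules $Y^\lambda$ ($\lambda\vdash n$) are the indecomposable direct summands, up to isomorphism, of the modules $M^\mu$, $\mu \vdash n$. They are parametrized by partitions so that $Y^\lambda$ occurs exactly once as a summand of $M^\lambda$ and all summands of $M^\lambda$ have the form $Y^\mu$ with $\mu\ge\lambda$ in the dominance order. The Schur algebra is taken here up to Morita equivalence, as the basic algebra $S_{\mathbb{F}_2}(n,n)=\operatorname{End}_{\mathbb{F}_2S_n}\left(\bigoplus_{\lambda\vdash n}Y^\lambda\right)$. The weight of a block of $\mathbb{F}_2S_n$ is the number of rim $2$-hooks that must be removed from any partition $\lambda$ with $Y^\lambda$ in the block in order to reach its $2$-core. $\mathbb{F}_2S_7$ has exactly two blocks: the principal block (weight $3$, $2$-core $[1]$) and one non-principal block (weight $2$, $2$-core $[2,1]$). The block of $S_{\mathbb{F}_2}(n,n)$ corresponding to a block $B$ of $\mathbb{F}_2S_n$ is $\operatorname{End}_{\mathbb{F}_2S_n}\left(\bigoplus_{\lambda}Y^\lambda\right)$, where $\lambda$ runs over the partitions of $n$ such that $Y^\lambda$ lies in $B$. *)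

(* Defs.v *)
From HB Require Import structures.
From mathcomp Require Import all_boot all_order all_fingroup all_algebra.
From mathcomp Require Import boolp.

Set Implicit Arguments.
Unset Strict Implicit.
Unset Printing Implicit Defensive.

Import GRing.Theory.
Local Open Scope ring_scope.

Definition mod_iso (A : pzRingType) (U V : lmodType A) : Prop :=
  exists f : {linear U -> V}, bijective f.

Definition mod_zero (A : pzRingType) (V : lmodType A) : Prop :=
  forall v : V, v = 0.

Definition indecomposable (A : pzRingType) (V : lmodType A) : Prop :=
  ~ mod_zero V /\
  forall U W : lmodType A,
    mod_iso V (U * W)%type -> mod_zero U \/ mod_zero W.

(* The index type is finite, so the direct sum is the full product. *)
Definition dsum (A : pzRingType) (I : finType) (V : I -> lmodType A) : Type :=
  forall i, V i.

Section DirectSum.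
Variables (A : pzRingType) (I : finType) (V : I -> lmodType A).
Implicit Types u v w : dsum V.

HB.instance Definition _ := Choice.on (dsum V).

Definition dsum_add u v : dsum V := fun i => u i + v i.
Definition dsum_zero : dsum V := fun i => 0.
Definition dsum_opp u : dsum V := fun i => - u i.
Definition dsum_scale (a : A) u : dsum V := fun i => a *: u i.

Fact dsum_addA : associative dsum_add.
Proof. by move=> u v w; apply: functional_extensionality_dep => i; apply: addrA. Qed.
Fact dsum_addC : commutative dsum_add.
Proof. by move=> u v; apply: functional_extensionality_dep => i; apply: addrC. Qed.
Fact dsum_add0 : left_id dsum_zero dsum_add.
Proof. by move=> u; apply: functional_extensionality_dep => i; apply: add0r. Qed.
Fact dsum_addN : left_inverse dsum_zero dsum_opp dsum_add.
Proof. by move=> u; apply: functional_extensionality_dep => i; apply: addNr. Qed.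

HB.instance Definition _ :=
  GRing.isZmodule.Build (dsum V) dsum_addA dsum_addC dsum_add0 dsum_addN.

Fact dsum_scaleA a b v : dsum_scale a (dsum_scale b v) = dsum_scale (a * b) v.
Proof. by apply: functional_extensionality_dep => i; apply: scalerA. Qed.
Fact dsum_scale1 : left_id 1 dsum_scale.
Proof. by move=> u; apply: functional_extensionality_dep => i; apply: scale1r. Qed.
Fact dsum_scaleDr : right_distributive dsum_scale +%R.
Proof. by move=> a u v; apply: functional_extensionality_dep => i; apply: scalerDr. Qed.
Fact dsum_scaleDl v : {morph dsum_scale^~ v : a b / a + b}.
Proof. by move=> a b; apply: functional_extensionality_dep => i; apply: scalerDl. Qed.

HB.instance Definition _ := GRing.Zmodule_isLmodule.Build A (dsum V)
  dsum_scaleA dsum_scale1 dsum_scaleDr dsum_scaleDl.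

End DirectSum.

Lemma linear_ext (A : pzRingType) (U V : lmodType A) (f g : {linear U -> V}) :
  f =1 g -> f = g.
Proof.
case: f => f [[hf0] [hf1]]; case: g => g [[hg0] [hg1]] /= /funext fg.
move: hf0 hf1 hg0 hg1; rewrite /= {}fg => *.
by congr (GRing.Linear.Pack (GRing.Linear.Class _ _)); congr (_ _);
  apply: Prop_irrelevance.
Qed.

Definition mod_end (A : pzRingType) (V : lmodType A) : Type := {linear V -> V}.

Section EndomorphismRing.
Variables (A : pzRingType) (V : lmodType A).
Implicit Types f g h : mod_end V.

HB.instance Definition _ := gen_eqMixin (mod_end V).
HB.instance Definition _ := gen_choiceMixin (mod_end V).

Definition mod_end_zero : mod_end V := \0.
Definition mod_end_opp f : mod_end V := \- (f : {linear V -> V}).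
Definition mod_end_add f g : mod_end V :=
  (f : {linear V -> V}) \+ (g : {linear V -> V}).
Definition mod_end_one : mod_end V := idfun.
Definition mod_end_mul f g : mod_end V :=
  (f : {linear V -> V}) \o (g : {linear V -> V}).

Fact mod_end_addA : associative mod_end_add.
Proof. by move=> f g h; apply: linear_ext => v; apply: addrA. Qed.
Fact mod_end_addC : commutative mod_end_add.
Proof. by move=> f g; apply: linear_ext => v; apply: addrC. Qed.
Fact mod_end_add0 : left_id mod_end_zero mod_end_add.
Proof. by move=> f; apply: linear_ext => v; apply: add0r. Qed.
Fact mod_end_addN : left_inverse mod_end_zero mod_end_opp mod_end_add.
Proof. by move=> f; apply: linear_ext => v; apply: addNr. Qed.

HB.instance Definition _ := GRing.isZmodule.Build (mod_end V)
  mod_end_addA mod_end_addC mod_end_add0 mod_end_addN.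

Fact mod_end_mulA : associative mod_end_mul.
Proof. by move=> f g h; apply: linear_ext. Qed.
Fact mod_end_mul1 : left_id mod_end_one mod_end_mul.
Proof. by move=> f; apply: linear_ext. Qed.
Fact mod_end_mulr1 : right_id mod_end_one mod_end_mul.
Proof. by move=> f; apply: linear_ext. Qed.
Fact mod_end_mulDl : left_distributive mod_end_mul +%R.
Proof. by move=> f g h; apply: linear_ext. Qed.
Fact mod_end_mulDr : right_distributive mod_end_mul +%R.
Proof.
by move=> f g h; apply: linear_ext => v; apply: (raddfD (f : {linear V -> V})).
Qed.

HB.instance Definition _ := GRing.Zmodule_isPzRing.Build (mod_end V)
  mod_end_mulA mod_end_mul1 mod_end_mulr1 mod_end_mulDl mod_end_mulDr.

End EndomorphismRing.

Record mod_functor (A B : pzRingType) := ModFunctor {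
  fobj :> lmodType A -> lmodType B;
  fmap : forall U V : lmodType A, {linear U -> V} -> {linear fobj U -> fobj V};
  fmap_id : forall U : lmodType A, fmap (idfun : {linear U -> U}) =1 idfun;
  fmap_comp : forall (U V W : lmodType A)
      (f : {linear V -> W}) (g : {linear U -> V}),
    fmap (f \o g : {linear U -> W}) =1 fmap f \o fmap g
}.

(* Equivalence of the categories of left modules. An equivalence between module
   categories is automatically additive, so [mod_functor] does not require it. *)
Definition morita_equivalent (A B : pzRingType) : Prop :=
  exists (F : mod_functor A B) (G : mod_functor B A)
    (eta : forall U : lmodType A, {linear U -> G (F U)})
    (eps : forall V : lmodType B, {linear F (G V) -> V}),
  [/\ forall U, bijective (eta U),
      forall (U U' : lmodType A) (f : {linear U -> U'}),
        eta U' \o f =1 fmap G (fmap F f) \o eta U,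
      forall V, bijective (eps V) &
      forall (V V' : lmodType B) (f : {linear V -> V'}),
        eps V' \o fmap F (fmap G f) =1 f \o eps V].

Definition central_idempotent (A : pzRingType) (e : A) : Prop :=
  e * e = e /\ forall x, e * x = x * e.

Definition primitive_central_idempotent (A : pzRingType) (e : A) : Prop :=
  [/\ central_idempotent e, e != 0 &
      forall f, central_idempotent f -> e * f = f -> f = 0 \/ f = e].

Record block (A : pzRingType) := Block {
  block_idem : A;
  block_idemP : primitive_central_idempotent block_idem
}.

(* The ideal [e A], a ring with identity [e]. *)
Definition block_alg (A : pzRingType) (b : block A) : Type :=
  {x : A | block_idem b * x == x}.

Section BlockAlgebra.
Variables (A : pzRingType) (b : block A).
Let e := block_idem b.
Implicit Types x y z : block_alg b.

HB.instance Definition _ := Choice.on (block_alg b).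

Lemma block_algP x : e * val x = val x. Proof. exact: (eqP (valP x)). Qed.

Lemma block_idem_id : e * e = e. Proof. by case: (block_idemP b) => -[]. Qed.
Lemma block_idemC (a : A) : e * a = a * e.
Proof. by case: (block_idemP b) => -[_ ->]. Qed.

Fact block_add_subproof x y : e * (val x + val y) == val x + val y.
Proof. by rewrite mulrDr !block_algP. Qed.
Fact block_opp_subproof x : e * (- val x) == - val x.
Proof. by rewrite mulrN block_algP. Qed.
Fact block_zero_subproof : e * 0 == 0. Proof. by rewrite mulr0. Qed.
Fact block_one_subproof : e * e == e. Proof. by rewrite block_idem_id. Qed.
Fact block_mul_subproof x y : e * (val x * val y) == val x * val y.
Proof. by rewrite mulrA block_algP. Qed.

Definition block_add x y : block_alg b :=
  exist (fun x : A => e * x == x) _ (block_add_subproof x y).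
Definition block_opp x : block_alg b :=
  exist (fun x : A => e * x == x) _ (block_opp_subproof x).
Definition block_zero : block_alg b :=
  exist (fun x : A => e * x == x) _ block_zero_subproof.
Definition block_one : block_alg b :=
  exist (fun x : A => e * x == x) _ block_one_subproof.
Definition block_mul x y : block_alg b :=
  exist (fun x : A => e * x == x) _ (block_mul_subproof x y).

Fact block_addA : associative block_add.
Proof. by move=> x y z; apply: val_inj; apply: addrA. Qed.
Fact block_addC : commutative block_add.
Proof. by move=> x y; apply: val_inj; apply: addrC. Qed.
Fact block_add0 : left_id block_zero block_add.
Proof. by move=> x; apply: val_inj; apply: add0r. Qed.
Fact block_addN : left_inverse block_zero block_opp block_add.
Proof. by move=> x; apply: val_inj; apply: addNr. Qed.

HB.instance Definition _ := GRing.isZmodule.Build (block_alg b)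
  block_addA block_addC block_add0 block_addN.

Fact block_mulA : associative block_mul.
Proof. by move=> x y z; apply: val_inj; apply: mulrA. Qed.
Fact block_mul1 : left_id block_one block_mul.
Proof. by move=> x; apply: val_inj; apply: block_algP. Qed.
Fact block_mulr1 : right_id block_one block_mul.
Proof. by move=> x; apply: val_inj; rewrite /= -block_idemC block_algP. Qed.
Fact block_mulDl : left_distributive block_mul +%R.
Proof. by move=> x y z; apply: val_inj; apply: mulrDl. Qed.
Fact block_mulDr : right_distributive block_mul +%R.
Proof. by move=> x y z; apply: val_inj; apply: mulrDr. Qed.

HB.instance Definition _ := GRing.Zmodule_isPzRing.Build (block_alg b)
  block_mulA block_mul1 block_mulr1 block_mulDl block_mulDr.

End BlockAlgebra.

Definition in_block (A : pzRingType) (b : block A) (V : lmodType A) : Prop :=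
  forall v : V, block_idem b *: v = v.

Definition galg (F : fieldType) (gT : finGroupType) : Type := {ffun gT -> F}.

Section GroupAlgebra.
Variables (F : fieldType) (gT : finGroupType).
Implicit Types (a b c : galg F gT) (g h : gT).

(* Only the additive structure is inherited from [{ffun gT -> F}]: its
   pointwise product is not the one of the group algebra. *)
HB.instance Definition _ := GRing.Zmodule.on (galg F gT).

Definition galg_one : galg F gT := [ffun g => (g == 1%g)%:R].
Definition galg_mul a b : galg F gT :=
  [ffun g => \sum_h a h * b (h^-1 * g)%g].

Fact galg_mulA : associative galg_mul.
Proof.
move=> a b c; apply/ffunP => g; rewrite !ffunE.
under eq_bigr do rewrite ffunE big_distrr /=.
under [RHS]eq_bigr do rewrite ffunE big_distrl /=.
rewrite [RHS]exchange_big /=; apply: eq_bigr => h _.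
rewrite [RHS](reindex_inj (mulgI h)) /=; apply: eq_bigr => k _.
by rewrite mulKg invMg mulrA mulgA.
Qed.
Fact galg_mul1 : left_id galg_one galg_mul.
Proof.
move=> a; apply/ffunP => g; rewrite ffunE (bigD1 1%g) //= big1 => [|h /negPf h1].
  by rewrite ffunE eqxx mul1r invg1 mul1g addr0.
by rewrite ffunE h1 mul0r.
Qed.
Fact galg_mulr1 : right_id galg_one galg_mul.
Proof.
move=> a; apply/ffunP => g; rewrite ffunE (bigD1 g) //= big1 => [|h /negPf hg].
  by rewrite ffunE mulVg eqxx mulr1 addr0.
by rewrite ffunE -eq_invg_mul invgK hg mulr0.
Qed.
Fact galg_mulDl : left_distributive galg_mul +%R.
Proof.
move=> a b c; apply/ffunP => g; rewrite !ffunE -big_split /=.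
by apply: eq_bigr => h _; rewrite ffunE mulrDl.
Qed.
Fact galg_mulDr : right_distributive galg_mul +%R.
Proof.
move=> a b c; apply/ffunP => g; rewrite !ffunE -big_split /=.
by apply: eq_bigr => h _; rewrite ffunE mulrDr.
Qed.

HB.instance Definition _ := GRing.Zmodule_isPzRing.Build (galg F gT)
  galg_mulA galg_mul1 galg_mulr1 galg_mulDl galg_mulDr.

End GroupAlgebra.

Definition coset_space (gT : finGroupType) (H : {group gT}) : Type :=
  {C : {set gT} | C \in lcosets H [set: gT]}.
HB.instance Definition _ (gT : finGroupType) (H : {group gT}) :=
  Finite.on (coset_space H).

(* An element [v] of [F[G/H]] stands for the formal sum of the [v C * C]. *)
Definition perm_module (F : fieldType) (gT : finGroupType) (H : {group gT}) :
  Type := {ffun coset_space H -> F}.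

Section PermutationModule.
Variables (F : fieldType) (gT : finGroupType) (H : {group gT}).
Implicit Types (a b : galg F gT) (g h : gT) (C : coset_space H).
Implicit Types u v w : perm_module F H.

HB.instance Definition _ := GRing.Zmodule.on (perm_module F H).

Fact coset_trans_subproof g C : (g *: val C)%g \in lcosets H [set: gT].
Proof.
case: C => C /= /lcosetsP[x _ ->]; apply/lcosetsP; exists (g * x)%g => //.
by rewrite lcosetM.
Qed.
Definition coset_trans g C : coset_space H :=
  exist (fun D : {set gT} => D \in lcosets H [set: gT]) _
    (coset_trans_subproof g C).

Lemma coset_trans1 C : coset_trans 1 C = C.
Proof. by apply: val_inj; rewrite /= lcoset1. Qed.
Lemma coset_transM g h C : coset_trans (g * h) C = coset_trans g (coset_trans h C).
Proof. by apply: val_inj; rewrite /= lcosetM. Qed.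

Definition perm_scale a v : perm_module F H :=
  [ffun C => \sum_g a g * v (coset_trans g^-1 C)].

Fact perm_scaleA a b v : perm_scale a (perm_scale b v) = perm_scale (a * b) v.
Proof.
apply/ffunP => C; rewrite !ffunE.
under eq_bigr do rewrite ffunE big_distrr /=.
under [RHS]eq_bigr do rewrite ffunE big_distrl /=.
rewrite [RHS]exchange_big /=; apply: eq_bigr => h _.
rewrite [RHS](reindex_inj (mulgI h)) /=; apply: eq_bigr => k _.
by rewrite mulKg invMg mulrA coset_transM.
Qed.
Fact perm_scale1 : left_id 1 perm_scale.
Proof.
move=> v; apply/ffunP => C; rewrite ffunE (bigD1 1%g) //= big1 => [|h /negPf h1].
  by rewrite ffunE eqxx mul1r invg1 coset_trans1 addr0.
by rewrite ffunE h1 mul0r.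
Qed.
Fact perm_scaleDr : right_distributive perm_scale +%R.
Proof.
move=> a u v; apply/ffunP => C; rewrite !ffunE -big_split /=.
by apply: eq_bigr => h _; rewrite ffunE mulrDr.
Qed.
Fact perm_scaleDl v : {morph perm_scale^~ v : a b / a + b}.
Proof.
move=> a b; apply/ffunP => C; rewrite !ffunE -big_split /=.
by apply: eq_bigr => h _; rewrite ffunE mulrDl.
Qed.

HB.instance Definition _ := GRing.Zmodule_isLmodule.Build (galg F gT)
  (perm_module F H) perm_scaleA perm_scale1 perm_scaleDr perm_scaleDl.

End PermutationModule.

(* [F[G/G]] is the trivial module. *)
Definition principal_block (F : fieldType) (gT : finGroupType)
    (b : block (galg F gT)) : Prop :=
  in_block b (perm_module F [set: gT]%G).

(* Permutations are multiplied from left to right in ['S_n]; inversion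
   identifies this group with the one multiplied from right to left. *)
Notation F2S n := (galg 'F_2 'S_n).

(* Partitions of [n], padded with zeros to length [n]. *)
Definition intpart (n : nat) : Type :=
  {l : n.-tuple 'I_n.+1 |
    sorted geq [seq val i | i <- l] && (sumn [seq val i | i <- l] == n)}.
HB.instance Definition _ (n : nat) := Finite.on (intpart n).

Definition parts (n : nat) (la : intpart n) : seq nat :=
  [seq nat_of_ord i | i <- val la].

Definition dominates (n : nat) (mu la : intpart n) : Prop :=
  forall k, (sumn (take k (parts la)) <= sumn (take k (parts mu)))%N.

(* [reshape_index (parts la) i] is the index of the interval containing [i] when
   0, ..., n-1 is cut into consecutive intervals of lengths [parts la]. *)
Definition young_subgroup_set (n : nat) (la : intpart n) : {set 'S_n} :=
  [set s : 'S_n | [forall i : 'I_n,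
    reshape_index (parts la) (s i) == reshape_index (parts la) i]].

Fact young_subgroup_group_set (n : nat) (la : intpart n) :
  group_set (young_subgroup_set la).
Proof.
apply/group_setP; split=> [|s t].
  by rewrite inE; apply/forallP => i; rewrite perm1.
rewrite !inE => /forallP hs /forallP ht; apply/forallP => i.
by rewrite permM (eqP (ht _)) (eqP (hs _)).
Qed.

Definition young_subgroup (n : nat) (la : intpart n) : {group 'S_n} :=
  Group (young_subgroup_group_set la).

Definition young_perm_module (n : nat) (la : intpart n) : lmodType (F2S n) :=
  perm_module 'F_2 (young_subgroup la).

(* [Y] is the family of the Young modules. The third clause gives the
   decomposition of [M^la] into indecomposables, which is unique by the
   Krull-Schmidt theorem: [Y^la] occurs once, and the other summands are [Y^mu]
   with [mu] dominating [la]. These conditions determine each [Y la] up to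
   isomorphism. *)
Definition young_modules (n : nat) (Y : intpart n -> lmodType (F2S n)) : Prop :=
  [/\ forall la, indecomposable (Y la),
      forall la mu, mod_iso (Y la) (Y mu) -> la = mu &
      forall la, exists (k : nat) (s : 'I_k -> intpart n),
        [/\ mod_iso (young_perm_module la) (dsum (fun i => Y (s i))),
            #|[set i | s i == la]| = 1%N &
            forall i, dominates (s i) la]].

Definition schur_algebra (n : nat) (Y : intpart n -> lmodType (F2S n)) :
  pzRingType := mod_end (dsum Y).

Definition schur_block (n : nat) (Y : intpart n -> lmodType (F2S n))
    (b : block (F2S n)) : pzRingType :=
  mod_end (dsum (fun la : {la : intpart n | `[< in_block b (Y la) >]} =>
                   Y (val la))).

(* Main.v *)
(* Call a module local projective if every covering family of maps into it has a
   split member, and relatively injective if every jointly monic family of maps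
   from it into local projectives has a split member.  These properties, and
   having at least 2^5 endomorphisms, are invariant under equivalence of module
   categories.  For an algebra A = F_2 S_n the local projectives are the A e with
   e idempotent and e A e local, and End (A e) = e A e.  For a Schur algebra
   they correspond to the Young modules, and the relatively injective ones
   to the Young modules A e; this uses that F_2 S_n is a symmetric algebra.  So
   all four statements follow from the sizes of the local corners e A e in the
   blocks: at most 2^4 for F_2 S_4, while the principal block of F_2 S_5 and the
   non-principal block of F_2 S_7 have a corner with at least 2^5 elements; at
   least 2^5 for the principal block of F_2 S_6, while that of F_2 S_7 has a
   corner with 2^4 elements.

   The corners are computed inside Hecke algebras q A q, where q is the sum of a
   subgroup Q of odd order and elements are vectors indexed by the double cosets
   of Q.  A block idempotent f is located without being known: f fixes or kills a
   local idempotent, the augmentation decides which for the projective cover of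
   the trivial module, e A e' <> 0 propagates it from e to e', and f <> 0 is
   central, hence a class function, so it cannot kill too many of the q.  In
   F_2 S_6 the sum of all transpositions has augmentation 1, so it is invertible
   in the principal block, and it kills the summands of the other blocks. *)

Require Import Defs.
From HB Require Import structures.
From mathcomp Require Import all_boot all_order all_fingroup all_algebra.
From mathcomp Require Import boolp.

Set Implicit Arguments.
Unset Strict Implicit.
Unset Printing Implicit Defensive.

Import GRing.Theory.
Local Open Scope ring_scope.

(** * Invariants of module categories *)

(** The functors of [morita_equivalent] are not assumed additive, so the invariants use only
    composition and equality of maps, and size is measured by an injection from a set with 2^5
    elements. Relative injectivity is there because a Schur algebra has a local projective for each
    Young module, projective or not, and only the projective ones have their endomorphisms given by
    a corner of the group algebra. Hecke algebras make corners computable: |Q| is odd, so q is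
    idempotent over F_2, q A q has one basis vector per double coset (about a hundred for S_7,
    against 5040), and an idempotent of q A q has the same corner there as in A. In A q the
    projective cover of a simple module D occurs as often as the dimension of the Q-fixed points of
    D, simple modules being absolutely simple here; each Q thus sees only some simple modules, and
    several Q are combined. Tables are built without proof and idempotents are literals; only the
    tests applied to them are proved sound. *)

Definition mklin (A : pzRingType) (U V : lmodType A) (f : U -> V)
  (H : forall a u v, f (a *: u + v) = a *: f u + f v) : {linear U -> V} :=
  HB.pack f (GRing.isLinear.Build A U V *:%R f H).

Lemma linear_inv (A : pzRingType) (U V : lmodType A) (f : {linear U -> V}) :
  bijective f -> exists2 g : {linear V -> U}, cancel f g & cancel g f.
Proof.
case=> g fg gf; have H a u v : g (a *: u + v) = a *: g u + g v.
  by apply: (can_inj fg); rewrite gf linearP !gf.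
by exists (mklin H).
Qed.

Section Submodule.
Variables (A : pzRingType) (V : lmodType A) (P : V -> Prop).
Hypothesis P0 : P 0.
Hypothesis PL : forall a u v, P u -> P v -> P (a *: u + v).

Let Pb : {pred V} := [pred v | `[< P v >]].
(** The closure proofs are arguments of the type, so that its module structure can be declared as an
    instance. *)
Definition subm of P 0 & (forall a u v, P u -> P v -> P (a *: u + v)) : Type :=
  {v : V | Pb v}.
Local Notation W := (subm P0 PL).
HB.instance Definition _ := SubChoice.on W.

Fact subm_closed : submod_closed Pb.
Proof.
split; first exact/asboolP.
by move=> a u v /asboolP Pu /asboolP Pv; apply/asboolP/PL.
Qed.
HB.instance Definition _ :=
  GRing.SubChoice_isSubLmodule.Build A V Pb W subm_closed.

Definition subm_val : {linear W -> V} := (\val : W -> V).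

Lemma subm_val_inj : injective subm_val. Proof. exact: val_inj. Qed.
Lemma subm_valP w : P (subm_val w). Proof. by apply/asboolP; apply: (valP w). Qed.
Lemma subm_lift (U : lmodType A) (f : {linear U -> V}) :
  (forall u, P (f u)) -> exists g : {linear U -> W}, f =1 subm_val \o g.
Proof.
move=> Pf; pose g u : W := Sub (f u) (introT (asboolP _) (Pf u)).
have H a u v : g (a *: u + v) = a *: g u + g v.
  by apply: val_inj; rewrite /= linearP.
by exists (mklin H).
Qed.
End Submodule.

Lemma dep_choice (I : Type) (T : I -> Type) (P : forall i, T i -> Prop) :
  (forall i, exists x, P i x) -> exists f : forall i, T i, forall i, P i (f i).
Proof. by move=> H; exists (fun i => sval (cid (H i))) => i; case: cid. Qed.

Definition monic (A : pzRingType) (U V : lmodType A) (f : {linear U -> V}) :=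
  forall (W : lmodType A) (g h : {linear W -> U}), f \o g =1 f \o h -> g =1 h.

Definition split_epi (A : pzRingType) (U V : lmodType A) (f : {linear U -> V}) :=
  exists s : {linear V -> U}, f \o s =1 id.

Definition split_mono (A : pzRingType) (U V : lmodType A) (f : {linear U -> V}) :=
  exists r : {linear V -> U}, r \o f =1 id.

(** Says that no proper submodule of [V] contains all the images: a monic [m] through which every
    [f i] factors must be an isomorphism. *)
Definition covers (A : pzRingType) (I : Type) (U : I -> lmodType A)
    (V : lmodType A) (f : forall i, {linear U i -> V}) :=
  forall (W : lmodType A) (m : {linear W -> V}), monic m ->
    (forall i, exists u : {linear U i -> W}, f i =1 m \o u) -> split_epi m.

Definition jointly_monic (A : pzRingType) (I : Type) (U : I -> lmodType A)
    (V : lmodType A) (f : forall i, {linear V -> U i}) :=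
  forall (W : lmodType A) (g h : {linear W -> V}),
    (forall i, f i \o g =1 f i \o h) -> g =1 h.

Definition local_projective (A : pzRingType) (V : lmodType A) :=
  forall (I : Type) (U : I -> lmodType A) (f : forall i, {linear U i -> V}),
    covers f -> exists i, split_epi (f i).

Definition rel_injective (A : pzRingType) (V : lmodType A) :=
  forall (I : Type) (U : I -> lmodType A) (f : forall i, {linear V -> U i}),
    (forall i, local_projective (U i)) -> jointly_monic f ->
    exists i, split_mono (f i).

Definition big_end (A : pzRingType) (V : lmodType A) :=
  exists g : 5.-tuple bool -> {linear V -> V},
    forall t t', g t =1 g t' -> t = t'.

(** An element [x] is the map [a |-> a x] from [A^o], so maps out of [A^o] test [f] on elements. *)
Lemma monic_inj (A : pzRingType) (U V : lmodType A) (f : {linear U -> V}) :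
  monic f <-> injective f.
Proof.
split=> [mf x y fxy|injf W g h fgh w]; last exact/injf/fgh.
have H (z : U) (a : A) (u v : A^o) :
    (a *: u + v : A) *: z = a *: ((u : A) *: z) + (v : A) *: z.
  by rewrite scalerDl scalerA.
have /(_ _ (1 : A)) := mf _ (mklin (H x)) (mklin (H y)).
rewrite /= !scale1r; apply => a /=.
by rewrite !linearZ /= fxy.
Qed.

Record equivalence_functor (A B : pzRingType) (F : mod_functor A B) : Prop := {
  eqf_full : forall (U V : lmodType A) (h : {linear F U -> F V}),
    exists f : {linear U -> V}, fmap F f =1 h;
  eqf_faithful : forall (U V : lmodType A) (f g : {linear U -> V}),
    fmap F f =1 fmap F g -> f =1 g;
  eqf_surj : forall V : lmodType B, exists (U : lmodType A)
    (a : {linear F U -> V}) (b : {linear V -> F U}), cancel a b /\ cancel b a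
}.

(** Naturality of [eta] makes [F] faithful, that of [eps] makes [G] faithful. Faithfulness of [G]
    then gives fullness of [F]: conjugating [G h] by [eta] yields a preimage of [h]. The same works
    with the roles exchanged. *)
Lemma morita_functors (A B : pzRingType) : morita_equivalent A B ->
  (exists F : mod_functor A B, equivalence_functor F) /\
  (exists G : mod_functor B A, equivalence_functor G).
Proof.
case=> F [G [eta [eps [etab etaN epsb epsN]]]].
have etaI U := linear_inv (etab U).
have epsI V := linear_inv (epsb V).
have Ff (U V : lmodType A) (f g : {linear U -> V}) : fmap F f =1 fmap F g -> f =1 g.
  move=> /linear_ext fg x; have [e _ _] := etaI V.
  apply: (bij_inj (etab V)).
  by have /= -> := etaN _ _ f x; have /= -> := etaN _ _ g x; rewrite fg.
have Gf (U V : lmodType B) (f g : {linear U -> V}) : fmap G f =1 fmap G g -> f =1 g.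
  move=> /linear_ext fg x; have [e _ eK] := epsI U.
  by rewrite -[x]eK; have /= <- := epsN _ _ f (e x); have /= <- := epsN _ _ g (e x); rewrite fg.
split.
  exists F; split=> // [U V h|V]; last first.
    by have [e eK Ke] := epsI V; exists (G V), (eps V), e.
  have [eU eUK KeU] := etaI U; have [eV eVK KeV] := etaI V.
  exists (eV \o (fmap G h \o eta U)); apply: Gf => x.
  rewrite -[x]KeU; have /= <- := etaN _ _ _ (eU x).
  by rewrite /= KeV.
exists G; split=> // [U V h|V]; last first.
  by have [e eK Ke] := etaI V; exists (F V), e, (eta V).
have [eU eUK KeU] := epsI U; have [eV eVK KeV] := epsI V.
exists (eps V \o (fmap F h \o eU)); apply: Ff => x.
apply: (bij_inj (epsb V)); have /= -> := epsN _ _ _ x.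
by rewrite /= eUK.
Qed.

Lemma fmapK (A B : pzRingType) (F : mod_functor A B) (U V W : lmodType A)
    (f : {linear V -> W}) (g : {linear U -> V}) x :
  fmap F f (fmap F g x) = fmap F (f \o g) x.
Proof. by rewrite fmap_comp. Qed.

Section Transport.
Variables (A B : pzRingType) (F : mod_functor A B).
Hypothesis FE : equivalence_functor F.

Lemma fmap_split_epi (U V : lmodType A) (f : {linear U -> V}) :
  split_epi (fmap F f) <-> split_epi f.
Proof.
split=> [[s fs]|[s fs]].
  have [s' s's] := eqf_full FE s; exists s'; apply: (eqf_faithful FE (f := f \o s') (g := idfun)) => x.
  by rewrite fmap_comp /= s's fmap_id; exact: fs.
exists (fmap F s) => x; rewrite /= fmapK.
suff -> : (f \o s : {linear _ -> _}) = idfun by rewrite fmap_id.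
exact: linear_ext.
Qed.

Lemma fmap_split_mono (U V : lmodType A) (f : {linear U -> V}) :
  split_mono (fmap F f) <-> split_mono f.
Proof.
split=> [[s fs]|[s fs]].
  have [s' s's] := eqf_full FE s; exists s'; apply: (eqf_faithful FE (f := s' \o f) (g := idfun)) => x.
  by rewrite fmap_comp /= s's fmap_id; exact: fs.
exists (fmap F s) => x; rewrite /= fmapK.
suff -> : (s \o f : {linear _ -> _}) = idfun by rewrite fmap_id.
exact: linear_ext.
Qed.

Lemma fmap_compE (U V W : lmodType A) (f : {linear V -> W}) (g : {linear U -> V})
  (h : {linear U -> W}) : h =1 f \o g -> fmap F h =1 fmap F f \o fmap F g.
Proof.
by move=> hfg x; rewrite /= fmapK; congr (fmap F _ x); apply: linear_ext.
Qed.

Lemma fmap_jointly_monic (I : Type) (U : I -> lmodType A) (V : lmodType A)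
    (f : forall i, {linear V -> U i}) :
  jointly_monic f -> jointly_monic (fun i => fmap F (f i)).
Proof.
move=> jf W g h gh; have [W' [a [b [ab ba]]]] := eqf_surj FE W.
have [g' gE] := eqf_full FE (g \o a); have [h' hE] := eqf_full FE (h \o a).
have gh' : g' =1 h'.
  apply: jf => i; apply: (eqf_faithful FE) => x.
  by rewrite !fmap_comp /= gE hE; exact: gh.
move=> w; rewrite -[w]ba; have /= <- := gE (b w); have /= <- := hE (b w).
by rewrite (linear_ext gh').
Qed.

Lemma fmap_monic (U V : lmodType A) (f : {linear U -> V}) : monic f -> monic (fmap F f).
Proof.
move=> mf W g h gh; apply: (@fmap_jointly_monic unit _ _ (fun _ => f)).
  by move=> W' g' h' /(_ tt); apply: mf.
by case.
Qed.

(** The sources [U i] are replaced by isomorphic modules [F (U' i)]; fullness then moves the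
    covering family back to [A]. *)
Lemma fmap_local_projective V : local_projective V -> local_projective (F V).
Proof.
move=> lpV I U f cf.
have {}/dep_choice[U' aU] := fun i => eqf_surj FE (U i).
have /dep_choice[h hE] (i : I) : exists h : {linear U' i -> V},
    exists b : {linear U i -> F (U' i)}, exists a : {linear F (U' i) -> U i},
    [/\ fmap F h =1 f i \o a, cancel a b & cancel b a].
  have [a [b [ab ba]]] := aU i.
  by have [h hE] := eqf_full FE (f i \o a); exists h, b, a.
have [|i [s hs]] := lpV I U' h.
  move=> W m mm mh; apply/fmap_split_epi; apply: cf => [|i]; first exact: fmap_monic.
  have [b [a [hi ab ba]]] := hE i; have [u hu] := mh i.
  exists (fmap F u \o b) => x; rewrite -[x in LHS]ba.
  by have /= <- := hi (b x); have /= -> := fmap_compE hu (b x).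
exists i; have [b [a [hi ab ba]]] := hE i; exists (a \o fmap F s) => x /=.
have /= <- := hi (fmap F s x); rewrite (fmapK (h i) s x).
suff -> : (h i \o s : {linear _ -> _}) = idfun by rewrite fmap_id.
exact: linear_ext.
Qed.

Lemma fmap_big_end V : big_end V <-> big_end (F V).
Proof.
split=> [[g gI]|[g gI]].
  by exists (fun t => fmap F (g t)) => t t' /(eqf_faithful FE)/gI.
have /dep_choice[g' gE] := fun t => eqf_full FE (g t).
exists g' => t t' /linear_ext tt'; apply: gI => x.
by rewrite -!gE tt'.
Qed.
End Transport.

Lemma local_projective_iso (A : pzRingType) (V V' : lmodType A)
    (a : {linear V -> V'}) (b : {linear V' -> V}) :
  cancel a b -> cancel b a -> local_projective V -> local_projective V'.
Proof.
move=> ab ba lpV I U f cf.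
have [|i [s fs]] := lpV I U (fun i => b \o f i).
  move=> W m mm mf; have [||s ms] := cf W (a \o m).
  - move=> W' g h gh; apply: mm => x; exact/(can_inj ab)/gh.
  - by move=> i; have [u fu] := mf i; exists u => x /=; have /= <- := fu x; rewrite ba.
  by exists (s \o a) => x /=; apply: (can_inj ab); exact: ms.
by exists i, (s \o b) => x /=; apply: (can_inj ba); exact: fs.
Qed.

(** [rel_injective] quantifies over local projective targets; those given over [B] must be
    recognised as local projective over [A]. *)
Lemma local_projective_reflect (A B : pzRingType) (F : mod_functor A B) V :
  equivalence_functor F -> local_projective (F V) -> local_projective V.
Proof.
move=> FE lpV I U f cf.
have [|i] := lpV I _ (fun i => fmap F (f i)); last first.
  by move=> /(fmap_split_epi FE); exists i.
move=> W m mm mf.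
have [W' [a [b [ab ba]]]] := eqf_surj FE W.
have [m' m'E] := eqf_full FE (m \o a).
suff /(fmap_split_epi FE)[s m's] : split_epi m'.
  by exists (a \o s) => x /=; have /= <- := m'E (s x); exact: m's.
apply: cf => [W1 g h gh|i].
  apply: (eqf_faithful FE) => x; apply: (can_inj ab).
  apply: (monic_inj m).1 => //; have /= <- := m'E (fmap F g x).
  have /= <- := m'E (fmap F h x).
  rewrite (fmapK m' g) (fmapK m' h).
  by congr (fmap F _ x); apply: linear_ext.
have [u fu] := mf i; have [u' u'E] := eqf_full FE (b \o u).
exists u'; apply: (eqf_faithful FE) => x.
rewrite fmap_comp fu /= m'E /=; have /= -> := u'E x.
by rewrite ba.
Qed.

Lemma fmap_rel_injective (A B : pzRingType) (F : mod_functor A B) V :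
  equivalence_functor F -> rel_injective V -> rel_injective (F V).
Proof.
move=> FE riV I U f lpU jf.
have {}/dep_choice[U' aU] := fun i => eqf_surj FE (U i).
have /dep_choice[h hE] (i : I) : exists h : {linear V -> U' i},
    exists b : {linear U i -> F (U' i)}, exists a : {linear F (U' i) -> U i},
    [/\ fmap F h =1 b \o f i, cancel a b & cancel b a].
  have [a [b [ab ba]]] := aU i.
  by have [h hE] := eqf_full FE (b \o f i); exists h, b, a.
have [||i /(fmap_split_mono FE)[r rh]] := riV I U' h.
- move=> i; have [b [a [hi ab ba]]] := hE i.
  exact: (local_projective_reflect FE (local_projective_iso ba ab (lpU i))).
- move=> W g k gk; apply: (eqf_faithful FE); apply: jf => i x /=.
  have [b [a [hi ab ba]]] := hE i; apply: (can_inj ba).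
  have /= <- := hi (fmap F g x); have /= <- := hi (fmap F k x).
  rewrite (fmapK _ g) (fmapK _ k).
  by congr (fmap F _ x); apply: linear_ext; exact: gk.
have [b [a [hi ab ba]]] := hE i.
by exists i, (r \o b) => x; rewrite /= -{}[RHS]rh /= hi.
Qed.

(** * Local projectives, idempotents and their corners *)

Definition generated (A : pzRingType) (V : lmodType A) (D : V -> Prop) :=
  forall P : V -> Prop, P 0 -> (forall a u v, P u -> P v -> P (a *: u + v)) ->
    (forall v, D v -> P v) -> forall v, P v.

(** In one direction the inclusion of the submodule [P] is the test map; in the other, an injective
    map whose image contains generators has a linear inverse. *)
Lemma coversP (A : pzRingType) (I : Type) (U : I -> lmodType A)
    (V : lmodType A) (f : forall i, {linear U i -> V}) :
  covers f <-> generated (fun v => exists i u, v = f i u).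
Proof.
split=> [cf P P0 PL Pf v|gf W m /monic_inj mI mf].
  have [||s sE] := cf _ (subm_val P0 PL).
  - exact/monic_inj/subm_val_inj.
  - by move=> i; apply: subm_lift => u; apply: Pf; exists i, u.
  by have /= <- := sE v; exact: subm_valP.
have /dep_choice[g gE] : forall v, exists w, m w = v.
  apply: gf => [|a u v [w <-] [w' <-]|v [i [u ->]]].
  - by exists 0; rewrite linear0.
  - by exists (a *: w + w'); rewrite linearP.
  - by have [h hE] := mf i; exists (h u).
have gH a u v : g (a *: u + v) = a *: g u + g v.
  by apply: mI; rewrite linearP !gE.
by exists (mklin gH).
Qed.

(** The empty family covers a zero module and has no split member. *)
Lemma local_projective_neq0 (A : pzRingType) (V : lmodType A) :
  local_projective V -> exists v : V, v != 0.
Proof.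
move=> lpV; apply: contrapT => /forallNP V0.
have [|[]] := lpV False (fun=> V) (fun=> idfun).
apply/coversP => P P0 PL _ v.
by have /negP/negPn/eqP -> := V0 v.
Qed.

(** Presents [V] as a direct summand of the left ideal [A e]: the map [a |-> a x] onto [V] has the
    section [s]. If moreover [s x = e], then [V] is isomorphic to [A e]. *)
Definition rank_one (A : pzRingType) (V : lmodType A) (e : A) (x : V)
    (s : {linear V -> A^o}) :=
  [/\ e *: x = x, forall v, (s v : A) *: x = v & forall v, (s v : A) * e = s v].

Section RankOne.
Variables (A : pzRingType) (V : lmodType A).

(** The maps [a |-> a E_i y] from the regular module cover [V]; a section of one of them, multiplied
    by [E_i] on the right, takes values in [A E_i]. *)
Lemma local_projective_rank_one (I : Type) (E : I -> A) :
    local_projective V -> (forall i, E i * E i = E i) ->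
    generated (fun v : V => exists i y, v = E i *: y) ->
  exists i x s, rank_one (E i) (x : V) s.
Proof.
move=> lpV EE gV.
have H (y : V) (a : A) (u v : A^o) :
    (a *: u + v : A) *: y = a *: ((u : A) *: y) + (v : A) *: y.
  by rewrite scalerDl scalerA.
have [|[i y] [s sE]] := lpV (I * V)%type (fun=> A^o)
    (fun iy => mklin (H (E iy.1 *: iy.2))).
  apply/coversP => P P0 PL HP; apply: gV => // v [i [y ->]].
  by apply: HP; exists (i, y), (1 : A); rewrite /= scale1r.
have H' (a : A) (u v : V) :
    ((s (a *: u + v) : A) * E i : A^o) = a *: ((s u : A) * E i : A^o) + (s v : A) * E i.
  by rewrite linearP mulrDl [in RHS]/GRing.scale /= mulrA.
exists i, (E i *: y), (mklin H'); split=> [|v|v] /=.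
- by rewrite scalerA EE.
- by rewrite scalerA -mulrA EE -scalerA; exact: sE.
- by rewrite -mulrA EE.
Qed.

Variables (e : A) (x : V) (s : {linear V -> A^o}).
Hypotheses (ee : e * e = e) (exs : rank_one e x s).

Let ex : e *: x = x. Proof. by case: exs. Qed.
Let sK v : (s v : A) *: x = v. Proof. by case: exs. Qed.
Let se v : (s v : A) * e = s v. Proof. by case: exs. Qed.
Let sZ a v : s (a *: v) = a * (s v : A). Proof. exact: linearZ. Qed.

Lemma rank_one_corner (f : {linear V -> V}) :
  e * (s (f x) : A) = s (f x) /\ (s (f x) : A) * e = s (f x).
Proof. by rewrite se -sZ -linearZ ex. Qed.

Definition corner_unit (r r' : A) :=
  [/\ e * r' = r', r' * e = r', r * r' = e & r' * r = e].

(** For a finite nonzero corner this is locality: some power of each element is idempotent, so a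
    non-unit of a finite local ring is nilpotent. *)
Definition corner_local :=
  forall r, e * r = r -> r * e = r ->
    (exists n, r ^+ n.+1 = 0) \/ exists r', corner_unit r r'.

Definition big_corner :=
  exists2 g : 5.-tuple bool -> A, injective g &
    forall t, e * g t = g t /\ g t * e = g t.

Lemma corner_local_idem r : corner_local ->
  e * r = r -> r * e = r -> r * r = r -> r = 0 \/ r = e.
Proof.
move=> loc er re rr; have [[n]|[r' [_ _ _ r'r]]] := loc r er re.
  rewrite (_ : r ^+ n.+1 = r); first by left.
  by elim: n => [|n IH]; rewrite ?expr1 // exprS IH.
by right; have := congr1 (fun z => r' * z) rr; rewrite mulrA r'r er.
Qed.

(** [s x] is an idempotent of the local corner, hence 0 or [e], and 0 would make [V] trivial. *)
Lemma rank_one_local (v : V) : v != 0 -> corner_local -> (s x : A) = e.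
Proof.
move=> v0 loc; have [er re] := rank_one_corner idfun.
have [|sx0|//] := corner_local_idem loc er re.
  by rewrite -sZ sK.
by case/eqP: v0; rewrite -[v]sK -[x]sK sx0 scale0r scaler0.
Qed.

Lemma big_end_corner : big_end V -> big_corner.
Proof.
case=> g gI; exists (fun t => s (g t x)) => [t t' tt'|t]; last exact: rank_one_corner.
apply: gI => v; rewrite -[v]sK !linearZ /=; congr (_ *: _).
by rewrite -[LHS]sK tt' sK.
Qed.

Lemma big_corner_end : (s x : A) = e -> big_corner -> big_end V.
Proof.
move=> sx [g gI ge].
have H t a u v : ((s (a *: u + v) : A) * g t) *: x =
    a *: (((s u : A) * g t) *: x) + ((s v : A) * g t) *: x.
  by rewrite linearP mulrDl scalerDl [X in (X * _) *: _]/GRing.scale /= -mulrA scalerA.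
exists (fun t => mklin (H t)) => t t' /(_ x) /=; rewrite sx !(ge _).1.
move=> /(congr1 s); rewrite !sZ sx !(ge _).2; exact: gI.
Qed.
End RankOne.

Section LocalRetract.
Variables (A : pzRingType) (V : lmodType A).
Variables (i : {linear V -> A^o}) (p : {linear A^o -> V}).
Hypotheses (pi : cancel i p).

Definition nil_end (r : V -> V) := exists n, forall y, iter n r y = 0.

Hypothesis locV : forall r : {linear V -> V},
  nil_end r \/ exists2 r' : {linear V -> V}, cancel r r' & cancel r' r.
Variable v0 : V.
Hypothesis v0N : v0 != 0.

Let H (v : V) (a : A) (y z : V) :
  (i (a *: y + z) : A) *: v = a *: ((i y : A) *: v) + (i z : A) *: v.
Proof. by rewrite linearP scalerDl -scalerA. Qed.
Let e v : {linear V -> V} := mklin (H v).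

Let nil_sum (g h : {linear V -> V}) :
  nil_end g -> nil_end h -> (forall y, g y + h y = y) -> False.
Proof.
case=> n gn [m hm] gh.
(* A nonzero kernel vector of the nilpotent [g] is fixed by [h], which is nilpotent too. *)
have [y y0 gy] : exists2 y, y != 0 & g y = 0.
  have: exists y, y != 0 /\ iter n g y = 0 by exists v0.
  elim: n {gn} => [[y [y0 /= yE]]|n IH [y [y0]]]; first by rewrite yE eqxx in y0.
  rewrite iterSr => gy; have [gy0|gy0] := eqVneq (g y) 0; first by exists y.
  by apply: IH; exists (g y).
have hy : h y = y by rewrite -[RHS]gh gy add0r.
have := hm y; rewrite (_ : iter m h y = y); first by move/eqP; rewrite (negPf y0).
by elim: m {hm} => //= m ->.
Qed.

(** If no [f k] is split, the elements [v] for which all [e (b *: v)] are nilpotent form a submodule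
    containing every image, hence everything. But [e (p 1)] is the identity. *)
Lemma local_retract : local_projective V.
Proof.
move=> I U f /coversP gf; apply: contrapT => nsplit.
pose N v := forall b : A, nil_end (e (b *: v)).
(* An endomorphism [t] is determined by [t (p 1)], so [e v] composed with [t] is again of the form
   [e (a *: v)]. *)
have eM v (t : {linear V -> V}) y :
    e v (t y) = e ((i (t (p 1)) : A) *: v) y.
  have -> : t y = (i y : A) *: t (p 1).
    rewrite -!linearZ; congr (t _); rewrite -[LHS]pi; congr (p _).
    by rewrite /GRing.scale /= mulr1.
  by rewrite /= linearZ; exact/esym/scalerA.
have Nf k u : N (f k u).
  move=> b.
  have Hu (a : A) (y z : V) : (i (a *: y + z) : A) *: (b *: u) =
      a *: ((i y : A) *: (b *: u)) + (i z : A) *: (b *: u).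
    by rewrite linearP scalerDl -scalerA.
  case: (locV (e (b *: f k u))) => // -[r' _ r'K]; case: nsplit.
  by exists k, (mklin Hu \o r') => y; rewrite /= !linearZ; exact: r'K.
have Nall v : N v.
  apply: gf v => [b|a u v Nu Nv b|v [k [u ->]]]; last exact: Nf.
    by exists 1%N => y /=; rewrite !scaler0.
  case: (locV (e (b *: (a *: u + v)))) => // -[t tK Kt].
  exfalso; apply: (@nil_sum (e (b *: (a *: u)) \o t) (e (b *: v) \o t)).
  - have [n nE] := Nu ((i (t (p 1)) : A) * b * a); exists n => y.
    rewrite -[RHS](nE y); apply: eq_iter => z /=.
    by have /= -> := eM (b *: (a *: u)) t z; rewrite !scalerA !mulrA.
  - have [n nE] := Nv ((i (t (p 1)) : A) * b); exists n => y.
    rewrite -[RHS](nE y); apply: eq_iter => z /=.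
    by have /= -> := eM (b *: v) t z; rewrite !scalerA !mulrA.
  - by move=> y; rewrite -[RHS]Kt /= -scalerDr -scalerDr.
have [n] := Nall (p 1) 1; move=> /(_ v0).
rewrite (_ : iter n _ v0 = v0); first by move/eqP; apply/negP.
elim: n => //= n ->; rewrite scale1r -linearZ /=.
by rewrite [X in p X]/GRing.scale /= mulr1.
Qed.
End LocalRetract.

(** The last clause says that maps with values in [A e] factor through the module, so that its
    construction as a submodule stays hidden. *)
Lemma left_ideal_module (A : pzRingType) (e : A) : e * e = e ->
  exists (V : lmodType A) (x : V) (s : {linear V -> A^o}),
    [/\ rank_one e x s, (s x : A) = e &
      forall (U : lmodType A) (f : {linear U -> A^o}),
        (forall u, (f u : A) * e = f u) -> exists g : {linear U -> V}, f =1 s \o g].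
Proof.
move=> ee; pose P (a : A^o) := (a : A) * e = a.
have P0 : P 0 by rewrite /P mul0r.
have PL (a : A) (u v : A^o) : P u -> P v -> P (a *: u + v).
  by rewrite /P mulrDl => {2}<- {2}<-; rewrite -mulrA.
have H (a : A) (u v : A^o) : (a *: u + v : A) * e = a *: (u * e : A^o) + v * e :> A.
  by rewrite mulrDl /GRing.scale /= mulrA.
have [a|g gE] := subm_lift P0 PL
  (f := @mklin A A^o A^o (fun a : A^o => (a : A) * e) H).
  by rewrite /P /= -mulrA ee.
have vE v : (subm_val P0 PL v : A) * e = subm_val P0 PL v by exact: (subm_valP v).
have sg a : (subm_val P0 PL (g a) : A) = (a : A) * e by exact/esym/gE.
exists (subm P0 PL), (g e), (subm_val P0 PL); split; first split.
- by apply: (@subm_val_inj _ _ P P0 PL); rewrite linearZ sg ee; exact: ee.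
- move=> v; apply: (@subm_val_inj _ _ P P0 PL).
  by rewrite linearZ sg ee; exact: vE.
- exact: vE.
- by rewrite sg.
- by move=> U f fe; apply: (subm_lift P0 PL).
Qed.

(** An endomorphism [r] is right multiplication by the corner element [s (r x)], so it is nilpotent
    or invertible along with that element, and [local_retract] applies. *)
Lemma local_left_ideal (A : pzRingType) (e : A) (V : lmodType A) (x : V)
    (s : {linear V -> A^o}) :
  e * e = e -> e != 0 -> corner_local e -> rank_one e x s -> (s x : A) = e ->
  local_projective V.
Proof.
move=> ee e0 loc exs sx; have [ex sK se] := exs.
have sZ a v : s (a *: v) = a * (s v : A) by exact: linearZ.
have H (a : A) (u v : A^o) :
    (a *: u + v : A) *: x = a *: ((u : A) *: x) + (v : A) *: x.
  by rewrite scalerDl scalerA.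
have x0 : x != 0 by apply: contra_neq e0 => x0; rewrite -sx x0 linear0.
apply: (@local_retract _ _ s (mklin H) sK _ x x0) => r.
have [er re] := rank_one_corner exs r.
have rE v : r v = (s v : A) *: r x by rewrite -linearZ sK.
have [[n rn]|[r' [er' r'e rr' r'r]]] := loc _ er re.
  left; exists n.+1 => y; rewrite -[RHS](scale0r x) -(mulr0 (s y : A)) -rn {rn}.
  elim: n.+1 y => [|m IH] y; first by rewrite expr0 mulr1 sK.
  by rewrite iterSr IH rE sZ exprS mulrA.
right.
have H' (a : A) (u v : V) :
    ((s (a *: u + v) : A) * r') *: x = a *: (((s u : A) * r') *: x) + ((s v : A) * r') *: x.
  by rewrite linearP mulrDl scalerDl [X in (X * _) *: _]/GRing.scale /= -mulrA scalerA.
exists (mklin H') => v /=.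
  by rewrite rE sZ -mulrA rr' se sK.
rewrite (_ : r _ = ((s v : A) * r') *: ((s (r x) : A) *: x)).
  by rewrite scalerA -mulrA r'r se sK.
by rewrite sK -linearZ.
Qed.

(** [V] is the direct sum of the image and the kernel of [r]. *)
Lemma idempotent_indecomposable (A : pzRingType) (V : lmodType A)
    (r : {linear V -> V}) : indecomposable V -> (forall v, r (r v) = r v) ->
  (forall v, r v = 0) \/ (forall v, r v = v).
Proof.
case=> _ indV rr; pose P v := r v = v; pose Q v := r v = 0.
have P0 : P 0 by rewrite /P linear0.
have PL a u v : P u -> P v -> P (a *: u + v) by rewrite /P linearP => -> ->.
have Q0 : Q 0 by rewrite /Q linear0.
have QL a u v : Q u -> Q v -> Q (a *: u + v).
  by rewrite /Q linearP => -> ->; rewrite scaler0 addr0.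
have [g gE] := subm_lift P0 PL (f := r) rr.
have [v|h hE] := subm_lift Q0 QL (f := (idfun : {linear V -> V}) \- r).
  by rewrite /Q /= linearB rr subrr.
have {}gE v : subm_val P0 PL (g v) = r v by rewrite gE.
have {}hE v : subm_val Q0 QL (h v) = v - r v by exact/esym/hE.
have H a u v : (g (a *: u + v), h (a *: u + v)) =
    a *: (g u, h u) + (g v, h v) :> (subm P0 PL * subm Q0 QL)%type.
  by rewrite !linearP.
have bij : bijective (mklin H).
  exists (fun w => subm_val P0 PL w.1 + subm_val Q0 QL w.2) => [v|[u w]] /=.
    by move: (gE v) (hE v) => /= -> ->; rewrite addrC subrK.
  have Pu : r (subm_val P0 PL u) = subm_val P0 PL u := subm_valP u.
  have Qw : r (subm_val Q0 QL w) = 0 := subm_valP w.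
  congr (_, _).
    by apply: (@subm_val_inj _ _ P P0 PL); rewrite gE linearD Pu Qw addr0.
  apply: (@subm_val_inj _ _ Q Q0 QL).
  by rewrite hE linearD Pu Qw addr0 addrAC subrr add0r.
case: (indV _ _ (ex_intro _ _ bij)) => Z.
  by left=> v; rewrite -gE (Z (g v)) linear0.
by right=> v; apply/esym/eqP; rewrite -subr_eq0 -hE (Z (h v)) linear0.
Qed.

Fixpoint iter_lin (A : pzRingType) (V : lmodType A) n (r : {linear V -> V}) :
    {linear V -> V} :=
  if n is m.+1 then r \o iter_lin m r else idfun.

Lemma iter_linE (A : pzRingType) (V : lmodType A) n (r : {linear V -> V}) v :
  iter_lin n r v = iter n r v.
Proof. by elim: n => //= n ->. Qed.

(** Fitting's lemma for a finite module: some iterate of [r] is idempotent, hence zero or the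
    identity. *)
Lemma fitting (A : pzRingType) (V : lmodType A) (T : finType) (g : V -> T)
    (r : {linear V -> V}) : injective g -> indecomposable V ->
  nil_end r \/ exists2 r' : {linear V -> V}, cancel r r' & cancel r' r.
Proof.
move=> gI indV.
have [a [d [d0 rE]]] : exists a d, (0 < d)%N /\ forall v, iter (a + d) r v = iter a r v.
  (* [V] only injects into the finite type [T], so the iterates are recorded as partial maps on [T]
     for the pigeonhole principle. *)
  pose h n := [ffun t : T => [pick t' | `[< exists2 v, g v = t & g (iter n r v) = t' >]]].
  have hE n v : h n (g v) = Some (g (iter n r v)).
    rewrite ffunE; case: pickP => [t' /asboolP[w /gI -> <-] //|].
    by move=> /(_ (g (iter n r v)))/asboolP[]; exists v.
  pose N := #|{ffun T -> option T}|.
  have: ~ injective (fun n : 'I_N.+1 => h n).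
    by move=> /leq_card; rewrite card_ord ltnn.
  move=> /existsNP[a /existsNP[b /not_implyP[hab /eqP ab]]].
  wlog lt_ab : a b hab ab / (a < b)%N => [W|].
    by case: (ltngtP a b) => [||/val_inj/eqP]; [apply: W|apply: W; rewrite // eq_sym|rewrite (negPf ab)].
  exists a, (b - a)%N; split=> [|v]; first by rewrite subn_gt0.
  rewrite subnKC ?(ltnW lt_ab) //; apply: gI; apply: Some_inj.
  by rewrite -!hE hab.
have rmul m v : iter (a + m * d) r v = iter a r v.
  elim: m => [|m IH]; first by rewrite mul0n addn0.
  have -> : (a + m.+1 * d = m * d + (a + d))%N by rewrite mulSn addnA addnC.
  by rewrite iterD rE -iterD addnC.
(* A multiple of the period [d] that is at least [a]: this iterate is idempotent. *)
pose n := (a.+1 * d)%N.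
have rn v : iter n r (iter n r v) = iter n r v.
  have an : (a <= n)%N by rewrite /n (leq_trans (leqnSn a)) // leq_pmulr.
  have -> : iter n r v = iter (n - a + a) r v by rewrite subnK.
  have -> : iter n r (iter (n - a + a) r v) = iter (n - a + (a + n)) r v.
    by rewrite -iterD addnC -addnA.
  by rewrite iterD rmul -iterD.
have [v|Z|Z] := idempotent_indecomposable (r := iter_lin n r) indV.
- by rewrite !iter_linE rn.
- by left; exists n => v; rewrite -iter_linE.
have n1 : n = n.-1.+1 by rewrite prednK // muln_gt0.
right; exists (iter_lin n.-1 r) => v.
  by rewrite iter_linE -iterSr -n1 -iter_linE Z.
by rewrite iter_linE -iterS -n1 -iter_linE Z.
Qed.

Lemma big_end_iso (A : pzRingType) (V W : lmodType A) (f : {linear V -> W})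
    (g : {linear W -> V}) : cancel f g -> big_end V -> big_end W.
Proof.
move=> fK [h hI]; exists (fun t => f \o (h t \o g)) => t t' tt'.
by apply: hI => v; apply: (can_inj fK); have /= := tt' (f v); rewrite fK.
Qed.

(** * Modules over endomorphism rings *)

Section EndomorphismRing.
Variables (A : pzRingType) (I : finType) (Z : I -> lmodType A).
Let S : pzRingType := mod_end (dsum Z).

Definition dsum_inj_fun i (z : Z i) : dsum Z := dfwith (fun j => 0 : Z j) z.

Fact dsum_inj_linear i (a : A) (u v : Z i) :
  dsum_inj_fun (a *: u + v) = a *: dsum_inj_fun u + dsum_inj_fun v.
Proof.
apply: functional_extensionality_dep => j.
change (dsum_inj_fun (a *: u + v) j = a *: dsum_inj_fun u j + dsum_inj_fun v j).
rewrite /dsum_inj_fun; have [<-|ij] := eqVneq i j; first by rewrite !dfwith_in.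
by rewrite !dfwith_out // scaler0 addr0.
Qed.
Definition dsum_inj i : {linear Z i -> dsum Z} := mklin (@dsum_inj_linear i).

Fact dsum_proj_linear i (a : A) (u v : dsum Z) :
  (a *: u + v) i = a *: u i + v i.
Proof. by []. Qed.
Definition dsum_proj i : {linear dsum Z -> Z i} :=
  @mklin A (dsum Z) (Z i) (fun v => v i) (@dsum_proj_linear i).

Lemma dsum_injK i z : dsum_proj i (dsum_inj i z) = z.
Proof. exact: dfwith_in. Qed.

Lemma dsum_inj_out i j z : i != j -> dsum_proj j (dsum_inj i z) = 0.
Proof. by move=> ij; apply: dfwith_out. Qed.

Lemma dsum_addE (u v : dsum Z) i : (u + v) i = u i + v i. Proof. by []. Qed.

Lemma dsum_sumE (J : Type) (r : seq J) (F : J -> dsum Z) i :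
  (\sum_(j <- r) F j) i = \sum_(j <- r) F j i.
Proof.
elim: r => [|j r IH]; first by rewrite !big_nil.
by rewrite !big_cons dsum_addE IH.
Qed.

Lemma dsum_split (v : dsum Z) : v = \sum_i dsum_inj i (dsum_proj i v).
Proof.
apply: functional_extensionality_dep => j; rewrite dsum_sumE (bigD1 j) //=.
rewrite big1 => [|i ij]; last exact: dsum_inj_out.
by rewrite addr0; apply/esym; exact: dsum_injK.
Qed.

Definition hom_end i j (h : {linear Z i -> Z j}) : S :=
  (dsum_inj j \o (h \o dsum_proj i) : {linear dsum Z -> dsum Z}).

Definition comp_end (i j : I) (f : S) : {linear Z i -> Z j} :=
  dsum_proj j \o ((f : {linear dsum Z -> dsum Z}) \o dsum_inj i).

Definition id_end i : S := hom_end (idfun : {linear Z i -> Z i}).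

Lemma endP (f g : S) :
  (forall v, (f : {linear _ -> _}) v = (g : {linear _ -> _}) v) -> f = g.
Proof. exact: linear_ext. Qed.

Lemma hom_endM i j k (h : {linear Z j -> Z k}) (h' : {linear Z i -> Z j}) :
  hom_end h * hom_end h' = hom_end (h \o h').
Proof.
apply: endP => v.
exact: (congr1 (fun z => dsum_inj k (h z)) (dsum_injK (h' (dsum_proj i v)))).
Qed.

Lemma id_endM i j (f : S) : id_end j * f * id_end i = hom_end (comp_end i j f).
Proof. exact: endP. Qed.

Lemma hom_endK i j (h : {linear Z i -> Z j}) z : comp_end i j (hom_end h) z = h z.
Proof.
exact: etrans (dsum_injK (h _)) (congr1 h (dsum_injK z)).
Qed.

Lemma hom_end_ext i j (h h' : {linear Z i -> Z j}) :
  h =1 h' -> hom_end h = hom_end h'.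
Proof. by move=> /linear_ext ->. Qed.

Lemma hom_end_idl i j (h : {linear Z i -> Z j}) : id_end j * hom_end h = hom_end h.
Proof. by rewrite hom_endM; apply: hom_end_ext. Qed.
Lemma hom_end_idr i j (h : {linear Z i -> Z j}) : hom_end h * id_end i = hom_end h.
Proof. by rewrite hom_endM; apply: hom_end_ext. Qed.

Lemma id_end_idem i : id_end i * id_end i = id_end i.
Proof. exact: hom_end_idl. Qed.

Lemma sum_id_end : \sum_i id_end i = 1.
Proof.
apply: endP => v; rewrite [RHS]/= [RHS]dsum_split.
elim/big_rec2: _ => // i _ f _ <-; by [].
Qed.

Hypothesis indZ : forall i, indecomposable (Z i).
Hypothesis locZ : forall i (r : {linear Z i -> Z i}),
  nil_end r \/ exists2 r' : {linear Z i -> Z i}, cancel r r' & cancel r' r.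

Lemma indZ_neq0 i : exists z : Z i, z != 0.
Proof.
have [nz _] := indZ i; apply: contrapT => /forallNP z0; apply: nz => z.
by apply/eqP/negPn/negP/z0.
Qed.

Lemma id_end_neq0 i : id_end i != 0.
Proof.
have [z z0] := indZ_neq0 i; apply: contra_neq z0 => e0.
have := hom_endK (idfun : {linear Z i -> Z i}) z; rewrite -/(id_end i) e0 /= => <-.
by [].
Qed.

Lemma id_end_local i : corner_local (id_end i).
Proof.
move=> f ef fe; have fE : f = hom_end (comp_end i i f) by rewrite -id_endM ef fe.
have [[n hn]|[r' rK Kr]] := locZ (comp_end i i f).
  left; exists n; rewrite fE; apply: endP => v.
  have H m : hom_end (comp_end i i f) ^+ m.+1 = hom_end (iter_lin m.+1 (comp_end i i f)).
    elim: m => [|m IH]; first by rewrite expr1; apply: hom_end_ext.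
    by rewrite exprS IH hom_endM; apply: hom_end_ext.
  rewrite H /hom_end; change (dsum_inj i (iter_lin n.+1 (comp_end i i f) (dsum_proj i v)) = 0).
  by rewrite iter_linE iterS hn !linear0.
right; exists (hom_end r'); split.
- exact: hom_end_idl.
- exact: hom_end_idr.
- by rewrite fE hom_endM; apply: hom_end_ext => z; exact: Kr.
- by rewrite fE hom_endM; apply: hom_end_ext => z; exact: rK.
Qed.

Lemma big_id_end i : big_corner (id_end i) <-> big_end (Z i).
Proof.
split=> [[g gI gE]|[g gI]].
  exists (fun t => comp_end i i (g t)) => t t' /hom_end_ext tt'; apply: gI.
  by move: tt'; rewrite -!id_endM !(gE _).1 !(gE _).2.
exists (fun t => hom_end (g t)) => [t t' tt'|t].
  by apply: gI => z; rewrite -[LHS]hom_endK tt' hom_endK.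
by rewrite hom_end_idl hom_end_idr.
Qed.

Lemma end_generated (X : lmodType S) :
  generated (fun v : X => exists i y, v = id_end i *: y).
Proof.
move=> P P0 PL HP v; rewrite -[v]scale1r -sum_id_end scaler_suml.
elim/big_ind: _ => // [u w Pu Pw|i _]; last by apply: HP; exists i, v.
by rewrite -[u]scale1r; apply: PL.
Qed.

Lemma end_rank_one (X : lmodType S) : local_projective X ->
  exists i x s, rank_one (id_end i) (x : X) s /\ (s x : S) = id_end i.
Proof.
move=> lpX; have [v v0] := local_projective_neq0 lpX.
have [i [x [s xs]]] := local_projective_rank_one lpX id_end_idem (@end_generated X).
exists i, x, s; split=> //.
exact: (rank_one_local xs v0 (@id_end_local i)).
Qed.

Variables (K : finType) (t : K -> I).
Variables (p : forall k, {linear A^o -> Z (t k)}) (q : forall k, {linear Z (t k) -> A^o}).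
Hypothesis qK : forall k, cancel (q k) (p k).
Let u : A := \sum_k (q k (p k (1 : A)) : A).
Hypothesis uC : forall a, u * a = a * u.
Hypothesis uZ : forall i (z : Z i), u *: z = z.

Let pE k (a : A) : p k a = a *: p k (1 : A).
Proof. by rewrite -linearZ; congr (p k _); rewrite /GRing.scale /= mulr1. Qed.

Let sum_qp (a : A) : \sum_k (q k (p k a) : A) = a * u.
Proof.
rewrite mulr_sumr; apply: eq_bigr => k _.
by rewrite pE linearZ.
Qed.

(** [X] is isomorphic to [S e_i] with [e_i = id_end i]. Right multiplication by maps
    [Z (t k) -> Z i] sends it to the local projectives [S e_(t k)], and this family is jointly monic
    because the images of the [Z (t k)] generate [Z i]. A split member makes [Z i] a summand of
    [Z (t k)], hence of the regular module. *)
Lemma end_injective_summand (X : lmodType S) :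
  local_projective X -> rel_injective X ->
  exists i, local_projective (Z i) /\ (big_end X <-> big_end (Z i)).
Proof.
move=> lpX riX; have [i [x [s [xs sx]]]] := end_rank_one lpX.
have [ex sK se] := xs.
have sZ (a : S) v : s (a *: v) = a * (s v : S) by exact: linearZ.
exists i; split; last first.
  rewrite -(big_id_end i); split; first exact: (big_end_corner xs).
  exact: (big_corner_end sx).
pose J := {k : K & {linear Z (t k) -> Z i}}.
have /dep_choice[W WE] (k : K) : exists W : lmodType S,
    exists x (r : {linear W -> S^o}), [/\ rank_one (id_end (t k)) x r,
    (r x : S) = id_end (t k) &
      forall (U : lmodType S) (f : {linear U -> S^o}),
        (forall u, (f u : S) * id_end (t k) = f u) ->
        exists g : {linear U -> W}, f =1 r \o g].
  exact/left_ideal_module/id_end_idem.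
have /dep_choice[y /dep_choice[r rE]] := WE.
have H (kh : J) (a : S) (v w : X) :
    (s (a *: v + w) : S) * hom_end (tagged kh) =
    a *: ((s v : S) * hom_end (tagged kh) : S^o) + (s w : S) * hom_end (tagged kh).
  by rewrite linearP mulrDl /GRing.scale /= mulrA.
have /dep_choice[f fE] (kh : J) : exists f : {linear X -> W (tag kh)},
    forall v, (r (tag kh) (f v) : S) = (s v : S) * hom_end (tagged kh).
  have [_ _ lift] := rE (tag kh).
  have [|f fE] := lift X (@mklin S X S^o (fun v => (s v : S) * hom_end (tagged kh)) (@H kh)).
    by move=> v; rewrite /= -mulrA hom_end_idr.
  by exists f => v; exact/esym/fE.
have [||[k h] [g gf]] := riX J (fun kh => W (tag kh)) f.
- move=> kh; have [yr ry _] := rE (tag kh).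
  exact: (local_left_ideal (id_end_idem _) (id_end_neq0 _) (@id_end_local _) yr ry).
- move=> V f1 f2 f12 v; pose d : S := (s (f1 v) : S) - s (f2 v).
  have de : d * id_end i = d by rewrite /d mulrBl !se.
  have dh k (h : {linear Z (t k) -> Z i}) : d * hom_end h = 0.
    rewrite /d mulrBl; have /= e1 := fE (existT _ k h) (f1 v).
    have /= e2 := fE (existT _ k h) (f2 v).
    by rewrite -e1 -e2; have /= -> := f12 (existT _ k h) v; rewrite subrr.
  (* As [u *: z = z], every [z] is a sum of values of the maps [y |-> q k y *: z] from the
     [Z (t k)], and [d] kills them all. *)
  have d0 : d = 0.
    apply: endP => w; rewrite -de.
    change ((d : {linear _ -> _}) (dsum_inj i (dsum_proj i w)) = 0).
    move: (dsum_proj i w) => z; rewrite -[z]uZ /u scaler_suml !linear_sum big1 // => k _.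
    have Hz (a : A) (b c : Z (t k)) :
        (q k (a *: b + c) : A) *: z = a *: ((q k b : A) *: z) + (q k c : A) *: z.
      by rewrite linearP scalerDl -scalerA.
    have E := congr1 (fun g : S => (g : {linear _ -> _}) (dsum_inj (t k) (p k (1 : A))))
      (dh k (mklin Hz)).
    apply: etrans E.
    exact: (congr1 (fun y => (d : {linear _ -> _}) (dsum_inj i (mklin Hz y)))
      (esym (dsum_injK (p k (1 : A))))).
  rewrite -[LHS]sK -[RHS]sK; congr (_ *: _).
  by apply/eqP; rewrite -subr_eq0; apply/eqP.
have [yr ry _] := rE k; have [ey rK re] := yr.
pose w : S := s (g (y k)).
have hw : hom_end h * w = id_end i.
  rewrite -sx -sZ -linearZ; congr (s _); rewrite -[RHS]gf; congr (g _).
  rewrite -[RHS]rK; have /= -> := fE (existT _ k h) x; rewrite sx.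
  by rewrite hom_end_idl.
pose h' := comp_end i (t k) w.
have hh' z : h (h' z) = z.
  have E := congr1 (fun g : S => comp_end i i g z) hw.
  apply: etrans (esym (dsum_injK (h (h' z)))) _; apply: etrans E _.
  exact: hom_endK.
have [z z0] := indZ_neq0 i.
apply: (@local_retract _ _ (q k \o h') (h \o p k) _ (@locZ i) z z0) => v /=.
by rewrite qK; exact: hh'.
Qed.

(** [A e] is isomorphic to some [Z i], and [X] is [S e_i]. A jointly monic family out of [X] comes
    from maps [h j : Z (m j) -> Z i]. If these did not cover [Z i], the annihilator hypothesis would
    give a nonzero map from [Z i] to [A^o] killing all their images, against joint monicity. So some
    [h j] splits, and with it a member of the family. *)
Lemma left_ideal_injective_summand (e : A) : e * e = e -> e != 0 ->
    corner_local e -> u * e = e ->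
    (forall V0 : A -> Prop, V0 0 -> (forall a b c, V0 b -> V0 c -> V0 (a * b + c)) ->
       ~ V0 e -> exists c, (forall a, V0 a -> a * c = 0) /\ e * c != 0) ->
  exists X : lmodType S,
    [/\ local_projective X, rel_injective X & big_end X <-> big_corner e].
Proof.
move=> ee e0 loc ue ann.
have [V [x [s [xs sx lift]]]] := left_ideal_module ee.
have lpV := local_left_ideal ee e0 loc xs sx.
have [ex sK se] := xs.
have sZ (a : A) v : s (a *: v) = a * (s v : A) by exact: linearZ.
have He k (a : A) (v w : Z (t k)) :
    (q k (a *: v + w) : A) * e = a *: ((q k v : A) * e : A^o) + (q k w : A) * e.
  by rewrite linearP mulrDl /GRing.scale /= mulrA.
have /dep_choice[f fE] k : exists f : {linear Z (t k) -> V},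
    forall z, (s (f z) : A) = (q k z : A) * e.
  have [|f fE] := lift (Z (t k)) (@mklin A (Z (t k)) A^o (fun z => (q k z : A) * e) (He k)).
    by move=> z; rewrite /= -mulrA ee.
  by exists f => z; exact/esym/fE.
have [|k0 [g fg]] := lpV K (fun k => Z (t k)) f.
  apply/coversP => P P0 PL HP v.
  have -> : v = \sum_k (f k (p k (s v : A))).
    rewrite -[LHS]sK -[RHS]sK; congr (_ *: _).
    rewrite linear_sum (eq_bigr (fun k => (q k (p k (s v : A)) : A) * e)) //.
    by rewrite -mulr_suml sum_qp -mulrA ue se.
  elim/big_ind: _ => // [v1 v2 Pv Pw|k _]; last by apply: HP; exists k, (p k (s v : A)).
  by rewrite -[v1]scale1r; apply: PL.
have {}fg v : f k0 (g v) = v by exact: fg.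
pose i := t k0; pose be : {linear Z i -> V} := f k0; pose al : {linear V -> Z i} := g.
have ab v : be (al v) = v by exact: fg.
have ba z : al (be z) = z.
  have [z'|H0|H1] := idempotent_indecomposable (r := al \o be) (indZ i).
  - by rewrite /= ab.
  - case/eqP: e0; rewrite -sx -[x]ab -[al x](_ : al (be (al x)) = _); last by rewrite ab.
    by have /= -> := H0 (al x); rewrite !linear0.
  - exact: H1.
have [X [xX [sX [xsX sxX liftX]]]] := left_ideal_module (id_end_idem i).
have [exX sKX seX] := xsX.
have sZX (a : S) v : sX (a *: v) = a * (sX v : S) by exact: linearZ.
exists X; split.
- exact: (local_left_ideal (id_end_idem _) (id_end_neq0 _) (@id_end_local _) xsX sxX).
- move=> J U fX lpU jm.
  have /dep_choice[m /dep_choice[y /dep_choice[r ry]]] := fun k => end_rank_one (lpU k).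
  pose w k : S := r k (fX k xX).
  have we k : w k * id_end (m k) = w k by have [[_ _ ->] _] := ry k.
  have rZ k (a : S) v : (r k (a *: v) : S) = a * (r k v : S) by rewrite linearZ.
  have ew k : id_end i * w k = w k by rewrite /w -rZ -linearZ exX.
  have rK k v : (r k v : S) *: y k = v by have [[_ -> _] _] := ry k.
  pose h k : {linear Z (m k) -> Z i} := comp_end (m k) i (w k).
  have hw k : hom_end (h k) = w k by rewrite /h -id_endM ew we.
  have fXE k v : (r k (fX k v) : S) = (sX v : S) * w k.
    by rewrite -[v in LHS]sKX linearZ rZ.
  have cov : covers h.
    move=> W M mM hM; apply: contrapT => nsplit.
    (* The left ideal of those [a] that send [al x] into the image of [M]; if it contained [e], then
       [M] would have a section. *)
    pose V0 (a : A) := exists b : W, M b = a *: al x.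
    have [|||c [V0c ec]] := ann V0.
    + by exists 0; rewrite linear0 scale0r.
    + by move=> a b c [b' bE] [c' cE]; exists (a *: b' + c'); rewrite linearP bE cE scalerDl scalerA.
    + move=> [b]; rewrite -linearZ ex => bE; case: nsplit.
      have Hs (a : A) (z1 z2 : Z i) : (s (be (a *: z1 + z2)) : A) *: b =
          a *: ((s (be z1) : A) *: b) + (s (be z2) : A) *: b.
        by rewrite !linearP scalerDl -scalerA.
      by exists (mklin Hs) => z; rewrite /= linearZ /= bE -linearZ sK ba.
    have HQ (a : A) (z1 z2 : Z i) : (s (be (a *: z1 + z2)) : A) * c =
        a *: ((s (be z1) : A) * c : A^o) + (s (be z2) : A) * c.
      by rewrite !linearP mulrDl /GRing.scale /= mulrA.
    pose Q : {linear Z i -> A^o} := @mklin A (Z i) A^o (fun z => (s (be z) : A) * c) HQ.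
    have QM b : Q (M b) = 0.
      by apply: V0c; exists b; rewrite -linearZ sK ba.
    have [k pQ] : exists k, p k (Q (al x)) != 0.
      apply: contrapT => /forallNP pQ0; case/eqP: ec.
      have -> : e * c = \sum_k (q k (p k (e * c)) : A).
        by rewrite sum_qp -uC mulrA ue.
      rewrite big1 // => k _; have /negP/negPn/eqP := pQ0 k.
      by rewrite /= ab sx => ->; rewrite linear0.
    (* This map [Z i -> Z (t k)] vanishes on the images of all [h j], so multiplication by it is
       invisible to the jointly monic family and it must be 0. *)
    pose si : S := hom_end (p k \o Q).
    have sie : si * id_end i = si by exact: hom_end_idr.
    have si0 : si = 0.
      have Hy (a : S) (b1 b2 : S^o) : ((a *: b1 + b2 : S) * si) *: xX =
          a *: (((b1 : S) * si) *: xX) + ((b2 : S) * si) *: xX.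
        by rewrite mulrDl scalerDl [X in (X * _) *: _]/GRing.scale /= -mulrA scalerA.
      have H0 (a : S) (b1 b2 : S^o) : 0 = a *: 0 + 0 :> X by rewrite scaler0 addr0.
      have := jm S^o (mklin Hy) (mklin H0) _ (1 : S); rewrite /= mul1r => H1.
      rewrite -sie -sxX -sZX H1 ?linear0 // => j b /=.
      rewrite linear0 -[LHS]rK fXE sZX sxX -!mulrA.
      have -> : id_end i * w j = w j by exact: ew.
      rewrite (_ : si * w j = 0) ?mulr0 ?scale0r //.
      rewrite -hw hom_endM; apply: endP => v.
      have [b' hb'] := hM j.
      change (dsum_inj (t k) (p k (Q (h j (dsum_proj (m j) v)))) = 0).
      have -> : h j (dsum_proj (m j) v) = M (b' (dsum_proj (m j) v)) by exact: hb'.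
      by rewrite QM !linear0.
    case/eqP: pQ; rewrite -[LHS](hom_endK (p k \o Q)) -/si si0.
    exact: linear0.
  have lpZ : local_projective (Z i) := local_projective_iso ab ba lpV.
  have [k [ta hta]] := lpZ J _ h cov.
  have Hr (a : S) (v1 v2 : U k) : (r k (a *: v1 + v2) : S) * hom_end ta =
      a *: ((r k v1 : S) * hom_end ta : S^o) + (r k v2 : S) * hom_end ta.
    by rewrite linearP mulrDl /GRing.scale /= mulrA.
  have [|rX rXE] := liftX (U k)
    (@mklin S (U k) S^o (fun v => (r k v : S) * hom_end ta) Hr).
    by move=> v; rewrite /= -mulrA hom_end_idr.
  exists k, rX => v; rewrite -[LHS]sKX -[RHS]sKX; congr (_ *: _).
  apply: etrans (esym (rXE (fX k v))) _; rewrite /= fXE -mulrA -hw hom_endM.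
  rewrite -[RHS]seX; congr (_ * _); apply: hom_end_ext; exact: hta.
have XZ : big_end X <-> big_end (Z i).
  rewrite -(big_id_end i); split; first exact: (big_end_corner xsX).
  exact: (big_corner_end sxX).
have VZ : big_end V <-> big_end (Z i) by split; apply: big_end_iso; [exact: ab|exact: ba].
have Ve : big_end V <-> big_corner e.
  by split; [exact: (big_end_corner xs)|exact: (big_corner_end sx)].
by rewrite XZ -VZ Ve.
Qed.
End EndomorphismRing.

(** * Central idempotents and the augmentation *)

Lemma block_idem_central_mul (A : pzRingType) (b : block A) f :
  central_idempotent f -> block_idem b * f = 0 \/ block_idem b * f = block_idem b.
Proof.
move=> [ff fC]; case: (block_idemP b) => -[bb bC] _; apply; last by rewrite mulrA bb.
split; last by move=> x; rewrite -mulrA fC mulrA bC -mulrA.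
by rewrite -mulrA (mulrA f) -bC -mulrA ff mulrA bb.
Qed.

Lemma local_central_idem (A : pzRingType) (b e : A) : central_idempotent b ->
  e * e = e -> corner_local e -> b * e = 0 \/ b * e = e.
Proof.
move=> [bb bC] ee loc; apply: corner_local_idem => //.
- by rewrite mulrA -bC -mulrA ee.
- by rewrite -mulrA ee.
- by rewrite -mulrA [e * _]mulrA -bC -!mulrA ee mulrA bb.
Qed.

Section Augmentation.
Variables (F : fieldType) (gT : finGroupType).
Implicit Types a b : galg F gT.

Definition augm a : F := \sum_g a g.

Lemma galg_mulE a b g : (a * b) g = \sum_h a h * b (h^-1 * g)%g.
Proof. by rewrite ffunE. Qed.

Lemma augmM a b : augm (a * b) = augm a * augm b.
Proof.
rewrite /augm mulr_suml; under eq_bigr do rewrite galg_mulE.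
rewrite exchange_big; apply: eq_bigr => h _.
by rewrite (reindex_inj (mulgI h)) mulr_sumr; apply: eq_bigr => g _; rewrite mulKg.
Qed.

Lemma augm1 : augm 1 = 1.
Proof.
rewrite /augm (bigD1 1%g) //= big1 => [|g /negPf g1].
  by rewrite ffunE eqxx addr0.
by rewrite ffunE g1.
Qed.

(** The block idempotent acts on the trivial module by its augmentation, which is an idempotent of
    [F], hence 0 or 1. *)
Lemma augm_block (b : block (galg F gT)) :
  (principal_block b -> augm (block_idem b) = 1) /\
  (~ principal_block b -> augm (block_idem b) = 0).
Proof.
have cosT (C : coset_space [set: gT]%G) g : coset_trans g C = C.
  apply: val_inj => /=; case: C => C /= /lcosetsP[x _ ->].
  by rewrite -lcosetM !lcoset_id ?inE.
have actE (v : perm_module F [set: gT]%G) :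
    block_idem b *: v = [ffun C => augm (block_idem b) * v C].
  apply/ffunP => C; rewrite !ffunE /augm mulr_suml; apply: eq_bigr => g _.
  by rewrite cosT.
have aa : augm (block_idem b) * augm (block_idem b) = augm (block_idem b).
  by rewrite -augmM; congr augm; case: (block_idemP b) => -[].
split=> [pb|npb].
  have C0 : (1 *: [set: gT])%g \in lcosets [set: gT] [set: gT].
    by apply/lcosetsP; exists 1%g.
  pose C : coset_space [set: gT]%G := exist (fun D => is_true (D \in _)) _ C0.
  have := pb [ffun=> 1]; rewrite actE => /ffunP/(_ C).
  by rewrite !ffunE mulr1.
have [//|a0] := eqVneq (augm (block_idem b)) 0; case: npb => v.
have a1 : augm (block_idem b) = 1 by apply: (mulfI a0); rewrite aa mulr1.
by rewrite actE a1; apply/ffunP => C; rewrite ffunE mul1r.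
Qed.
End Augmentation.

(* The coefficient of the identity is a symmetrising form for the group algebra:
   a linear form vanishing on V0 but not at e gives the right multiplier c. *)
Lemma left_ideal_annihilator (gT : finGroupType) (e : galg 'F_2 gT)
    (V0 : galg 'F_2 gT -> Prop) :
  V0 0 -> (forall a b c, V0 b -> V0 c -> V0 (a * b + c)) -> ~ V0 e ->
  exists c, (forall a, V0 a -> a * c = 0) /\ e * c != 0.
Proof.
move=> V00 V0L nV0.
pose D := [set a : {ffun gT -> 'F_2} | `[< V0 a >]].
pose rv (a : {ffun gT -> 'F_2}) : 'rV_#|gT| := \row_i a (enum_val i).
pose M := \matrix_(k < #|D|) rv (enum_val k).
have rvM (a : galg 'F_2 gT) (w : 'cV_#|gT|) :
    (rv a *m w) 0 0 = \sum_g a g * w (enum_rank g) 0.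
  rewrite mxE (reindex_onto enum_rank enum_val) => [|i _]; last by rewrite enum_valK.
  by apply: eq_big => [g|g _]; rewrite ?enum_rankK ?eqxx // mxE enum_rankK.
have V0D a b : V0 a -> V0 b -> V0 (a + b).
  by move=> Va Vb; rewrite -[a]mul1r; apply: V0L.
have nsub : ~~ (rv e <= M)%MS.
  apply/negP => /submxP[C eC]; apply: nV0.
  have -> : e = \sum_(k | C 0 k != 0) (enum_val k : galg 'F_2 gT).
    apply/ffunP => g; have := congr1 (fun r : 'rV_#|gT| => r 0 (enum_rank g)) eC.
    rewrite !mxE enum_rankK => ->; rewrite sum_ffunE [RHS]big_mkcond /=.
    apply: eq_bigr => k _; rewrite !mxE enum_rankK.
    have [->|] := eqVneq (C 0 k) 0; first by rewrite mul0r.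
    by case: (C 0 k) => -[|[|?]] // i _; rewrite (_ : Ordinal i = 1) ?mul1r //; apply: val_inj.
  elim/big_ind: _ => // k _; have := enum_valP k.
  by rewrite inE => /asboolP.
have : rv e *m cokermx M != 0 by rewrite -submxE.
case/rV0Pn => j ej; pose w := col j (cokermx M).
have wE (a : 'rV_#|gT|) : (a *m w) 0 0 = (a *m cokermx M) 0 j.
  by rewrite !mxE; apply: eq_bigr => i _; rewrite mxE.
pose c : galg 'F_2 gT := [ffun g => w (enum_rank g^-1%g) 0].
pose delta g : galg 'F_2 gT := [ffun h => (h == g)%:R].
have cE a g : (a * c) g = (rv (delta g^-1%g * a) *m w) 0 0.
  rewrite galg_mulE rvM (reindex_inj (mulgI g)); apply: eq_bigr => h _.
  have -> : ((g * h)^-1 * g = h^-1)%g by rewrite invMg mulgKV.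
  rewrite [c _]ffunE invgK galg_mulE; congr (_ * _).
  rewrite (bigD1 g^-1%g) //= big1 => [|k /negPf kg].
    by rewrite ffunE eqxx mul1r invgK addr0.
  by rewrite ffunE kg mul0r.
exists c; split=> [a Va|].
  apply/ffunP => g; rewrite cE wE [RHS]ffunE.
  set d : galg 'F_2 gT := delta g^-1%g * a.
  have Vd : V0 d by rewrite -[d]addr0; apply: V0L.
  have dD : (d : {ffun gT -> 'F_2}) \in D by rewrite inE; apply/asboolP.
  have : (rv d <= M)%MS.
    rewrite (_ : rv d = row (enum_rank_in dD d) M) ?row_sub //.
    by rewrite rowK enum_rankK_in.
  by rewrite submxE => /eqP ->; rewrite mxE.
apply: contra_neq ej => ec0; rewrite -wE -[e]mul1r.
have /ffunP/(_ 1%g) := ec0; rewrite cE [X in _ = X -> _]ffunE => <-.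
congr ((rv (_ * e) *m w) 0 0); apply/ffunP => h.
by rewrite !ffunE invg1.
Qed.

(** * Young modules and the regular module *)

Section YoungModules.
Variables (n : nat) (n0 : (0 < n)%N) (Y : intpart n -> lmodType (F2S n)).
Hypothesis youngY : young_modules Y.

Lemma young_indecomposable la : indecomposable (Y la).
Proof. by case: youngY. Qed.

(** A Young module is a summand of a permutation module, hence finite. *)
Lemma young_fitting la (r : {linear Y la -> Y la}) :
  nil_end r \/ exists2 r' : {linear Y la -> Y la}, cancel r r' & cancel r' r.
Proof.
have [_ _ /(_ la)[k [s [[f fb] cs _]]]] := youngY.
have [g fK gK] := linear_inv fb.
have [i si] : exists i, s i = la.
  have /card_gt0P[i] : (0 < #|[set i | s i == la]|)%N by rewrite cs.
  by rewrite inE => /eqP; exists i.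
move: r; rewrite -si => r.
pose h (y : Y (s i)) : {ffun coset_space (young_subgroup la) -> 'F_2} :=
  g (dsum_inj (fun i => Y (s i)) i y).
apply: (@fitting _ _ _ h) (young_indecomposable _) => y z yz.
have := can_inj gK yz => /(congr1 (dsum_proj (fun i => Y (s i)) i)).
by rewrite (dsum_injK (Z := fun i => Y (s i)) y) (dsum_injK (Z := fun i => Y (s i)) z).
Qed.

Definition ones : n.-tuple 'I_n.+1 := [tuple of nseq n (inord 1)].

Fact ones_val : [seq val i | i <- ones] = nseq n 1%N.
Proof. by rewrite /= map_nseq /= inordK. Qed.

Fact ones_subproof : sorted geq [seq val i | i <- ones] &&
  (sumn [seq val i | i <- ones] == n).
Proof.
rewrite ones_val sumn_nseq mul1n eqxx andbT.
by case: (n) => //= m; elim: m => //= m ->.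
Qed.

Definition ones_part : intpart n :=
  exist (fun l : n.-tuple 'I_n.+1 => sorted geq [seq val i | i <- l] &&
    (sumn [seq val i | i <- l] == n)) _ ones_subproof.

Lemma young_subgroup_ones : young_subgroup ones_part = 1%G.
Proof.
apply/val_inj/setP => s /=; rewrite !inE.
have pE : parts ones_part = nseq n 1%N by exact: ones_val.
have rE m i : (i < m)%N -> reshape_index (nseq m 1%N) i = i.
  elim: m i => // m IH [|i] //= im; rewrite /reshape_index /=.
  by rewrite subn1 -/(reshape_index _ _) IH.
apply/forallP/eqP => [sE|-> i]; last by rewrite perm1.
apply/permP => i; rewrite perm1; apply: val_inj => /=.
by have /eqP := sE i; rewrite pE !rE.
Qed.

Let L := F2S n.

(** [M^(1^n)] is the regular module, so its decomposition into Young modules splits the identity of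
    the group algebra. *)
Lemma young_regular : exists (k : nat) (s : 'I_k -> intpart n)
  (p : forall i, {linear L^o -> Y (s i)}) (q : forall i, {linear Y (s i) -> L^o}),
  (forall i, cancel (q i) (p i)) /\ forall a : L, \sum_i (q i (p i a) : L) = a.
Proof.
have [_ _ /(_ ones_part)[k [s [[f fb] _ _]]]] := youngY.
have [g fK gK] := linear_inv fb.
pose H := young_subgroup ones_part; pose M := young_perm_module ones_part.
have cosP (x : 'S_n) : (x *: H)%g \in lcosets H [set: 'S_n].
  by apply/lcosetsP; exists x.
pose cos x : coset_space H := exist (fun D => is_true (D \in _)) _ (cosP x).
have cosM x y : coset_trans x (cos y) = cos (x * y)%g.
  by apply: val_inj; rewrite /= lcosetM.
have H1 : (H : {set _}) = 1%g by rewrite /H young_subgroup_ones.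
have repr_cos x : repr (val (cos x)) = x.
  by rewrite -[RHS]repr_set1 -[in RHS](mulg1 [set x]) -H1.
have cos_repr C : cos (repr (val C)) = C.
  have /lcosetsP[x _ xC] := valP C.
  by rewrite (_ : C = cos x) ?repr_cos //; exact: val_inj.
have psiH (a : L) (u v : M) : ([ffun x => (a *: u + v) (cos x)] : L^o) =
    a *: ([ffun x => u (cos x)] : L^o) + [ffun x => v (cos x)].
  apply/ffunP => x; rewrite !ffunE; congr (_ + _).
  by apply: eq_bigr => h _; rewrite ffunE cosM.
pose psi : {linear M -> L^o} := @mklin L M L^o (fun v => [ffun x => v (cos x)]) psiH.
have psib : bijective psi.
  exists (fun a : L => [ffun C => a (repr (val C))] : M) => [v|a] /=.
    by apply/ffunP => C; rewrite !ffunE cos_repr.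
  by apply/ffunP => x; rewrite !ffunE repr_cos.
have [phi psiK phiK] := linear_inv psib.
pose Z := fun i => Y (s i).
exists k, s, (fun i => dsum_proj Z i \o (f \o phi)), (fun i => psi \o (g \o dsum_inj Z i)).
split=> [i z|a]; first by rewrite /= psiK gK; exact: dsum_injK.
rewrite (eq_bigr (fun i => (psi \o g) (dsum_inj Z i (dsum_proj Z i (f (phi a)))))) //.
rewrite -(linear_sum (psi \o g)) -dsum_split /= fK; exact: phiK.
Qed.

Lemma schur_algebra_summand (X : lmodType (schur_algebra Y)) :
  local_projective X -> rel_injective X ->
  exists la, local_projective (Y la) /\ (big_end X <-> big_end (Y la)).
Proof.
have [k [s [p [q [qK qp]]]]] := young_regular.
apply: (@end_injective_summand _ _ Y young_indecomposable young_fitting _ s p q qK).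
by move=> la z; rewrite qp scale1r.
Qed.

Section Block.
Variable b : block L.
Let e := block_idem b.
Let ee : e * e = e. Proof. by case: (block_idemP b) => -[]. Qed.
Let eC a : e * a = a * e. Proof. by case: (block_idemP b) => -[]. Qed.

Let I := {la : intpart n | `[< in_block b (Y la) >]}.
Let Z (la : I) := Y (val la).

Lemma young_block la : in_block b (Y la) \/ forall y : Y la, e *: y = 0.
Proof.
have H (a : L) (u v : Y la) : e *: (a *: u + v) = a *: (e *: u) + e *: v.
  by rewrite scalerDr !scalerA eC.
have [v||] := idempotent_indecomposable (r := mklin H) (young_indecomposable la).
- by rewrite /= scalerA ee.
- by right.
- by left.
Qed.

(** The summands outside the block are annihilated by [e], so the remaining ones add up to [e]. *)
Lemma young_block_regular : exists (K : finType) (t : K -> I)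
  (p : forall k, {linear L^o -> Z (t k)}) (q : forall k, {linear Z (t k) -> L^o}),
  (forall k, cancel (q k) (p k)) /\ \sum_k (q k (p k (1 : L)) : L) = e.
Proof.
have [k [s [p [q [qK qp]]]]] := young_regular.
pose K := {i : 'I_k | `[< in_block b (Y (s i)) >]}.
pose t (i : K) : I := exist (fun la => is_true `[< in_block b (Y la) >]) (s (val i)) (valP i).
exists K, t, (fun i => p (val i)), (fun i => q (val i)); split=> [i|]; first exact: qK.
rewrite -[RHS](qp e) (bigID (fun i => `[< in_block b (Y (s i)) >])) /=.
have pe i : p i e = e *: p i (1 : L).
  by rewrite -linearZ; congr (p i _); rewrite /GRing.scale /= mulr1.
rewrite [X in _ = _ + X]big1 => [|i nb]; last first.
  have [ib|z] := young_block (s i); first by move/asboolP: nb.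
  by rewrite pe z linear0.
rewrite addr0 [RHS](eq_bigr (fun i => q i (p i (1 : L)))) => [|i /asboolP ib].
  have := big_sub (fun i : 'I_k => `[< in_block b (Y (s i)) >])
    (fun i => q i (p i (1 : L)) : L).
  by move=> ->.
by rewrite pe ib.
Qed.

Lemma schur_block_summand (X : lmodType (schur_block Y b)) :
  local_projective X -> rel_injective X ->
  exists la, [/\ in_block b (Y la), local_projective (Y la) &
    big_end X <-> big_end (Y la)].
Proof.
have [K [t [p [q [qK qp]]]]] := young_block_regular => lpX riX.
have [|la [lp XY]] := @end_injective_summand _ _ Z (fun la => young_indecomposable (val la))
  (fun la => @young_fitting (val la)) _ t p q qK _ X lpX riX.
  by move=> la z; rewrite qp; have /asboolP := valP la; apply.
by exists (val la); split=> //; apply/asboolP/(valP la).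
Qed.

Lemma schur_block_local (f : L) : f * f = f -> f != 0 -> corner_local f ->
  e * f = f -> exists X : lmodType (schur_block Y b),
    [/\ local_projective X, rel_injective X & big_end X <-> big_corner f].
Proof.
have [K [t [p [q [qK qp]]]]] := young_block_regular => ff f0 loc ef.
apply: (@left_ideal_injective_summand _ _ Z (fun la => young_indecomposable (val la))
  (fun la => @young_fitting (val la)) _ t p q) => //.
- by move=> a; rewrite qp.
- by rewrite qp.
- by move=> V0 V00 V0L nV0; apply: left_ideal_annihilator.
Qed.
End Block.
End YoungModules.

(** * Reduction to corners of the group algebra *)

Section IdempotentFamilies.
Variables (A : pzRingType) (J : finType) (P : pred J) (a e c : J -> A).
Hypothesis ee : forall j, P j -> e j * e j = e j.

(** The identity of [X] is a sum of terms [a e c], so the [e_j X] generate [X], which is then a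
    summand of some [A e_j]. *)
Lemma family_rank_one (X : lmodType A) : local_projective X ->
  (forall v : X, v = \sum_(j | P j) (a j * e j * c j) *: v) ->
  exists j x s, P j /\ rank_one (e j) (x : X) s.
Proof.
move=> lpX gX.
have gen : generated (fun v : X => exists (j : {j | P j}) y, v = e (val j) *: y).
  move=> Q Q0 QL HQ v; rewrite [v]gX.
  elim/big_ind: _ => // [v1 v2 Q1 Q2|j Pj].
    by rewrite -[v1]scale1r; apply: QL.
  rewrite -[_ *: v]addr0 -mulrA -scalerA; apply: QL => //.
  by apply: HQ; exists (Sub j Pj), (c j *: v); rewrite scalerA.
have [|j [x [s xs]]] := local_projective_rank_one lpX _ gen.
  by move=> j; apply: ee; exact: valP.
by exists (val j), x, s; split=> //; exact: valP.
Qed.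

Lemma family_big (X : lmodType A) : local_projective X ->
  (forall v : X, v = \sum_(j | P j) (a j * e j * c j) *: v) ->
  (forall j, P j -> corner_local (e j) /\ big_corner (e j)) -> big_end X.
Proof.
move=> lpX gX good; have [v v0] := local_projective_neq0 lpX.
have [j [x [s [Pj xs]]]] := family_rank_one lpX gX; have [loc big] := good _ Pj.
exact: (big_corner_end (rank_one_local xs v0 loc) big).
Qed.

Lemma family_small (X : lmodType A) : local_projective X ->
  (forall v : X, v = \sum_(j | P j) (a j * e j * c j) *: v) ->
  (forall j, P j -> ~ big_corner (e j)) -> ~ big_end X.
Proof.
move=> lpX gX small; have [j [x [s [Pj xs]]]] := family_rank_one lpX gX.
by move=> /(big_end_corner xs); exact: small.
Qed.
End IdempotentFamilies.

Section BlockAlgebra.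
Variables (A : pzRingType) (b : block A).
Let f := block_idem b.
Let B : pzRingType := block_alg b.

Let ff : f * f = f. Proof. exact: block_idem_id. Qed.
Let fC a : f * a = a * f. Proof. exact: block_idemC. Qed.
Let fM (a : A) : f * (f * a) == f * a. Proof. by rewrite mulrA ff. Qed.
Definition to_block (a : A) : B := exist (fun x => is_true (f * x == x)) (f * a) (fM a).

Lemma to_block_val (x : B) : to_block (val x) = x.
Proof. by apply: val_inj; exact: block_algP. Qed.
Lemma to_blockM a c : to_block (a * c) = to_block a * to_block c.
Proof.
by apply: val_inj; rewrite /= -[RHS]mulrA [a * (f * c)]mulrA -fC -mulrA [RHS]mulrA ff.
Qed.
Lemma to_block1 : to_block 1 = 1.
Proof. by apply: val_inj; rewrite /= mulr1. Qed.
Lemma to_blockD : {morph to_block : a c / a + c}.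
Proof. by move=> a c; apply: val_inj; rewrite /= mulrDr. Qed.
Lemma to_block0 : to_block 0 = 0.
Proof. by apply: val_inj; rewrite /= mulr0. Qed.
Lemma valM (x y : B) : val (x * y) = val x * val y. Proof. by []. Qed.

Section Idempotent.
Variable e : A.
Hypotheses (ee : e * e = e) (fe : f * e = e).

Lemma to_block_idem : to_block e * to_block e = to_block e.
Proof. by rewrite -to_blockM ee. Qed.

Lemma to_block_idem_val : val (to_block e) = e. Proof. exact: fe. Qed.

Lemma to_block_local : corner_local e -> corner_local (to_block e).
Proof.
move=> loc r er re.
have {}er : e * val r = val r by rewrite -[in RHS]er valM to_block_idem_val.
have {}re : val r * e = val r by rewrite -[in RHS]re valM to_block_idem_val.
have [[n rn]|[r' [er' r'e rr' r'r]]] := loc _ er re.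
  left; exists n; apply: val_inj; change (val (r ^+ n.+1) = 0); rewrite -rn.
  elim: n {rn} => [|n IH]; first by rewrite !expr1.
  by rewrite exprS valM IH -exprS.
by right; exists (to_block r'); split;
  rewrite -?to_blockM ?er' ?r'e // -[r in LHS]to_block_val -to_blockM ?rr' ?r'r.
Qed.

Lemma to_block_big : big_corner e <-> big_corner (to_block e).
Proof.
split=> -[g gI gE].
  exists (fun t => to_block (g t)) => [t t' /(congr1 val)/=|t].
    by rewrite -(gE t).1 -(gE t').1 !mulrA fe !(gE _).1 => /gI.
  by rewrite -!to_blockM (gE t).1 (gE t).2.
exists (fun t => val (g t)) => [t t' /val_inj/gI //|t].
by split; [rewrite -[in RHS](gE t).1|rewrite -[in RHS](gE t).2]; rewrite valM to_block_idem_val.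
Qed.

Lemma block_local_projective : e != 0 -> corner_local e ->
  exists2 X : lmodType B, local_projective X & big_end X <-> big_corner e.
Proof.
move=> e0 loc; have loc' := to_block_local loc.
have [X [x [s [xs sx _]]]] := left_ideal_module to_block_idem.
exists X; last first.
  rewrite to_block_big; split; first exact: (big_end_corner xs).
  exact: (big_corner_end sx).
apply: (local_left_ideal to_block_idem _ loc' xs sx).
by apply: contra_neq e0 => /(congr1 val); rewrite to_block_idem_val.
Qed.
End Idempotent.

(** [f] fixes or kills each local [e j], and the killed terms drop out of the decomposition of
    [f]. *)
Lemma block_family_big (J : finType) (a e c : J -> A) :
  (forall j, [/\ e j * e j = e j, corner_local (e j) & big_corner (e j)]) ->
  f = \sum_j a j * e j * c j ->
  forall X : lmodType B, local_projective X -> big_end X.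
Proof.
move=> good fE X lpX; pose P j := f * e j == e j.
apply: (@family_big B J P (to_block \o a) (to_block \o e) (to_block \o c)) => //.
- by move=> j _ /=; rewrite -to_blockM; have [-> _ _] := good j.
- move=> v; rewrite -[LHS]scale1r -to_block1 -scaler_suml; congr (_ *: v).
  have -> : to_block 1 = to_block f by apply: val_inj; rewrite /= mulr1 ff.
  rewrite [f in LHS]fE (big_morph to_block to_blockD to_block0) /=.
  rewrite (bigID P) /= [X in _ + X]big1 ?addr0 => [|j nPj].
    by apply: eq_bigr => j _; rewrite !to_blockM.
  have [ej locj _] := good j.
  have [fe0|/eqP fej] := local_central_idem (conj ff fC) ej locj; last by case/negP: nPj.
  by apply: val_inj; rewrite /= !mulrA (fC (a j)) -(mulrA (a j)) fe0 mulr0 mul0r.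
- move=> j /eqP fe; have [ej locj bigj] := good j.
  by split; [exact: to_block_local|exact/to_block_big].
Qed.
End BlockAlgebra.

Definition local_idempotent (A : pzRingType) (e : A) :=
  [/\ e * e = e, e != 0 & corner_local e].

(** Two-sided multiples are allowed so that an idempotent [u e v] isomorphic to [e] needs no
    certificate of its own. *)
Definition decomposition (A : pzRingType) (P : A -> Prop) (b : A) :=
  exists (J : finType) (a e c : J -> A),
    (forall j, P (e j)) /\ b = \sum_j a j * e j * c j.

Definition big_decomposition (A : pzRingType) : A -> Prop :=
  decomposition (fun e => local_idempotent e /\ big_corner e).

Definition small_decomposition (A : pzRingType) : A -> Prop :=
  decomposition (fun e => e * e = e /\ ~ big_corner e).

Section Inequivalence.
Variables (A B : pzRingType).

(** The equivalence would carry a local projective with many endomorphisms to one over [A], where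
    each is a summand of some [A e] with a small corner. *)
Lemma small_vs_local (b : block B) (e : B) : small_decomposition (1 : A) ->
  local_idempotent e -> block_idem b * e = e -> big_corner e ->
  ~ morita_equivalent A (block_alg b).
Proof.
move=> [J [a [d [c [dP d1]]]]] [ee e0 loc] be big /morita_functors[_ [G GE]].
have [X lpX bX] := block_local_projective ee be e0 loc.
have bGX : big_end (G X) by apply/(fmap_big_end GE)/bX.
apply: (@family_small A J predT a d c _ _ (fmap_local_projective GE lpX)) bGX => //.
- by move=> j _; case: (dP j).
- by move=> v; rewrite -scaler_suml -d1 scale1r.
- by move=> j _; case: (dP j).
Qed.

Lemma big_vs_local (b : block A) (b' : block B) (e : B) :
  big_decomposition (block_idem b) ->
  local_idempotent e -> block_idem b' * e = e -> ~ big_corner e ->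
  ~ morita_equivalent (block_alg b) (block_alg b').
Proof.
move=> [J [a [d [c [dP d1]]]]] [ee e0 loc] be nbig /morita_functors[_ [G GE]].
have [X lpX bX] := block_local_projective ee be e0 loc.
apply/nbig/bX/(fmap_big_end GE).
apply: (block_family_big (a := a) (e := d) (c := c)) => // [j|].
  by have [[]] := dP j.
exact: fmap_local_projective.
Qed.
End Inequivalence.

Section SchurInequivalence.
Variables (m n : nat) (m0 : (0 < m)%N) (n0 : (0 < n)%N).
Variables (Y : intpart m -> lmodType (F2S m)) (Y' : intpart n -> lmodType (F2S n)).
Hypotheses (young : young_modules Y) (young' : young_modules Y').

Lemma schur_small_vs_local (b : block (F2S n)) (e : F2S n) :
  small_decomposition (1 : F2S m) ->
  local_idempotent e -> block_idem b * e = e -> big_corner e ->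
  ~ morita_equivalent (schur_algebra Y) (schur_block Y' b).
Proof.
move=> [J [a [d [c [dP d1]]]]] [ee e0 loc] be big /morita_functors[_ [G GE]].
have [X [lpX riX bX]] := schur_block_local n0 young' ee e0 loc be.
have bGX : big_end (G X) by apply/(fmap_big_end GE)/bX.
have [la [lpY bY]] := schur_algebra_summand m0 young
  (fmap_local_projective GE lpX) (fmap_rel_injective GE riX).
apply: (@family_small _ J predT a d c _ _ lpY) (bY.1 bGX) => //.
- by move=> j _; case: (dP j).
- by move=> v; rewrite -scaler_suml -d1 scale1r.
- by move=> j _; case: (dP j).
Qed.

Lemma schur_big_vs_local (b : block (F2S m)) (b' : block (F2S n)) (e : F2S n) :
  big_decomposition (block_idem b) ->
  local_idempotent e -> block_idem b' * e = e -> ~ big_corner e ->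
  ~ morita_equivalent (schur_block Y b) (schur_block Y' b').
Proof.
move=> [J [a [d [c [dP d1]]]]] [ee e0 loc] be nbig /morita_functors[_ [G GE]].
have [X [lpX riX bX]] := schur_block_local n0 young' ee e0 loc be.
have [la [bla lpY bY]] := schur_block_summand m0 young
  (fmap_local_projective GE lpX) (fmap_rel_injective GE riX).
apply/nbig/bX/(fmap_big_end GE)/bY.
apply: (@family_big _ J predT a d c _ _ lpY) => //.
- by move=> j _; case: (dP j) => -[].
- by move=> v; rewrite -scaler_suml -d1 bla.
- by move=> j _; case: (dP j) => -[].
Qed.
End SchurInequivalence.

Lemma main_from_facts :
  small_decomposition (1 : F2S 4) ->
  (forall b : block (F2S 5), principal_block b ->
    exists e, [/\ local_idempotent e, block_idem b * e = e & big_corner e]) ->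
  (forall b : block (F2S 7), ~ principal_block b ->
    exists e, [/\ local_idempotent e, block_idem b * e = e & big_corner e]) ->
  (forall b : block (F2S 6), principal_block b -> big_decomposition (block_idem b)) ->
  (forall b : block (F2S 7), principal_block b ->
    exists e, [/\ local_idempotent e, block_idem b * e = e & ~ big_corner e]) ->
  [/\ (forall b5 : block (F2S 5), principal_block b5 ->
         ~ morita_equivalent (F2S 4) (block_alg b5)) /\
      (forall b7 : block (F2S 7), ~ principal_block b7 ->
         ~ morita_equivalent (F2S 4) (block_alg b7)),
      forall Y4 : intpart 4 -> lmodType (F2S 4), young_modules Y4 ->
        (forall Y5 : intpart 5 -> lmodType (F2S 5), young_modules Y5 ->
         forall b5 : block (F2S 5), principal_block b5 ->
           ~ morita_equivalent (schur_algebra Y4) (schur_block Y5 b5)) /\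
        (forall Y7 : intpart 7 -> lmodType (F2S 7), young_modules Y7 ->
         forall b7 : block (F2S 7), ~ principal_block b7 ->
           ~ morita_equivalent (schur_algebra Y4) (schur_block Y7 b7)),
      forall (b6 : block (F2S 6)) (b7 : block (F2S 7)),
        principal_block b6 -> principal_block b7 ->
        ~ morita_equivalent (block_alg b6) (block_alg b7) &
      forall (Y6 : intpart 6 -> lmodType (F2S 6))
             (Y7 : intpart 7 -> lmodType (F2S 7)),
        young_modules Y6 -> young_modules Y7 ->
        forall (b6 : block (F2S 6)) (b7 : block (F2S 7)),
        principal_block b6 -> principal_block b7 ->
        ~ morita_equivalent (schur_block Y6 b6) (schur_block Y7 b7)].
Proof.
move=> N4 E5 E7n U6 E7p; split.
- split=> b pb.
    by have [e [le be big]] := E5 b pb; apply: small_vs_local be big.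
  by have [e [le be big]] := E7n b pb; apply: small_vs_local be big.
- move=> Y4 y4; split=> [Y5 y5|Y7 y7] b pb.
    by have [e [le be big]] := E5 b pb; apply: schur_small_vs_local be big.
  by have [e [le be big]] := E7n b pb; apply: schur_small_vs_local be big.
- move=> b6 b7 p6 p7; have [e [le be nbig]] := E7p b7 p7.
  exact: big_vs_local (U6 _ p6) le be nbig.
- move=> Y6 Y7 y6 y7 b6 b7 p6 p7; have [e [le be nbig]] := E7p b7 p7.
  exact: schur_big_vs_local (U6 _ p6) le be nbig.
Qed.

(** * Double cosets and Hecke algebras *)

(* The permutation s is coded by the list of its values s 0, ..., s (n-1), and
   [cmp] follows the left-to-right product of ['S_n].  The Boolean tests avoid the
   generic [==] for speed: the kernel evaluates them. *)
Notation code := (seq nat).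

Definition cmp (a b : code) : code := [seq nth 0%N b i | i <- a].

Fixpoint idx (x : nat) (s : seq nat) : nat :=
  if s is y :: s' then if eqn y x then 0%N else (idx x s').+1 else 0%N.

Definition cinv (a : code) : code := [seq idx i a | i <- iota 0 (size a)].

Fixpoint eqs (a b : code) : bool :=
  match a, b with
  | [::], [::] => true
  | x :: a', y :: b' => if eqn x y then eqs a' b' else false
  | _, _ => false
  end.

Fixpoint lexperms (k : nat) (s : seq nat) : seq code :=
  if k is k'.+1 then
    flatten [seq [seq x :: p | p <- lexperms k' (filter (fun y => ~~ eqn x y) s)] | x <- s]
  else [:: [::]].

Definition all_codes n := lexperms n (iota 0 n).

Definition validb n (l : code) :=
  eqn (size l) n && all (fun i => has (eqn i) l) (iota 0 n).

Lemma eqsP a b : reflect (a = b) (eqs a b).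
Proof.
apply: (iffP idP) => [|<-].
  elim: a b => [|x a IH] [|y b] //=; rewrite eqnE.
  by have [->|//] := eqVneq x y; move/IH => ->.
by elim: a => //= x a ->; rewrite eqnE eqxx.
Qed.

Lemma uniq_min_perm (T : eqType) (s1 s2 : seq T) : uniq s1 ->
  {subset s1 <= s2} -> (size s2 <= size s1)%N -> perm_eq s1 s2.
Proof.
move=> u1 sub le; apply: uniq_perm (leq_size_uniq u1 sub le) _ => //.
by have [_] := uniq_min_size u1 sub le.
Qed.

Lemma mem_lexperms k s l : size s = k -> uniq s -> perm_eq l s -> l \in lexperms k s.
Proof.
elim: k s l => [|k IH] s l; first by move/size0nil => -> _ /perm_nilP ->.
move=> sk us ls; case: l ls => [|x l ls]; first by move/perm_size; rewrite sk.
have xs : x \in s by rewrite -(perm_mem ls) mem_head.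
apply/flattenP; exists [seq x :: p | p <- lexperms k (filter (fun y => ~~ eqn x y) s)].
  by apply/mapP; exists x.
apply: map_f; have fE : filter (fun y => ~~ eqn x y) s = rem x s.
  by rewrite rem_filter //; apply: eq_filter => y /=; rewrite eqnE eq_sym.
apply: IH; rewrite fE ?rem_uniq ?size_rem ?sk //.
by rewrite -(perm_cons x) (perm_trans ls) // perm_to_rem.
Qed.

Section Codes.
Variable n : nat.
Implicit Types s t : 'S_n.

Definition enc s : code := [seq val (s i) | i <- enum 'I_n].

Lemma size_enc s : size (enc s) = n. Proof. by rewrite size_map size_enum_ord. Qed.

Lemma nth_enc s (i : 'I_n) : nth 0%N (enc s) i = s i.
Proof. by rewrite (nth_map i) ?size_enum_ord // nth_ord_enum. Qed.

Lemma enc_inj : injective enc.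
Proof.
move=> s t st; apply/permP => i; apply: val_inj.
by rewrite /= -!nth_enc st.
Qed.

Lemma encM s t : enc (s * t)%g = cmp (enc s) (enc t).
Proof. by rewrite /cmp -map_comp; apply: eq_map => i /=; rewrite nth_enc permM. Qed.

Lemma enc1 : enc 1%g = iota 0 n.
Proof. by rewrite -val_enum_ord; apply: eq_map => i; rewrite perm1. Qed.

Lemma enc_perm s : perm_eq (enc s) (iota 0 n).
Proof.
rewrite perm_sym; apply: uniq_min_perm; rewrite ?iota_uniq ?size_enc ?size_iota // => i.
rewrite mem_iota add0n /= => lti; apply/mapP; exists (s^-1 (Ordinal lti))%g.
  by rewrite mem_enum.
by rewrite permKV.
Qed.

Lemma enc_all s : enc s \in all_codes n.
Proof. by apply: mem_lexperms; rewrite ?size_iota ?iota_uniq ?enc_perm. Qed.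

Lemma idx_index x l : x \in l -> idx x l = index x l.
Proof.
elim: l => //= y l IH; rewrite inE eqnE (eq_sym y).
by have [->|_ /IH ->] := eqVneq x y; rewrite ?eqxx // eq_sym.
Qed.

Lemma encV s : enc s^-1%g = cinv (enc s).
Proof.
rewrite /cinv size_enc -val_enum_ord -map_comp; apply: eq_map => i /=.
have us : uniq (enc s) by rewrite (perm_uniq (enc_perm s)) iota_uniq.
have E : val i = nth 0%N (enc s) (s^-1 i)%g by rewrite nth_enc permKV.
rewrite [nat_of_ord i]E idx_index ?index_uniq ?size_enc //.
by rewrite mem_nth ?size_enc.
Qed.

Definition decode (l : code) : 'S_n := odflt 1%g [pick s | enc s == l].

Lemma encK s : decode (enc s) = s.
Proof.
rewrite /decode; case: pickP => [t /eqP/enc_inj //|/(_ s)]; by rewrite eqxx.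
Qed.

Lemma decodeK l : validb n l -> enc (decode l) = l.
Proof.
move=> /andP[/eqnP sl /allP al].
have nl (i : 'I_n) : nth 0%N l i \in iota 0 n.
  have : perm_eq (iota 0 n) l.
    apply: uniq_min_perm; rewrite ?iota_uniq ?size_iota ?sl // => j /al/hasP[k kl].
    by rewrite eqnE => /eqP ->.
  by move/perm_mem => ->; rewrite mem_nth ?sl.
have ln i : (nth 0%N l (i : 'I_n) < n)%N by move: (nl i); rewrite mem_iota.
pose f (i : 'I_n) := Ordinal (ln i).
have ul : uniq l.
  apply: (leq_size_uniq (iota_uniq 0 n)); rewrite ?size_iota ?sl // => j /al/hasP[k kl].
  by rewrite eqnE => /eqP ->.
have fI : injective f.
  move=> i j /(congr1 val) /= /eqP; rewrite nth_uniq ?sl //.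
  by move=> /eqP; apply: val_inj.
have fE : enc (perm fI) = l.
  apply: (@eq_from_nth _ 0%N) => [|i]; rewrite size_enc ?sl // => lti.
  by rewrite -[i]/(val (Ordinal lti)) nth_enc permE.
rewrite /decode; case: pickP => [s /eqP //|/(_ (perm fI))].
by rewrite fE eqxx.
Qed.

End Codes.

(* Under the code of g, [Leaf i j q] records g = u x v, where x is the i-th double
   coset representative, u is the j-th element of a list of representatives of the
   left cosets of Q in Q x Q (one u per coset u x Q) and v is the q-th element of Q. *)
Inductive trie := Empty | Leaf of nat & nat & nat | Node of seq trie.

Fixpoint tget (c : code) (t : trie) : option (nat * nat * nat) :=
  match c, t with
  | [::], Leaf i j q => Some (i, j, q)
  | x :: c', Node l => tget c' (nth Empty l x)
  | _, _ => None
  end.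

Fixpoint tupd (l : seq trie) (x : nat) (f : trie -> trie) : seq trie :=
  match l, x with
  | [::], 0 => [:: f Empty]
  | [::], x'.+1 => Empty :: tupd [::] x' f
  | a :: l', 0 => f a :: l'
  | a :: l', x'.+1 => a :: tupd l' x' f
  end.

Fixpoint tins (c : code) (v t : trie) : trie :=
  if c is x :: c' then Node (tupd (if t is Node l then l else [::]) x (tins c' v)) else v.

Fixpoint addcos (i j q : nat) (r : code) (Q : seq code) (t : trie) : trie :=
  if Q is u :: Q' then addcos i j q.+1 r Q' (tins (cmp r u) (Leaf i j q) t) else t.

Fixpoint adddc (i j : nat) (g : code) (Q Q0 : seq code) (t : trie) (us : seq code) :=
  if Q is u :: Q' then
    let r := cmp u g in
    if tget r t is Some _ then adddc i j g Q' Q0 t us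
    else adddc i j.+1 g Q' Q0 (addcos i j 0 r Q0 t) (u :: us)
  else (t, rev us).

Fixpoint build (i : nat) (G : seq code) Q (t : trie) (Rs : seq (code * seq code)) :=
  if G is g :: G' then
    if tget g t is Some _ then build i G' Q t Rs
    else let: (t', us) := adddc i 0 g Q Q t [::] in build i.+1 G' Q t' ((g, us) :: Rs)
  else (t, rev Rs).

Definition dc (t : trie) (g : code) : nat := if tget g t is Some (i, _, _) then i else 0%N.

(* Products of powers of the generators; each generator comes with its order. *)
Fixpoint qlist (n : nat) (gens : seq (code * nat)) : seq code :=
  if gens is (c, o) :: gens' then
    flatten [seq [seq iter i (cmp c) y | y <- qlist n gens'] | i <- iota 0 o]
  else [:: iota 0 n].

Definition table := (trie * seq (code * seq code))%type.
Definition mk_table n gens : table := build 0 (all_codes n) (qlist n gens) Empty [::].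

Definition row (tb : table) i : code * seq code := nth ([::], [::]) tb.2 i.

Definition leaf_ok (Q : seq code) (tb : table) (g : code) : bool :=
  if tget g tb.1 is Some (i, j, q) then
    [&& leq i.+1 (size tb.2), leq j.+1 (size (row tb i).2), leq q.+1 (size Q) &
      eqs g (cmp (cmp (nth [::] (row tb i).2 j) (row tb i).1) (nth [::] Q q))]
  else false.

Definition row_ok n (Q : seq code) (tb : table) (i : nat) : bool :=
  let: (x, us) := row tb i in
  [&& validb n x, (if us is u :: _ then eqs u (iota 0 n) else false) &
    all (fun u => has (eqs u) Q && eqn (dc tb.1 (cmp u x)) i) us].

Definition gen_ok (gens : seq (code * nat)) (t : trie) (g : code) : bool :=
  let d := dc t g in
  all (fun c => eqn (dc t (cmp c.1 g)) d && eqn (dc t (cmp g c.1)) d) gens.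

Definition first_ok n (tb : table) : bool :=
  let: (x, us) := row tb 0 in
  eqs x (iota 0 n) && (if us is [:: u] then eqs u (iota 0 n) else false).

(** The construction of the table is not proved correct; its result is tested. Each permutation is
    found in the form [u x v], and there are n! such triples, so the form is unique. The tests on
    generators show that the index is constant on double cosets. *)
Definition table_ok n (gens : seq (code * nat)) (tb : table) : bool :=
  let Q := qlist n gens in
  [&& all (fun c => validb n c.1) gens, all (validb n) Q, odd (size Q), first_ok n tb,
    all (row_ok n Q tb) (iota 0 (size tb.2)),
    eqn (foldr addn 0 [seq size xu.2 * size Q | xu <- tb.2])%N n`!,
    all (leaf_ok Q tb) (all_codes n) & all (gen_ok gens tb.1) (all_codes n)].

Fixpoint toggle (x : nat) (v : bitseq) : bitseq :=
  match v, x with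
  | [::], _ => [::]
  | b :: v', 0 => ~~ b :: v'
  | b :: v', x'.+1 => b :: toggle x' v'
  end.

(* Entry i is the matrix of left multiplication by the i-th double coset sum in the
   basis of double coset sums, whose entry (l, m) is the parity of the number of u
   with (u x_i)^-1 x_l in the m-th double coset: the |Q| elements of u x_i Q
   contribute equally, and |Q| is odd. *)
Definition left_mats (tb : table) : seq (seq bitseq) :=
  let z := nseq (size tb.2) false in
  [seq (let R := [seq cinv (cmp u xu.1) | u <- xu.2] in
        [seq foldr (fun r acc => toggle (dc tb.1 (cmp r yu.1)) acc) z R | yu <- tb.2])
  | xu <- tb.2].

Fixpoint xorv (v w : bitseq) : bitseq :=
  match v, w with
  | a :: v', b :: w' => (if a then ~~ b else b) :: xorv v' w'
  | _, _ => [::]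
  end.

Fixpoint dotv (v w : bitseq) : bool :=
  match v, w with
  | a :: v', b :: w' => if a then (if b then ~~ dotv v' w' else dotv v' w') else dotv v' w'
  | _, _ => false
  end.

Fixpoint xorm (M N : seq bitseq) : seq bitseq :=
  match M, N with
  | r :: M', s :: N' => xorv r s :: xorm M' N'
  | _, _ => [::]
  end.

Fixpoint left_rows (Z : seq bitseq) (v : bitseq) (T : seq (seq bitseq)) : seq bitseq :=
  match v, T with
  | b :: v', M :: T' => if b then xorm M (left_rows Z v' T') else left_rows Z v' T'
  | _, _ => Z
  end.

Definition zero_mat k : seq bitseq := nseq k (nseq k false).
Definition apply_rows (rows : seq bitseq) (w : bitseq) : bitseq := [seq dotv r w | r <- rows].
Definition unitv k i : bitseq := toggle i (nseq k false).

Definition of_bits k (I : seq nat) : bitseq := foldr toggle (nseq k false) I.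

(** The double coset of [xu] has [size xu.2 * |Q|] elements, and [|Q|] is odd. *)
Definition augv (tb : table) (v : bitseq) : bool :=
  dotv v [seq odd (size xu.2) | xu <- tb.2].

Definition moves_two (g : code) : bool :=
  eqn (count (fun i => ~~ eqn (nth 0%N g i) i) (iota 0 (size g))) 2.

(** Coefficients of D q at the representatives, D being the sum of the elements selected by [f]: the
    one at x is the parity of the number of selected elements in x Q. *)
Definition class_vec n gens (tb : table) (f : code -> bool) : bitseq :=
  [seq foldr (fun q b => if f (cmp xu.1 (cinv q)) then ~~ b else b) false (qlist n gens)
  | xu <- tb.2].

Fixpoint cycle_from fuel (g : code) (x0 x : nat) : seq nat :=
  if fuel is f.+1 then
    let y := nth 0%N g x in x :: (if eqn y x0 then [::] else cycle_from f g x0 y)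
  else [::].

Fixpoint insert_cycle (c : seq nat) (cs : seq (seq nat)) : seq (seq nat) :=
  if cs is d :: cs' then
    if leq (size d) (size c) then c :: cs else d :: insert_cycle c cs'
  else [:: c].

Definition cycle_word (g : code) : code :=
  flatten (foldl (fun cs x => if has (has (eqn x)) cs then cs
    else insert_cycle (cycle_from (size g) g x x) cs) [::] (iota 0 (size g))).

(* Conjugating g by its cycle word gives a product of cycles of consecutive
   numbers, of decreasing length: one representative of each class. *)
Definition normal_form (g : code) : code :=
  let w := cycle_word g in cmp (cmp w g) (cinv w).

Fixpoint pos (g : code) (reps : seq code) : nat :=
  if reps is r :: reps' then if eqs g r then 0%N else (pos g reps').+1 else 0%N.

(* Equation satisfied by the values at [reps] of a class function f with f q = 0,
   q the sum of Q: the coefficient of f q at x is the sum of f over x Q. *)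
Definition class_row m (reps Q : seq code) (x : code) : bitseq :=
  foldr (fun q acc => toggle (pos (normal_form (cmp x (cinv q))) reps) acc) (nseq m false) Q.

Definition normal_ok n (reps : seq code) (g : code) : bool :=
  validb n (cycle_word g) && has (eqs (normal_form g)) reps.

(** Coefficient at [s] of a product of elements of two different Hecke algebras, to which the
    multiplication matrices do not apply: the left factor is expanded over its group elements
    [u x q]. *)
Definition cross_ok n gens1 (tb1 tb2 : table) (e1 e2 : bitseq) (s : code) : bool :=
  let Q := qlist n gens1 in
  foldr (fun bxu acc => if bxu.1 then
      foldr (fun u acc' => foldr (fun q acc'' =>
        if nth false e2 (dc tb2.1 (cmp (cinv (cmp (cmp u bxu.2.1) q)) s)) then ~~ acc'' else acc'')
        acc' Q) acc bxu.2.2 else acc)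
    false (zip e1 tb1.2).

Definition same_ok n (tb1 : table) v1 (tb2 : table) v2 : bool :=
  all (fun g => eqb (nth false v1 (dc tb1.1 g)) (nth false v2 (dc tb2.1 g))) (all_codes n).

(** * Bit vectors as vectors over F_2 *)

Lemma F2_addb (a b : bool) : (a (+) b)%:R = a%:R + b%:R :> 'F_2.
Proof. by case: a; case: b; apply/eqP. Qed.

Lemma F2_odd m : m%:R = (odd m)%:R :> 'F_2.
Proof.
elim: m => //= m IH; rewrite mulrSr IH.
by case: (odd m); apply/eqP.
Qed.

Lemma F2_bool (x : 'F_2) : x = (x != 0)%:R.
Proof. by case: x => -[|[|?]] // i; apply/eqP. Qed.

Lemma F2_addxx (x : 'F_2) : x + x = 0.
Proof. by case: x => -[|[|?]] // i; apply/eqP. Qed.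

Lemma size_xorv v w : size v = size w -> size (xorv v w) = size v.
Proof. by elim: v w => [|a v IH] [|b w] //= [] /IH ->. Qed.

Lemma nth_xorv v w i : size v = size w ->
  nth false (xorv v w) i = nth false v i (+) nth false w i.
Proof.
elim: v w i => [|a v IH] [|b w] [|i] //=; first by case: a.
by case=> /IH ->.
Qed.

Lemma size_toggle x v : size (toggle x v) = size v.
Proof. by elim: v x => [|b v IH] [|x] //=; rewrite IH. Qed.

Lemma nth_toggle x v i : (x < size v)%N ->
  nth false (toggle x v) i = nth false v i (+) (i == x).
Proof.
elim: v x i => // b v IH [|x] [|i] //=; rewrite ?addbF ?addbT // => /IH ->.
by [].
Qed.

Lemma dotvE v w : (dotv v w)%:R =
  \sum_(i < size v) (nth false v i)%:R * (nth false w i)%:R :> 'F_2.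
Proof.
elim: v w => [|a v IH] [|b w] /=; rewrite ?big_ord0 //.
  by rewrite big1 // => i _; rewrite nth_nil mulr0.
rewrite big_ord_recl /= -IH; case: a b => [] [] /=;
  rewrite ?mul0r ?mulr0 ?mulr1 ?add0r //.
by case: (dotv v w); apply/eqP.
Qed.

Lemma nth_xorm M N i : size M = size N ->
  nth [::] (xorm M N) i = xorv (nth [::] M i) (nth [::] N i).
Proof.
elim: M N i => [|r M IH] [|s N] [|i] //= [] e.
exact: IH.
Qed.

Lemma size_xorm M N : size M = size N -> size (xorm M N) = size M.
Proof. by elim: M N => [|r M IH] [|s N] //= [] /IH ->. Qed.

Definition square k (M : seq bitseq) := size M = k /\ forall i, (i < k)%N -> size (nth [::] M i) = k.

Lemma square_left_rows k v T : (forall M, M \in T -> square k M) ->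
  square k (left_rows (zero_mat k) v T).
Proof.
have sqz : square k (zero_mat k).
  by split=> [|i ik]; rewrite ?size_nseq // nth_nseq ik size_nseq.
elim: v T => [|b v IH] [|M T] //= sqT.
have /IH[sL rL] : forall N, N \in T -> square k N.
  by move=> N NT; apply: sqT; rewrite inE NT orbT.
have [sM rM] := sqT M (mem_head _ _).
case: b; last by split.
split=> [|i ik]; first by rewrite size_xorm ?sM.
by rewrite nth_xorm ?sM // size_xorv rM // rL.
Qed.

Lemma nth_left_rows k v T l j : (forall M, M \in T -> square k M) -> (l < k)%N ->
  (nth false (nth [::] (left_rows (zero_mat k) v T) l) j)%:R =
  \sum_(i < size T) (nth false v i)%:R *
    (nth false (nth [::] (nth [::] T i) l) j)%:R :> 'F_2.
Proof.
move=> sqT lk; elim: v T sqT => [|b v IH] [|M T] /= sqT;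
  rewrite ?big_ord0 ?nth_nseq ?lk ?nth_nseq ?if_same //.
  by rewrite big1 // => i _; rewrite nth_nil mul0r.
have sqT' N : N \in T -> square k N by move=> NT; apply: sqT; rewrite inE NT orbT.
have [sM rM] := sqT M (mem_head _ _); have [sL rL] := square_left_rows v sqT'.
rewrite big_ord_recl /= -(IH T) //.
case: b; rewrite ?mul0r ?add0r // mul1r -F2_addb nth_xorm ?sM //.
by rewrite nth_xorv // rM ?rL.
Qed.

Lemma F2_foldr (X : eqType) (step : X -> bool -> bool) (c : X -> 'F_2) a l :
  (forall x acc, x \in l -> (step x acc)%:R = acc%:R + c x) ->
  (foldr step a l)%:R = a%:R + \sum_(x <- l) c x.
Proof.
elim: l => [|x l IH] H; first by rewrite big_nil addr0.
rewrite /= H ?mem_head // IH => [|y acc yl]; last by apply: H; rewrite inE yl orbT.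
by rewrite big_cons -addrA [c x + _]addrC.
Qed.

Section HeckeAlgebra.
Variables (n : nat) (gens : seq (code * nat)) (tb : table).
Hypothesis ok : table_ok n gens tb.
Local Notation A := (F2S n).
Local Notation Q := (qlist n gens).
Local Notation k := (size tb.2).
Local Notation d := (dc tb.1).
Local Notation us i := (row tb i).2.
Implicit Types (v w : bitseq) (a b : A) (s : 'S_n).

Let gens_valid c : c \in gens -> validb n c.1.
Proof. by case/and5P: ok => /allP H _ _ _ _; apply: H. Qed.
Lemma qlist_valid u : u \in Q -> validb n u.
Proof. by case/and5P: ok => _ /allP H _ _ _; apply: H. Qed.
Lemma qlist_odd : odd (size Q). Proof. by case/and5P: ok. Qed.
Let first_row : row tb 0 = (iota 0 n, [:: iota 0 n]).
Proof.
case/and5P: ok => _ _ _ + _; rewrite /first_ok; case: (row tb 0) => x us.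
by case/andP => /eqsP -> ; case: us => [|u []] // /eqsP ->.
Qed.
Let rowP i : (i < k)%N -> [/\ validb n (row tb i).1, iota 0 n \in us i &
  forall u, u \in us i -> u \in Q /\ d (cmp u (row tb i).1) = i].
Proof.
case/and5P: ok => _ _ _ _ /and4P[/allP ro _ _ _] ik.
have := ro i; rewrite mem_iota add0n => /(_ ik).
rewrite /row_ok; case: (row tb i) => x us /and3P[vx us1 /allP aus]; split=> // [|u uus].
  by case: us us1 {aus} => // u us /eqsP ->; rewrite mem_head.
have /andP[/hasP[u' u'Q /eqsP ->] /eqnP ->] := aus _ uus.
by split.
Qed.
Let count_ok : foldr addn 0%N [seq (size xu.2 * size Q)%N | xu <- tb.2] = n`!.
Proof. by case/and5P: ok => _ _ _ _ /and4P[_ /eqnP]. Qed.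

Definition rep i : 'S_n := decode n (row tb i).1.

Lemma enc_rep i : (i < k)%N -> enc (rep i) = (row tb i).1.
Proof. by move=> ik; have [vx _ _] := rowP ik; rewrite decodeK. Qed.

Let rowE i u : (i < k)%N -> u \in us i ->
  enc (decode n u * rep i) = cmp u (row tb i).1.
Proof.
move=> ik uus; have [vx _ aus] := rowP ik; have [uQ _] := aus _ uus.
by rewrite encM !decodeK // qlist_valid.
Qed.

Let leafP s : exists2 i, (i < k)%N & exists u q,
  [/\ d (enc s) = i, u \in us i, q \in Q & s = (decode n u * rep i * decode n q)%g].
Proof.
case/and5P: ok => _ _ _ _ /and4P[_ _ /allP lo _].
have := lo _ (enc_all s); rewrite /leaf_ok /dc; case: tget => [[[i j] q]|] //.
case/and4P=> ik ju qQ /eqsP sE; exists i => //.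
exists (nth [::] (us i) j), (nth [::] Q q); split; rewrite ?mem_nth //.
apply: enc_inj; rewrite encM rowE ?mem_nth // sE decodeK //.
by apply: qlist_valid; rewrite mem_nth.
Qed.

Lemma dc_lt s : (d (enc s) < k)%N.
Proof. by have [i ik [u [q [-> _ _ _]]]] := leafP s. Qed.

Let genP c s : c \in gens ->
  d (enc (decode n c.1 * s)) = d (enc s) /\ d (enc (s * decode n c.1)) = d (enc s).
Proof.
case/and5P: ok => _ _ _ _ /and4P[_ _ _ /allP go] cg.
have /allP/(_ _ cg)/andP[/eqnP lE /eqnP rE] := go _ (enc_all s).
by rewrite !encM !decodeK ?gens_valid.
Qed.

Definition linv a := forall c s, c \in gens -> a (decode n c.1 * s)%g = a s.
Definition rinv a := forall c s, c \in gens -> a (s * decode n c.1)%g = a s.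

(** [Q] is a list of words in the generators; induction on words passes from invariance under
    generators to invariance under [Q], without showing that [Q] is a subgroup. *)
Lemma qlist_ind (P : 'S_n -> Prop) : P 1%g ->
  (forall c x, c \in gens -> P x -> P (decode n c.1 * x)%g) ->
  forall u, u \in Q -> P (decode n u).
Proof.
move=> P1 PM; suff H g : {subset g <= gens} -> forall u, u \in qlist n g ->
    exists2 x, u = enc x & P x.
  by move=> u /(H gens (fun _ => id))[x -> Px]; rewrite encK.
elim: g => [|[c o] g IH] sub u /=.
  by rewrite inE => /eqP ->; exists 1%g; rewrite ?enc1.
case/flattenP => l /mapP[i _ ->] /mapP[y yQ ->].
have cg : (c, o) \in gens by apply: sub; rewrite mem_head.
have [|x -> Px] := IH _ _ yQ; first by move=> z zg; apply: sub; rewrite inE zg orbT.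
elim: i => [|i [z zE Pz]]; first by exists x.
exists (decode n c * z)%g; last exact: (PM _ _ cg).
by rewrite /= zE encM decodeK //; exact: (gens_valid cg).
Qed.

Lemma linvQ a u s : linv a -> u \in Q -> a (decode n u * s)%g = a s.
Proof.
move=> la uQ; move: s; pattern (decode n u); apply: qlist_ind uQ => [s|c x cg IH s].
  by rewrite mul1g.
by rewrite -mulgA la.
Qed.

Lemma rinvQ a u s : rinv a -> u \in Q -> a (s * decode n u)%g = a s.
Proof.
move=> ra uQ; move: s; pattern (decode n u); apply: qlist_ind uQ => [s|c x cg IH s].
  by rewrite mulg1.
by rewrite mulgA IH ra.
Qed.

Lemma biinv_rep a s : linv a -> rinv a -> a s = a (rep (d (enc s))).
Proof.
move=> la ra; have [i ik [u [q [-> uus qQ ->]]]] := leafP s.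
have [_ _ /(_ _ uus)[uQ _]] := rowP ik.
by rewrite rinvQ // linvQ.
Qed.

Let decode1 : decode n (iota 0 n) = 1%g.
Proof. by rewrite -enc1 encK. Qed.

Lemma dc_rep i : (i < k)%N -> d (enc (rep i)) = i.
Proof.
move=> ik; have [_ u1 aus] := rowP ik; have [_ dE] := aus _ u1.
by rewrite -[rep i]mul1g -decode1 rowE.
Qed.

Let RR := flatten [seq [seq (decode n u * rep i)%g | u <- us i] | i <- iota 0 k].

(** The products contain every permutation by [leafP] and number n! by [count_ok], so none is
    repeated. *)
Let perm_RR : perm_eq (enum {: 'S_n}) [seq (r * decode n q)%g | r <- RR, q <- Q].
Proof.
apply: uniq_min_perm => [|s _|]; first exact: enum_uniq.
  have [i ik [u [q [_ uus qQ ->]]]] := leafP s.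
  apply/allpairsP; exists ((decode n u * rep i)%g, q); split=> //=.
  apply/flattenP; exists [seq (decode n u * rep i)%g | u <- us i]; last exact: map_f.
  by apply: map_f; rewrite mem_iota.
rewrite size_allpairs -cardE card_Sn -count_ok size_flatten /shape -map_comp.
rewrite -{2}(mkseq_nth ([::], [::]) tb.2) /mkseq -map_comp.
elim: (iota 0 k) => //= i l IH.
by rewrite mulnDl leq_add // size_map.
Qed.

(** Each left coset contributes [|Q|] equal terms, which over F_2 amount to one. *)
Lemma sum_cosets (F : 'S_n -> 'F_2) :
  (forall c s, c \in gens -> F (s * decode n c.1)%g = F s) ->
  \sum_s F s = \sum_(i < k) \sum_(u <- us i) F (decode n u * rep i)%g.
Proof.
move=> FQ.
have FQ' u s : u \in Q -> F (s * decode n u)%g = F s.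
  move=> uQ; have := @rinvQ [ffun s => F s] u s _ uQ; rewrite !ffunE; apply.
  by move=> c t cg; rewrite !ffunE FQ.
rewrite -big_enum (perm_big _ perm_RR) /= big_allpairs_dep /=.
have -> : \sum_(r <- RR) \sum_(q <- Q) F (r * decode n q)%g = \sum_(r <- RR) F r.
  apply: eq_bigr => r _; rewrite (eq_big_seq (fun=> F r)) => [|q qQ]; last exact: FQ'.
  by rewrite big_const_seq count_predT iter_addr_0 -mulr_natr F2_odd qlist_odd mulr1.
rewrite big_flatten big_map (_ : iota 0 k = index_iota 0 k) ?big_mkord.
  by apply: eq_bigr => i _; rewrite big_map.
by rewrite /index_iota subn0.
Qed.

Definition gal v : A := [ffun s => (nth false v (d (enc s)))%:R].

Lemma galE v s : gal v s = (nth false v (d (enc s)))%:R.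
Proof. by rewrite ffunE. Qed.

Lemma gal_linv v : linv (gal v).
Proof. by move=> c s cg; rewrite !galE (genP s cg).1. Qed.

Lemma gal_rinv v : rinv (gal v).
Proof. by move=> c s cg; rewrite !galE (genP s cg).2. Qed.

Lemma mul_linv a b : linv a -> linv (a * b).
Proof.
move=> la c s cg; rewrite !galg_mulE (reindex_inj (mulgI (decode n c.1))).
by apply: eq_bigr => h _; rewrite la // invMg -mulgA mulKg.
Qed.

Lemma mul_rinv a b : rinv b -> rinv (a * b).
Proof.
move=> rb c s cg; rewrite !galg_mulE.
by apply: eq_bigr => h _; rewrite mulgA rb.
Qed.

Definition coefs a : bitseq := [seq a (rep i) != 0 | i <- iota 0 k].

Lemma size_coefs a : size (coefs a) = k. Proof. by rewrite size_map size_iota. Qed.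

Lemma coefsK a : linv a -> rinv a -> gal (coefs a) = a.
Proof.
move=> la ra; apply/ffunP => s; rewrite galE (nth_map 0%N) ?size_iota ?dc_lt //.
by rewrite nth_iota ?dc_lt // add0n -F2_bool -biinv_rep.
Qed.

Lemma gal_rep v i : (i < k)%N -> gal v (rep i) = (nth false v i)%:R.
Proof. by move=> ik; rewrite galE dc_rep. Qed.

Lemma galD v w : size v = size w -> gal (xorv v w) = gal v + gal w.
Proof. by move=> vw; apply/ffunP => s; rewrite !ffunE nth_xorv // F2_addb. Qed.

Lemma gal0 : gal (nseq k false) = 0.
Proof. by apply/ffunP => s; rewrite !ffunE nth_nseq if_same. Qed.

Let T := left_mats tb.

Let size_T : size T = k. Proof. by rewrite size_map. Qed.

Let Trow l i : (l < k)%N -> (i < k)%N -> nth [::] (nth [::] T i) l =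
  foldr (fun r acc => toggle (d (cmp r (row tb l).1)) acc) (nseq k false)
    [seq cinv (cmp u (row tb i).1) | u <- us i].
Proof.
by move=> lk ik; rewrite (nth_map ([::], [::])) // (nth_map ([::], [::])).
Qed.

Let size_Ti i : (i < k)%N -> size (nth [::] T i) = k.
Proof. by move=> lk; rewrite (nth_map ([::], [::])) // !size_map. Qed.

Let size_Trow l i : (l < k)%N -> (i < k)%N -> size (nth [::] (nth [::] T i) l) = k.
Proof.
move=> lk ik; rewrite Trow //; elim: (map _ _) => [|r R IH] /=.
  by rewrite size_nseq.
by rewrite size_toggle.
Qed.

Lemma square_left_mats M : M \in T -> square k M.
Proof.
move=> MT; have := index_mem M T; rewrite MT size_T => iT; rewrite -(nth_index [::] MT).
by split=> [|l lk]; [exact: size_Ti|exact: size_Trow].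
Qed.

Let dot_Trow l i w : (l < k)%N -> (i < k)%N ->
  (dotv (nth [::] (nth [::] T i) l) w)%:R =
  \sum_(u <- us i) gal w ((decode n u * rep i)^-1 * rep l)%g :> 'F_2.
Proof.
move=> lk ik; rewrite dotvE size_Trow // Trow //.
have [vl _ _] := rowP lk.
have uR u : u \in us i -> d (cmp (cinv (cmp u (row tb i).1)) (row tb l).1) =
    d (enc ((decode n u * rep i)^-1 * rep l)%g).
  by move=> uus; rewrite encM encV rowE // decodeK.
elim: (us i) uR => [|u l' IH] uR /=.
  by rewrite big_nil big1 // => j _; rewrite nth_nseq if_same mul0r.
rewrite big_cons -IH => [|u' u'l]; last by apply: uR; rewrite inE u'l orbT.
rewrite uR ?mem_head // galE; set m := d _.
have mk : (m < k)%N by exact: dc_lt.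
set acc := foldr _ _ _.
have sacc : size acc = k.
  by rewrite /acc; elim: (map _ _) => [|r R IHR] /=; rewrite ?size_nseq ?size_toggle.
under eq_bigr do rewrite nth_toggle ?sacc // F2_addb mulrDl.
rewrite big_split /= addrC; congr (_ + _).
rewrite (bigD1 (Ordinal mk)) //= eqxx mul1r big1 ?addr0 // => j jm.
by rewrite (_ : (j == m :> nat) = false) ?mul0r //; apply: negbTE.
Qed.

Lemma size_left_mats : size T = k. Proof. exact: size_T. Qed.

(** The summand [h |-> v(h) w(h^-1 s)] is constant on left cosets of [Q], so [sum_cosets] leaves
    exactly the parities stored in the matrices. *)
Lemma gal_mul v w :
  gal v * gal w = gal (apply_rows (left_rows (zero_mat k) v T) w).
Proof.
apply/ffunP => s; rewrite (biinv_rep s (mul_linv (gal w) (gal_linv v)) (mul_rinv (gal v) (gal_rinv w))).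
rewrite [RHS]galE; move: (d (enc s)) (dc_lt s) => l lk.
have [sL rL] := square_left_rows v square_left_mats.
rewrite galg_mulE sum_cosets => [|c h cg]; last first.
  rewrite gal_rinv // invMg -mulgA -[X in _ * X = _](gal_linv w _ cg).
  by rewrite mulKVg.
rewrite (nth_map [::]) ?sL // dotvE rL //.
under eq_bigr => i _.
  rewrite (eq_big_seq (fun u => (nth false v i)%:R * gal w ((decode n u * rep i)^-1 * rep l)%g)).
    rewrite -mulr_sumr -dot_Trow // dotvE size_Trow // mulr_sumr; over.
  move=> u uus; have [_ _ /(_ _ uus)[_ dE]] := rowP (ltn_ord i).
  by rewrite galE rowE // dE.
rewrite exchange_big; apply: eq_bigr => j _ /=.
rewrite (nth_left_rows _ _ square_left_mats) // mulr_suml size_T.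
by apply: eq_bigr => i _; rewrite mulrA.
Qed.

Lemma gal_basis_mul i w : (i < k)%N ->
  gal (unitv k i) * gal w = gal (apply_rows (nth [::] T i) w).
Proof.
move=> ik; rewrite gal_mul; congr gal.
have [sL rL] := square_left_rows (unitv k i) square_left_mats.
apply: (@eq_from_nth _ false) => [|l]; rewrite !size_map sL ?size_Ti // => lk.
rewrite !(nth_map [::]) ?sL ?size_Ti //; congr dotv.
apply: (@eq_from_nth _ false) => [|j]; rewrite rL ?size_Trow // => jk.
have := nth_left_rows (unitv k i) j square_left_mats lk.
rewrite size_T (bigD1 (Ordinal ik)) //= big1 => [|i' i'i]; last first.
  by rewrite nth_toggle ?size_nseq // nth_nseq if_same (negbTE (i'i : (i' : nat) != i)) mul0r.
rewrite nth_toggle ?size_nseq // nth_nseq if_same eqxx mul1r addr0.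
by case: (nth false _ j) (nth false _ j) => [] [] // /eqP.
Qed.

Lemma sum_all (F : 'S_n -> 'F_2) : \sum_s F s =
  \sum_(i < k) \sum_(u <- us i) \sum_(q <- Q) F (decode n u * rep i * decode n q)%g.
Proof.
rewrite -big_enum (perm_big _ perm_RR) /= big_allpairs_dep /=.
rewrite big_flatten big_map (_ : iota 0 k = index_iota 0 k) ?big_mkord.
  by apply: eq_bigr => i _; rewrite big_map.
by rewrite /index_iota subn0.
Qed.

Lemma dc_leaf i u q : (i < k)%N -> u \in us i -> q \in Q ->
  d (enc (decode n u * rep i * decode n q)) = i.
Proof.
move=> ik uus qQ; have [_ _ /(_ _ uus)[_ dE]] := rowP ik.
pose v := unitv k i; have := rinvQ (decode n u * rep i)%g (gal_rinv v) qQ.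
rewrite !galE rowE // dE !nth_toggle ?size_nseq // !nth_nseq !if_same eqxx.
by case: eqP => // _ /eqP.
Qed.

(* The sum of Q is the basis element of index 0. *)
Lemma mul_gal_unit (f : A) x :
  (f * gal (unitv k 0)) x = \sum_(q <- Q) f (x * (decode n q)^-1)%g.
Proof.
have k0 : (0 < k)%N by rewrite (leq_ltn_trans _ (dc_lt 1%g)).
rewrite galg_mulE (reindex (fun t => x * t^-1)%g) /=; last first.
  by exists (fun t => t^-1 * x)%g => t _; rewrite ?invMg ?invgK ?mulgKV ?mulgA
    ?mulKg ?mulgV ?mul1g ?mulgK ?mulVKg.
have tx t : ((x * t^-1)^-1 * x = t)%g by rewrite invMg invgK mulgKV.
under eq_bigr do rewrite tx.
rewrite sum_all (bigD1 (Ordinal k0)) //= first_row /= big_seq1.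
rewrite decode1 mul1g (_ : rep 0 = 1%g) ?mul1g; last by rewrite /rep first_row decode1.
rewrite [X in _ + X]big1 ?addr0 => [|i i0].
  apply: eq_big_seq => q qQ; rewrite mul1g galE.
  have := @dc_leaf 0 (iota 0 n) q k0; rewrite first_row mem_head => /(_ isT qQ).
  rewrite decode1 mul1g (_ : rep 0 = 1%g) ?mul1g => [->|]; last by rewrite /rep first_row decode1.
  by rewrite nth_toggle ?size_nseq // nth_nseq if_same eqxx mulr1.
rewrite big_seq big1 // => u uus; rewrite big_seq big1 // => q qQ.
rewrite galE dc_leaf // nth_toggle ?size_nseq // nth_nseq if_same.
by rewrite (negbTE (i0 : (i : nat) != 0%N)) mulr0.
Qed.

Lemma gal_mul1 v : gal v * gal (unitv k 0) = gal v.
Proof.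
apply/ffunP => x; rewrite mul_gal_unit (eq_big_seq (fun=> gal v x)) => [|q qQ].
  by rewrite big_const_seq count_predT iter_addr_0 -mulr_natr F2_odd qlist_odd mulr1.
by rewrite -(rinvQ _ (gal_rinv v) qQ) mulgKV.
Qed.

Lemma augm_gal v : size v = k -> augm (gal v) = (augv tb v)%:R.
Proof.
move=> sv; rewrite /augm sum_cosets; last by move=> c s cg; exact: gal_rinv.
rewrite /augv dotvE sv; apply: eq_bigr => i _.
rewrite (eq_big_seq (fun=> (nth false v i)%:R)) => [|u uus]; last first.
  by have [_ _ /(_ _ uus)[_ dE]] := rowP (ltn_ord i); rewrite galE rowE // dE.
rewrite big_const_seq count_predT iter_addr_0 -[LHS]mulr_natr (F2_odd (size _)).
by rewrite (nth_map ([::], [::])).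
Qed.

Lemma gal_class_vec (f : code -> bool) (D : A) :
  (forall s, D s = (f (enc s))%:R) -> (forall a, D * a = a * D) ->
  D * gal (unitv k 0) = gal (class_vec n gens tb f).
Proof.
move=> DE DC; rewrite -[LHS]coefsK; last first.
- exact/mul_rinv/gal_rinv.
- by rewrite DC; exact/mul_linv/gal_linv.
congr gal; apply: (@eq_from_nth _ false) => [|i]; rewrite ?size_coefs ?size_map // => ik.
rewrite (nth_map 0%N) ?size_iota // nth_iota // add0n (nth_map ([::], [::])) //.
have [vx _ _] := rowP ik.
have -> : (D * gal (unitv k 0)) (rep i) =
    (foldr (fun q (b : bool) => if f (cmp (row tb i).1 (cinv q)) then ~~ b else b) false Q)%:R.
  rewrite mul_gal_unit; elim: Q qlist_valid => [|q l IH] lv; first by rewrite big_nil.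
  rewrite big_cons IH => [|q' q'l]; last by apply: lv; rewrite inE q'l orbT.
  rewrite DE encM encV /rep (decodeK vx) (decodeK (lv _ (mem_head _ _))) /=.
  case: (f _); rewrite ?add0r //.
  by case: (foldr _ _ _); apply/eqP.
have F2_neq0 (b : bool) : (b%:R != 0 :> 'F_2) = b by case: b.
exact: F2_neq0.
Qed.

Lemma gal_cross (b : A) (w : code -> bool) v x c : size v = k ->
  (forall s, b s = (w (enc s))%:R) -> enc x = c ->
  (gal v * b) x =
  (foldr (fun bxu acc => if bxu.1 then
      foldr (fun u acc' => foldr (fun q acc'' =>
        if w (cmp (cinv (cmp (cmp u bxu.2.1) q)) c) then ~~ acc'' else acc'')
        acc' Q) acc bxu.2.2 else acc)
    false (zip v tb.2))%:R.
Proof.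
move=> sv bE xE; rewrite galg_mulE sum_all.
rewrite (@F2_foldr _ _ (fun p : bool * (code * seq code) => p.1%:R *
  \sum_(u <- p.2.2) \sum_(q <- Q) (w (cmp (cinv (cmp (cmp u p.2.1) q)) c))%:R)); last first.
  move=> [[] [y us]] acc _ /=; last by rewrite mul0r addr0.
  rewrite mul1r (@F2_foldr _ _ (fun u =>
    \sum_(q <- Q) (w (cmp (cinv (cmp (cmp u y) q)) c))%:R)) // => u acc' _.
  rewrite (@F2_foldr _ _ (fun q => (w (cmp (cinv (cmp (cmp u y) q)) c))%:R)) // => q acc'' _.
  by case: (w _); case: acc''; apply/eqP.
rewrite add0r (big_nth (false, ([::], [::]))) size_zip sv minnn big_mkord.
apply: eq_bigr => i _; rewrite nth_zip ?sv //= mulr_sumr.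
apply: eq_big_seq => u uus; rewrite mulr_sumr; apply: eq_big_seq => q qQ.
rewrite galE dc_leaf // bE encM encV xE encM rowE // decodeK //.
exact: qlist_valid.
Qed.
End HeckeAlgebra.

Lemma same_gal n gens1 gens2 tb1 tb2 v1 v2 :
  table_ok n gens1 tb1 -> table_ok n gens2 tb2 ->
  same_ok n tb1 v1 tb2 v2 -> gal n tb1 v1 = gal n tb2 v2.
Proof.
move=> _ _ /allP H; apply/ffunP => s; rewrite !galE.
by have /eqP -> := H _ (enc_all s).
Qed.

(** * Certificates for idempotents of Hecke algebras *)

Definition zerov (v : bitseq) := all negb v.

Fixpoint eqv (v w : bitseq) : bool :=
  match v, w with
  | [::], [::] => true
  | a :: v', b :: w' => if a then (if b then eqv v' w' else false)
                        else (if b then false else eqv v' w')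
  | _, _ => false
  end.

Fixpoint reduce (B : seq (nat * bitseq)) (v : bitseq) : bitseq :=
  if B is (p, b) :: B' then reduce B' (if nth false v p then xorv v b else v) else v.

Definition echelon (V : seq bitseq) : seq (nat * bitseq) :=
  foldl (fun B v => let v' := reduce B v in
    if zerov v' then B else rcons B (find id v', v')) [::] V.

(** Pivots need no checking: reduction only adds elements of [B], so a vector reduced to 0 lies in
    their span. *)
Definition spans k (B : seq (nat * bitseq)) (V : seq bitseq) : bool :=
  all (fun pb => eqn (size pb.2) k) B && all (fun v => zerov (reduce B v)) V.

Fixpoint selx (k : nat) (v : bitseq) (rows : seq bitseq) : bitseq :=
  match v, rows with
  | b :: v', r :: rows' => if b then xorv r (selx k v' rows') else selx k v' rows'
  | _, _ => nseq k false
  end.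

Fixpoint bitseqs m : seq bitseq :=
  if m is m'.+1 then
    [seq false :: c | c <- bitseqs m'] ++ [seq true :: c | c <- bitseqs m'] else [:: [::]].

Section Certificates.
Variables (k : nat) (T : seq (seq bitseq)).

Definition left_mat v := left_rows (zero_mat k) v T.

Definition vmul v w := apply_rows (left_mat v) w.

Definition corner_vec (Le : seq bitseq) f i := apply_rows Le (apply_rows (nth [::] T i) f).

Definition corner_span e (Le : seq bitseq) (B : seq (nat * bitseq)) : bool :=
  eqn (size e) k && eqv (apply_rows Le e) e &&
  spans k B [seq apply_rows Le (apply_rows M e) | M <- T].

(* In a local corner over F_2 with residue field F_2, either e b_i e or
   e b_i e + e is nilpotent; the flag tells which one is taken. *)
Definition nil_part (Le : seq bitseq) e (i : nat) : nat * bool * bitseq :=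
  let v := corner_vec Le e i in
  if zerov (iter 8 (fun x => corner_vec Le x i) e) then (i, false, v) else (i, true, xorv v e).

Definition nil_mul (Le : seq bitseq) (p : nat * bool * bitseq) (x : bitseq) : bitseq :=
  let y := corner_vec Le x p.1.1 in if p.1.2 then xorv y x else y.

(* The chain N, J N, J (J N), ... of spaces reaches 0. *)
Fixpoint nil_ok fuel Le (J : seq (nat * bool * bitseq)) (N : seq bitseq) : bool :=
  if all zerov N then true else
  if fuel is f.+1 then
    let P := flatten [seq [seq nil_mul Le p x | x <- N] | p <- J] in
    let B := echelon P in
    spans k B P && nil_ok f Le J [seq pb.2 | pb <- B]
  else false.

(* The corner is spanned by e and the span N of the elements of J, and J^8 N = 0:
   all elements of N are nilpotent and all elements of e + N are invertible. *)
Definition local_ok e (I : seq nat) : bool :=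
  let Le := left_mat e in
  let J := [seq nil_part Le e i | i <- I] in
  let V := [seq p.2 | p <- J] in
  [&& all (fun i => leq i.+1 k) I, corner_span e Le (echelon (e :: V)) &
    nil_ok 8 Le J V].

Definition small_ok e (I : seq nat) : bool :=
  let Le := left_mat e in
  let B := echelon (e :: [seq corner_vec Le e i | i <- I]) in
  [&& all (fun i => leq i.+1 k) I, corner_span e Le B & leq (size B) 4].

(** Independence is tested on all 32 combinations, which are then the 2^5 elements asked for by
    [big_corner]. *)
Definition big_ok e (I : seq nat) : bool :=
  let Le := left_mat e in
  let V := [seq corner_vec Le e i | i <- I] in
  [&& eqn (size I) 5, all (fun i => leq i.+1 k) I &
    all (fun c => zerov c || ~~ zerov (selx k c V)) (bitseqs 5)].

Definition link_ok e f i : bool :=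
  leq i.+1 k && ~~ zerov (corner_vec (left_mat e) f i).
End Certificates.

(** The unknowns are the values of a class function at class representatives. The equations saying
    that it annihilates both subgroup sums must span all linear forms in these values. *)
Definition class_ok n (reps : seq code) (gens1 gens2 : seq (code * nat)) (tb1 tb2 : table) :=
  let m := size reps in
  let Q1 := qlist n gens1 in let Q2 := qlist n gens2 in
  let EQ := [seq class_row m reps Q1 xu.1 | xu <- tb1.2] ++
            [seq class_row m reps Q2 xu.1 | xu <- tb2.2] in
  spans m (echelon EQ) [seq unitv m c | c <- iota 0 m] &&
  all (normal_ok n reps) (all_codes n).

(** * Soundness of the certificates *)

Lemma eqvP v w : reflect (v = w) (eqv v w).
Proof.
apply: (iffP idP) => [|<-]; last by elim: v => //= -[].
by elim: v w => [|[] v IH] [|[] w] //= /IH ->.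
Qed.

Lemma zerovP v : zerov v -> v = nseq (size v) false.
Proof. by elim: v => //= -[] v IH //= /IH <-. Qed.

Lemma mem_bitseqs c : c \in bitseqs (size c).
Proof. by elim: c => //= b c IH; rewrite mem_cat; case: b; rewrite map_f ?orbT. Qed.

(** The inverse of [e - y] with [y] nilpotent is the geometric series; its term of index 0 is 1
    instead of [e], which the factor [e] corrects. *)
Lemma corner_unit_nilpotent (A : pzRingType) (e r : A) m : e * e = e ->
  e * r = r -> r * e = r -> (e - r) ^+ m.+1 = 0 -> exists r', corner_unit e r r'.
Proof.
move=> ee er re; set y := e - r => y0.
have ey : e * y = y by rewrite /y mulrBr ee er.
have ye : y * e = y by rewrite /y mulrBl ee re.
have rE : r = e - y by rewrite /y opprB addrC subrK.
have eyX i : e * y ^+ i = y ^+ i * e.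
  by elim: i => [|i IH]; rewrite ?expr0 ?mulr1 ?mul1r // exprSr mulrA IH -!mulrA ey ye.
have ysum : (1 - y) * \sum_(i < m.+1) y ^+ i = 1.
  by apply/oppr_inj; rewrite -mulNr opprB -subrX1 y0 sub0r.
have ysum' : (\sum_(i < m.+1) y ^+ i) * (1 - y) = 1.
  apply: etrans ysum; rewrite mulr_suml mulr_sumr; apply: eq_bigr => i _.
  by rewrite mulrBr mulrBl mulr1 mul1r -exprS -exprSr.
have eS : e * \sum_(i < m.+1) y ^+ i = (\sum_(i < m.+1) y ^+ i) * e.
  by rewrite mulr_sumr mulr_suml; apply: eq_bigr => i _; exact: eyX.
have r1 : r = e * (1 - y) by rewrite rE mulrBr mulr1 ey.
have r2 : r = (1 - y) * e by rewrite rE mulrBl mul1r ye.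
exists (e * \sum_(i < m.+1) y ^+ i); split.
- by rewrite mulrA ee.
- by rewrite eS -mulrA ee.
- by rewrite mulrA re r1 -mulrA ysum mulr1.
- by rewrite eS r1 mulrA -(mulrA _ e e) ee -eS -mulrA ysum' mulr1.
Qed.

Section Combinations.
Variable n : nat.
Local Notation A := (F2S n).

Lemma galg_addxx (a : A) : a + a = 0.
Proof. by apply/ffunP => s; rewrite !ffunE F2_addxx. Qed.

Lemma galg_opp (a : A) : - a = a.
Proof. by apply/eqP; rewrite eq_sym -addr_eq0 galg_addxx. Qed.

Fixpoint comb (c : bitseq) (V : seq A) : A :=
  match c, V with
  | b :: c', v :: V' => (if b then v else 0) + comb c' V'
  | _, _ => 0
  end.

Definition span (V : seq A) (x : A) := exists2 c, size c = size V & x = comb c V.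

Lemma combD c c' V : size c = size c' -> comb (xorv c c') V = comb c V + comb c' V.
Proof.
elim: c c' V => [|b c IH] [|b' c'] [|v V] //=; rewrite ?addr0 // => -[/IH ->].
rewrite addrACA; congr (_ + _).
by case: b b' => [] []; rewrite ?addr0 ?add0r ?galg_addxx.
Qed.

Lemma comb0 V m : comb (nseq m false) V = 0.
Proof. by elim: m V => [|m IH] [|v V] //=; rewrite IH addr0. Qed.

Lemma span0 V : span V 0.
Proof. by exists (nseq (size V) false); rewrite ?size_nseq ?comb0. Qed.

Lemma spanD V x y : span V x -> span V y -> span V (x + y).
Proof.
move=> [c sc ->] [c' sc' ->]; exists (xorv c c'); last by rewrite combD // sc.
by rewrite size_xorv // sc.
Qed.

Lemma span_mem V x : x \in V -> span V x.
Proof.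
elim: V => // v V IH; rewrite inE => /predU1P[->|/IH[c sc ->]].
  by exists (true :: nseq (size V) false); rewrite /= ?size_nseq ?comb0 ?addr0.
by exists (false :: c); rewrite /= ?sc ?add0r.
Qed.

(** Over F_2 every additive map is linear. *)
Lemma span_sub (V W : seq A) (f : A -> A) : {morph f : x y / x + y} ->
  (forall v, v \in V -> span W (f v)) -> forall x, span V x -> span W (f x).
Proof.
move=> fD fV x [c _ ->].
have f0 : f 0 = 0 by apply: (@addrI _ (f 0)); rewrite -fD !addr0.
elim: c V fV => [|b c IH] [|v V] fV /=; rewrite ?f0; try exact: span0.
rewrite fD; apply: spanD; last by apply: IH => w wV; apply: fV; rewrite inE wV orbT.
by case: b; [apply: fV; rewrite mem_head|rewrite f0; exact: span0].
Qed.
End Combinations.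

Section Soundness.
Variables (n : nat) (gens : seq (code * nat)) (tb : table).
Hypothesis ok : table_ok n gens tb.
Local Notation A := (F2S n).
Local Notation k := (size tb.2).
Local Notation T := (left_mats tb).
Local Notation G := (gal n tb).
Implicit Types (v w e f : bitseq) (B : seq (nat * bitseq)).

Lemma gal_zerov v : zerov v -> G v = 0.
Proof.
move=> /zerovP ->; apply/ffunP => s.
by rewrite galE nth_nseq if_same ffunE.
Qed.

Lemma zerov_gal v : size v = k -> G v = 0 -> zerov v.
Proof.
move=> sv v0; apply/(all_nthP false) => i; rewrite sv => ik.
have := congr1 (fun a : A => a (rep n tb i)) v0.
rewrite (gal_rep ok) // ffunE; by case: (nth false v i) => // /eqP.
Qed.

Lemma vmulE v w : G v * G w = G (vmul k T v w).
Proof. exact: (gal_mul ok). Qed.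

Lemma size_left_mat v : size (left_mat k T v) = k.
Proof. by have [] := square_left_rows v (@square_left_mats tb). Qed.

Lemma size_vmul v w : size (vmul k T v w) = k.
Proof. by rewrite size_map size_left_mat. Qed.

Lemma corner_vecE e f i : (i < k)%N ->
  G (corner_vec T (left_mat k T e) f i) = G e * (G (unitv k i) * G f).
Proof. by move=> ik; rewrite (gal_basis_mul ok) // (gal_mul ok). Qed.

Lemma size_corner_vec e f i : size (corner_vec T (left_mat k T e) f i) = k.
Proof. by rewrite size_map size_left_mat. Qed.

Lemma reduce_span B v : (forall pb, pb \in B -> size pb.2 = k) -> size v = k ->
  size (reduce B v) = k /\ span [seq G pb.2 | pb <- B] (G v + G (reduce B v)).
Proof.
elim: B v => [|[p b] B IH] v sB sv /=; first by rewrite galg_addxx; split=> //; exact: span0.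
have sb : size b = k by exact: (sB (p, b) (mem_head _ _)).
have sB' pb : pb \in B -> size pb.2 = k by move=> pbB; apply: sB; rewrite inE pbB orbT.
have sp x : span [seq G pb.2 | pb <- B] x -> span (G b :: [seq G pb.2 | pb <- B]) x.
  by case=> c sc ->; exists (false :: c); rewrite /= ?sc ?add0r.
case: ifP => _; last by have [sr /sp] := IH v sB' sv.
have svb : size (xorv v b) = k by rewrite size_xorv ?sb.
have [sr /sp H] := IH _ sB' svb; split=> //.
have -> : G v + G (reduce B (xorv v b)) = (G (xorv v b) + G (reduce B (xorv v b))) + G b.
  by rewrite galD ?sb // addrAC -(addrA (G v)) galg_addxx addr0.
by apply: spanD => //; apply: span_mem; rewrite mem_head.
Qed.

Lemma spans_sound B V v : spans k B V -> v \in V -> size v = k ->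
  span [seq G pb.2 | pb <- B] (G v).
Proof.
case/andP=> /allP sB /allP zV vV sv.
have [|_ ] := reduce_span (B := B) _ sv; first by move=> pb /sB/eqnP.
by rewrite (gal_zerov (zV _ vV)) addr0.
Qed.

Lemma span_trans (V W : seq A) (x : A) : (forall v : A, v \in V -> span W v) ->
  span V x -> span W x.
Proof. by move=> VW; exact: (span_sub (f := id)). Qed.

Lemma echelon_sub V : (forall v, v \in V -> size v = k) -> forall pb, pb \in echelon V ->
  size pb.2 = k /\ span [seq G v | v <- V] (G pb.2).
Proof.
rewrite /echelon => sV.
pose P B := forall pb, pb \in B -> size pb.2 = k /\ span [seq G v | v <- V] (G pb.2).
rewrite -/(P _); set step := fun B v => _.
suff H V' B : {subset V' <= V} -> P B -> P (foldl step B V') by apply: H.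
elim: V' B => //= v V' IH B sub PB; apply: IH => [w wV'|].
  by apply: sub; rewrite inE wV' orbT.
have vV : v \in V by apply: sub; rewrite mem_head.
rewrite /step; case: ifP => // _ pb; rewrite mem_rcons inE => /predU1P[->|/PB //] /=.
have [|sr H] := reduce_span (B := B) _ (sV _ vV); first by move=> pb' /PB[].
split=> //; have -> : G (reduce B v) = G v + (G v + G (reduce B v)).
  by rewrite addrA galg_addxx add0r.
apply: spanD; first by apply: span_mem; exact: map_f.
by apply: span_trans H => _ /mapP[pb' /PB[_ ?] ->].
Qed.

Lemma gal_span v : size v = k -> span [seq G (unitv k i) | i <- iota 0 k] (G v).
Proof.
move=> sv; exists v; rewrite ?size_map ?size_iota //.
apply/ffunP => s; rewrite galE; have dk := dc_lt ok s.
(* The starting index varies in the induction because [comb] consumes the list of basis elements. *)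
have H c m : (comb c [seq G (unitv k i) | i <- iota m (size c)]) s =
    (if (m <= dc tb.1 (enc s) < m + size c)%N then nth false c (dc tb.1 (enc s) - m) else false)%:R.
  elim: c m => [|b c IH] m /=; first by rewrite ffunE addn0; case: ltngtP.
  rewrite ffunE IH addSnnS.
  have -> : (if b then G (unitv k m) else 0) s = (b && (dc tb.1 (enc s) == m))%:R.
    case: b; last by rewrite ffunE.
    rewrite galE; have [mk|km] := ltnP m k.
      by rewrite nth_toggle ?size_nseq // nth_nseq if_same.
    rewrite (_ : (_ == m) = false); last by apply: ltn_eqF; exact: leq_trans km.
    congr (_%:R); rewrite /unitv.
    elim: (k) m (dc _ _) km {dk IH} => [|k' IH] [|m] [|d] //=; rewrite ?nth_nil //.
    by rewrite ltnS; exact: IH.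
  case: (ltngtP m (dc tb.1 (enc s))) => [lt|gt|eq].
  - by rewrite andbF add0r -(subnSK lt).
  - by rewrite andbF addr0.
  - by rewrite andbT addr0 -eq addnS ltnS leq_addr subnn.
by rewrite -{2}sv H leq0n add0n sv dk subn0.
Qed.

Section Corner.
Variable e : bitseq.
Local Notation E := (G e).
Local Notation Le := (left_mat k T e).

(** For any [a] of the group algebra, [E * a * E] is invariant under [Q] on both sides, hence a
    combination of double coset sums. So the corner in the group algebra is the corner in the Hecke
    algebra, where finitely many products decide. *)
Lemma corner_span_sound B : corner_span k T e Le B ->
  [/\ size e = k, E * E = E &
    forall a, span [seq G pb.2 | pb <- B] (E * a * E)].
Proof.
case/andP => /andP[/eqnP se /eqvP ee] sB; split=> // [|a].
  by rewrite vmulE /vmul ee.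
have EE : E * E = E by rewrite vmulE /vmul ee.
have -> : E * a * E = E * (E * a * E) * E by rewrite !mulrA EE -[RHS]mulrA EE.
suff H u : size u = k -> span [seq G pb.2 | pb <- B] (E * G u * E).
  rewrite -(coefsK ok (a := E * a * E)); first exact/H/size_coefs.
    exact/mul_linv/mul_linv/(gal_linv ok).
  exact/mul_rinv/(gal_rinv ok).
move=> su.
have fD : {morph (fun x : A => E * x * E) : x y / x + y}.
  by move=> x y; rewrite mulrDr mulrDl.
apply: (span_sub fD _ (gal_span su)) => _ /mapP[i + ->]; rewrite mem_iota add0n => ik.
rewrite -mulrA (gal_basis_mul ok) // vmulE; apply: spans_sound sB _ _; last exact: size_vmul.
by apply: map_f; rewrite mem_nth // size_left_mats.
Qed.

Hypothesis EE : E * E = E.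

Definition nil_val (p : nat * bool * bitseq) : A :=
  E * G (unitv k p.1.1) * E + (if p.1.2 then E else 0).

Lemma nil_part_val i : (i < k)%N -> size e = k ->
  (nil_part T Le e i).1.1 = i /\ size (nil_part T Le e i).2 = k /\
  G (nil_part T Le e i).2 = nil_val (nil_part T Le e i).
Proof.
move=> ik se; have sv := size_corner_vec e e i; rewrite /nil_part /nil_val.
case: ifP => _ /=; split=> //; split; rewrite ?size_xorv ?sv //.
  by rewrite corner_vecE // mulrA addr0.
by rewrite galD ?sv // corner_vecE // mulrA.
Qed.

Lemma nil_mulE p x : (p.1.1 < k)%N -> size x = k -> E * G x = G x ->
  size (nil_mul T Le p x) = k /\ G (nil_mul T Le p x) = nil_val p * G x.
Proof.
move=> ik sx Ex; have sv := size_corner_vec e x p.1.1; rewrite /nil_mul /nil_val.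
rewrite mulrDl -[E * _ * E * _]mulrA Ex -mulrA -corner_vecE //.
case: ifP => _; split; rewrite ?size_xorv ?sv // ?mul0r ?addr0 //.
by rewrite galD ?sv // Ex.
Qed.

Lemma span_fix (V : seq A) (z : A) : (forall v : A, v \in V -> z * v = v) ->
  forall x, span V x -> z * x = x.
Proof.
move=> zV x [c _ ->]; elim: c V zV => [|b c IH] [|v V] zV /=; rewrite ?mulr0 //.
rewrite mulrDr IH => [|w wV]; last by apply: zV; rewrite inE wV orbT.
by case: b; rewrite ?mulr0 // zV ?mem_head.
Qed.

(** Left multiplication by [j] takes the span of one list of the chain into the span of the next,
    and the last list consists of zeros. *)
Lemma nil_ok_sound fuel (J : seq (nat * bool * bitseq)) (N : seq bitseq) :
  (forall p, p \in J -> (p.1.1 < k)%N) ->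
  (forall x, x \in N -> size x = k /\ E * G x = G x) ->
  nil_ok k T fuel Le J N ->
  forall j x, span [seq nil_val p | p <- J] j -> span [seq G x | x <- N] x ->
    j ^+ fuel * x = 0.
Proof.
have Z (V : seq bitseq) x : all zerov V -> span [seq G v | v <- V] x -> x = 0.
  move=> /allP Vz [c _ ->]; elim: c V Vz => [|b c IH] [|v V] //= Vz.
  rewrite IH => [|w wV]; last by apply: Vz; rewrite inE wV orbT.
  by rewrite gal_zerov ?addr0 ?if_same // Vz ?mem_head.
move=> Jk; elim: fuel N => [|fuel IH] N NE /=; case: ifP => // Nz.
- by move=> _ j x _ /(Z _ _ Nz) ->; rewrite mulr0.
- by move=> _ j x _ /(Z _ _ Nz) ->; rewrite mulr0.
set P := flatten _; case/andP=> sB nB j x Jj Nx.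
have PE v : v \in P -> size v = k /\ E * G v = G v.
  case/flattenP => _ /mapP[p pJ ->] /mapP[y yN ->].
  have [sy Ey] := NE _ yN; have [sm mE] := nil_mulE (Jk _ pJ) sy Ey.
  split=> //; rewrite mE /nil_val mulrA mulrDr !mulrA EE.
  by congr ((_ + _) * _); case: ifP; rewrite ?mulr0.
have Bsub pb : pb \in echelon P -> size pb.2 = k /\ span [seq G v | v <- P] (G pb.2).
  by apply: echelon_sub => v /PE[].
rewrite exprSr -mulrA; apply: (IH [seq pb.2 | pb <- echelon P]) => //.
  move=> _ /mapP[pb /Bsub[sb spb] ->]; split=> //.
  by apply: span_fix spb => _ /mapP[v /PE[_ vE] ->].
rewrite -map_comp.
have jD : {morph (fun j : A => j * x) : a b / a + b} by move=> a b; rewrite mulrDl.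
apply: (span_sub jD _ Jj) => _ /mapP[p pJ ->].
have pD : {morph (fun x : A => nil_val p * x) : a b / a + b} by move=> a b; rewrite mulrDr.
apply: (span_sub pD _ Nx) => _ /mapP[y yN ->].
have [sy Ey] := NE _ yN; have [sm <-] := nil_mulE (Jk _ pJ) sy Ey.
apply: spans_sound sB _ sm; apply/flattenP; exists [seq nil_mul T Le p x | x <- N].
  exact: map_f.
exact: map_f.
Qed.
End Corner.

Lemma local_sound e I : local_ok k T e I ->
  G e * G e = G e /\ corner_local (G e).
Proof.
rewrite /local_ok; set Le := left_mat k T e; set J := [seq nil_part T Le e i | i <- I].
set V := [seq p.2 | p <- J]; case/and3P=> /allP Ik cs nil.
have [se EE cor] := corner_span_sound cs; split=> // r Er rE.
have Jk p : p \in J -> (p.1.1 < k)%N.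
  by case/mapP=> i iI ->; have [-> _] := nil_part_val (Ik _ iI) se; exact: Ik.
have JE p : p \in J -> size p.2 = k /\ G p.2 = nil_val e p.
  by case/mapP=> i iI ->; have [_ []] := nil_part_val (Ik _ iI) se.
have valE p : G e * nil_val e p = nil_val e p /\ nil_val e p * G e = nil_val e p.
  rewrite /nil_val mulrDl mulrDr; split.
    by rewrite !mulrA EE; case: ifP; rewrite ?mulr0 ?EE.
  by rewrite -!mulrA EE; case: ifP; rewrite ?mul0r ?EE.
have [b [j [jJ rE']]] : exists (b : bool) j, span [seq nil_val e p | p <- J] j /\
    r = (if b then G e else 0) + j.
  have : span (G e :: [seq G v | v <- V]) r.
    have := cor r; rewrite Er rE; apply: span_trans => _ /mapP[pb pbB ->].
    have [v|_ //] := echelon_sub (V := e :: V) _ pbB.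
     by rewrite inE => /predU1P[-> //|/mapP[p /JE[sp _] ->]].
  case=> -[|b c] // [sc] ->; exists b, (comb c [seq G v | v <- V]); split=> //.
  exists c; first by rewrite sc !size_map.
  congr comb; rewrite -map_comp; apply/eq_in_map => p pJ /=.
  by have [_ ->] := JE _ pJ.
(* [j] lies in the span of [J] and also in that of [N], so [j^8] kills [j]. *)
have jn : j ^+ 9 = 0.
  rewrite exprSr; apply: (nil_ok_sound EE Jk _ nil jJ) => [x /mapP[p pJ ->]|].
    have [sp ->] := JE _ pJ; split=> //; by have [-> _] := valE p.
  rewrite -map_comp (_ : [seq _ | p <- J] = [seq nil_val e p | p <- J]) //.
  by apply/eq_in_map => p pJ /=; have [_ ->] := JE _ pJ.
case: b rE' => rE'; last by left; exists 8; rewrite rE' add0r.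
right; apply: (@corner_unit_nilpotent _ _ _ 8 EE Er rE).
by rewrite rE' opprD addrA subrr sub0r galg_opp.
Qed.

Lemma corner_vec_span (e : bitseq) (I : seq nat)
    (V := [seq corner_vec T (left_mat k T e) e i | i <- I]) :
  (forall i, i \in I -> (i < k)%N) -> G e * G e = G e ->
  forall x : A, span [seq G v | v <- V] x -> G e * x = x /\ x * G e = x.
Proof.
move=> Ik EE x xV.
have VE a : a \in [seq G v | v <- V] -> exists y, a = G e * (y * G e).
  case/mapP=> _ /mapP[i iI ->] ->; exists (G (unitv k i)).
  by rewrite corner_vecE // Ik.
have xE : G e * x = x by apply: span_fix xV => _ /VE[y ->]; rewrite (mulrA (G e)) EE.
split=> //; case: xV => c _ ->; elim: c V VE => [|b c IH] [|v V'] VE /=; rewrite ?mul0r //.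
rewrite mulrDl IH => [|a aV]; last by apply: VE; rewrite inE aV orbT.
case: b; rewrite ?mul0r //.
by have [|y ->] := VE (G v); rewrite ?mem_head // -!mulrA EE.
Qed.

Lemma gal_selx c (V : seq bitseq) : (forall v, v \in V -> size v = k) ->
  G (selx k c V) = comb c [seq G v | v <- V] /\ size (selx k c V) = k.
Proof.
elim: c V => [|b c IH] [|v V] sV /=; rewrite ?gal0 ?size_nseq //.
have [|H sH] := IH V; first by move=> w wV; apply: sV; rewrite inE wV orbT.
case: b; last by rewrite H add0r.
by rewrite galD ?size_xorv ?sH ?H // sV ?mem_head.
Qed.

Lemma xorv_eq v w : size v = size w -> zerov (xorv v w) -> v = w.
Proof. by elim: v w => [|[] v IH] [|[] w] //= [] /IH H /H ->. Qed.

Lemma big_sound e I : G e * G e = G e -> big_ok k T e I -> big_corner (G e).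
Proof.
move=> EE; rewrite /big_ok; set V := [seq _ | i <- I]; case/and3P=> /eqnP sI /allP Ik ind.
have sV v : v \in V -> size v = k by case/mapP=> i _ ->; exact: size_corner_vec.
have H (t : 5.-tuple bool) : span [seq G v | v <- V] (comb t [seq G v | v <- V]).
  by exists t; rewrite // size_tuple !size_map sI.
exists (fun t : 5.-tuple bool => comb t [seq G v | v <- V]) => [t t' tt'|t]; last first.
  exact: (corner_vec_span Ik EE (H t)).
apply: val_inj; apply: xorv_eq; rewrite ?size_tuple //.
have [GE sE] := gal_selx (xorv t t') sV.
have /zerov_gal : G (selx k (xorv t t') V) = 0.
  by rewrite GE combD ?size_tuple // tt' galg_addxx.
move=> /(_ sE) z; have := allP ind (xorv t t') _; rewrite z orbF; apply.
by have := mem_bitseqs (xorv t t'); rewrite size_xorv ?size_tuple.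
Qed.

Lemma small_sound e I : small_ok k T e I -> G e * G e = G e /\ ~ big_corner (G e).
Proof.
case/and3P=> _ cs; set B := echelon _; move=> sB.
have [se EE cor] := corner_span_sound cs; split=> // -[g gI gE].
have /choice[c cE] (t : 5.-tuple bool) : exists c : (size B).-tuple bool,
    g t = comb c [seq G pb.2 | pb <- B].
  have [c sc cE] := cor (g t); rewrite !size_map in sc.
  exists (tcast sc (in_tuple c)); rewrite val_tcast /= -cE.
  by have [-> ->] := gE t.
have /leq_card : injective c by move=> t t' tt'; apply: gI; rewrite !cE tt'.
rewrite !card_tuple card_bool leq_exp2l // => /leq_trans/(_ sB).
by [].
Qed.

Lemma link_sound e f i : link_ok k T e f i -> exists a, G e * a * G f != 0.
Proof.
case/andP=> ik nz; exists (G (unitv k i)); apply: contra nz => /eqP z.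
by apply: zerov_gal; rewrite ?size_corner_vec // corner_vecE // mulrA.
Qed.
End Soundness.

(** * Class functions and blocks *)

Section ClassFunctions.
Variable n : nat.
Implicit Types (s t : 'S_n) (f : F2S n).

Definition point s : F2S n := [ffun g => (g == s)%:R].

Lemma point_mul s f t : (point s * f) t = f (s^-1 * t)%g.
Proof.
rewrite galg_mulE (bigD1 s) //= ffunE eqxx mul1r big1 ?addr0 // => h /negPf hs.
by rewrite ffunE hs mul0r.
Qed.

Lemma mul_point s f t : (f * point s) t = f (t * s^-1)%g.
Proof.
rewrite galg_mulE (bigD1 (t * s^-1)%g) //= ffunE invMg invgK mulgKV eqxx mulr1.
rewrite big1 ?addr0 // => h /negPf hs; rewrite ffunE.
case: eqP => [E|_]; last by rewrite mulr0.
by rewrite -E invMg invgK mulKVg eqxx in hs.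
Qed.

Lemma central_class f s t : (forall a, f * a = a * f) -> f (s * t * s^-1)%g = f t.
Proof.
move=> fC; have := congr1 (fun a : F2S n => a (s * t)%g) (fC (point s)).
by rewrite mul_point point_mul mulKg.
Qed.

Lemma class_central f : (forall s t, f (s * t * s^-1)%g = f t) ->
  forall a, f * a = a * f.
Proof.
move=> fC a; apply/ffunP => g; rewrite !galg_mulE (reindex (fun h => g * h^-1)%g) /=.
  apply: eq_bigr => h _; rewrite invMg invgK mulgKV mulrC; congr (_ * _).
  by rewrite -[RHS](fC h) mulKVg.
by exists (fun h => h^-1 * g)%g => h _; rewrite invMg invgK ?mulKVg ?mulgKV.
Qed.

Lemma normal_formE reps s : normal_ok n reps (enc s) ->
  exists2 t, normal_form (enc s) = enc (t * s * t^-1)%g & has (eqs (normal_form (enc s))) reps.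
Proof.
case/andP=> v h; exists (decode n (cycle_word (enc s))) => //.
by rewrite /normal_form !encM encV decodeK.
Qed.

Lemma nth_pos r reps : has (eqs r) reps -> (pos r reps < size reps)%N /\ nth [::] reps (pos r reps) = r.
Proof.
elim: reps => //= r' reps IH; rewrite /=.
by case: eqsP => [->|_ /= /IH].
Qed.

Lemma dotv_xorv u v w : size u = size v -> dotv (xorv u v) w = dotv u w (+) dotv v w.
Proof.
elim: u v w => [|a u IH] [|b v] [|c w] //= [] /IH H.
by case: a b c => [] [] [] /=; rewrite H; case: (dotv u w) (dotv v w) => [] [].
Qed.

Lemma dotv_toggle i v w : (i < size v)%N -> dotv (toggle i v) w = nth false w i (+) dotv v w.
Proof.
elim: v i w => // b v IH [|i] [|c w] //=; first by case: b c => [] []; case: (dotv v w).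
by move=> /IH ->; case: b c => [] [] //; case: (nth false w i) (dotv v w) => [] [].
Qed.

Lemma dotv_nseq k w : dotv (nseq k false) w = false.
Proof. by elim: k w => [|k IH] [|c w] /=. Qed.

Lemma reduce_dot m w B v : (forall pb, pb \in B -> size pb.2 = m /\ dotv pb.2 w = false) ->
  size v = m -> size (reduce B v) = m /\ dotv (reduce B v) w = dotv v w.
Proof.
elim: B v => [|[p b] B IH] v sB sv //=.
have [sb db] : size b = m /\ dotv b w = false by exact: (sB (p, b) (mem_head _ _)).
have [||-> ->] := IH (if nth false v p then xorv v b else v).
- by move=> pb pbB; apply: sB; rewrite inE pbB orbT.
- by case: ifP => // _; rewrite size_xorv ?sb.
by split=> //; case: ifP => // _; rewrite dotv_xorv ?sb // db addbF.
Qed.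

Lemma echelon_dot m w V : (forall v, v \in V -> size v = m /\ dotv v w = false) ->
  forall pb, pb \in echelon V -> size pb.2 = m /\ dotv pb.2 w = false.
Proof.
rewrite /echelon => sV.
pose P (B : seq (nat * bitseq)) := forall pb, pb \in B -> size pb.2 = m /\ dotv pb.2 w = false.
rewrite -/(P _); set step := fun B v => _.
suff H V' B : {subset V' <= V} -> P B -> P (foldl step B V') by apply: H.
elim: V' B => //= v V' IH B sub PB; apply: IH => [x xV'|].
  by apply: sub; rewrite inE xV' orbT.
have [sv dv] := sV _ (sub _ (mem_head _ _)).
rewrite /step; case: ifP => // _ pb; rewrite mem_rcons inE => /predU1P[->|/PB //] /=.
by have [-> ->] := reduce_dot PB sv.
Qed.

(** The vector [w] of values of [f] is orthogonal to every row, hence to all that elimination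
    produces from the rows, hence to the unit vectors that reduce to 0. *)
Lemma class_function_zero reps gens1 gens2 tb1 tb2 f :
  table_ok n gens1 tb1 -> table_ok n gens2 tb2 ->
  class_ok n reps gens1 gens2 tb1 tb2 -> (forall a, f * a = a * f) ->
  f * gal n tb1 (unitv (size tb1.2) 0) = 0 ->
  f * gal n tb2 (unitv (size tb2.2) 0) = 0 -> f = 0.
Proof.
move=> ok1 ok2 /andP[sp /allP no] fC f1 f2; set m := size reps in sp.
pose w := [seq f (decode n r) != 0 | r <- reps].
have fw s : (pos (normal_form (enc s)) reps < m)%N /\
    f s = (nth false w (pos (normal_form (enc s)) reps))%:R.
  have [t tE h] := normal_formE (no _ (enc_all s)).
  have [pm pE] := nth_pos h; split=> //.
  by rewrite (nth_map [::]) // pE tE encK central_class // -F2_bool.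
have rows gens tb : table_ok n gens tb -> f * gal n tb (unitv (size tb.2) 0) = 0 ->
    forall xu, xu \in tb.2 -> size (class_row m reps (qlist n gens) xu.1) = m /\
      dotv (class_row m reps (qlist n gens) xu.1) w = false.
  move=> ok fe _ /(nthP ([::], [::]))[i ik <-].
  have := congr1 (fun a : F2S n => a (rep n tb i)) fe.
  rewrite (mul_gal_unit ok) ffunE -/(row tb i) -(enc_rep ok) // => S0.
  suff [sz dE] : size (class_row m reps (qlist n gens) (enc (rep n tb i))) = m /\
      (dotv (class_row m reps (qlist n gens) (enc (rep n tb i))) w)%:R =
      \sum_(q <- qlist n gens) f (rep n tb i * (decode n q)^-1)%g.
    split=> //; apply/negbTE/negP => d1.
    by move: dE; rewrite S0 d1 => /eqP.
  rewrite /class_row; have := @qlist_valid _ _ _ ok.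
  elim: (qlist n gens) => [|q Q IH] /= vQ; first by rewrite size_nseq dotv_nseq big_nil.
  have [|sz dE] := IH; first by move=> u uQ; apply: vQ; rewrite inE uQ orbT.
  have qE : cmp (enc (rep n tb i)) (cinv q) = enc (rep n tb i * (decode n q)^-1)%g.
    by rewrite encM encV decodeK // vQ ?mem_head.
  have [pm fE] := fw (rep n tb i * (decode n q)^-1)%g.
  rewrite qE size_toggle sz dotv_toggle ?sz // F2_addb dE big_cons fE.
  by split.
have EQ v : v \in [seq class_row m reps (qlist n gens1) xu.1 | xu <- tb1.2] ++
    [seq class_row m reps (qlist n gens2) xu.1 | xu <- tb2.2] ->
    size v = m /\ dotv v w = false.
  by rewrite mem_cat => /orP[] /mapP[xu xuT ->]; [exact: (rows _ _ ok1)|exact: (rows _ _ ok2)].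
case/andP: sp => _ /allP sp.
apply/ffunP => s; rewrite ffunE; have [pm ->] := fw s.
set c := pos _ _ in pm *.
have zc : zerov (reduce (echelon ([seq class_row m reps (qlist n gens1) xu.1 | xu <- tb1.2] ++
    [seq class_row m reps (qlist n gens2) xu.1 | xu <- tb2.2])) (unitv m c)).
  by apply: sp; apply: map_f; rewrite mem_iota.
have su : size (unitv m c) = m by rewrite size_toggle size_nseq.
have [sr] := reduce_dot (echelon_dot EQ) su.
rewrite (zerovP zc) dotv_nseq dotv_toggle ?size_nseq // dotv_nseq addbF => <-.
by [].
Qed.
End ClassFunctions.

(** * Block membership and decompositions *)

Section Transfer.
Variables (A : pzRingType) (f : A).
Hypothesis fi : central_idempotent f.

Lemma linked_fixed e1 a e2 : f * e1 = e1 -> e2 * e2 = e2 -> corner_local e2 ->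
  e1 * a * e2 != 0 -> f * e2 = e2.
Proof.
move=> fe1 ee2 loc nz; have [f0|//] := local_central_idem fi ee2 loc.
by case/eqP: nz; rewrite -fe1 -!mulrA fi.2 -!mulrA -fi.2 f0 !mulr0.
Qed.

Lemma linked_killed e1 a e2 : f * e1 = 0 -> e2 * e2 = e2 -> corner_local e2 ->
  e1 * a * e2 != 0 -> f * e2 = 0.
Proof.
move=> fe1 ee2 loc nz; have [//|f2] := local_central_idem fi ee2 loc.
by case/eqP: nz; rewrite -f2 -!mulrA (mulrA a) -fi.2 !mulrA -fi.2 fe1 !mul0r.
Qed.
End Transfer.

Section Decompositions.
Variables (A : pzRingType) (P : A -> Prop).

Lemma decomposition_one e : P e -> decomposition P e.
Proof.
move=> Pe; exists unit, (fun=> 1), (fun=> e), (fun=> 1); split=> //.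
by rewrite (bigD1 tt) //= big1 ?addr0 ?mul1r ?mulr1 // => -[].
Qed.

Lemma decomposition_mul x b y : decomposition P b -> decomposition P (x * b * y).
Proof.
move=> [J [a [e [c [Pe ->]]]]].
exists J, (fun j => x * a j), e, (fun j => c j * y); split=> //.
by rewrite mulr_sumr mulr_suml; apply: eq_bigr => j _; rewrite !mulrA.
Qed.

Lemma decomposition_add b b' : decomposition P b -> decomposition P b' ->
  decomposition P (b + b').
Proof.
move=> [J [a [e [c [Pe ->]]]]] [J' [a' [e' [c' [Pe' ->]]]]].
pose g T (h : J -> T) (h' : J' -> T) (j : (J + J')%type) :=
  match j with inl i => h i | inr i => h' i end.
exists (J + J')%type, (g A a a'), (g A e e'), (g A c c'); split=> [[j|j] /=|].
- exact: Pe.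
- exact: Pe'.
by rewrite big_sumType.
Qed.
End Decompositions.

Lemma big_corner_neq0 (A : pzRingType) (e : A) : big_corner e -> e != 0.
Proof.
case=> g gI gE; apply: contraT => /negPn/eqP e0.
have g0 t : g t = 0 by rewrite -(gE t).1 e0 mul0r.
have /gI/(congr1 val) : g [tuple of nseq 5 true] = g [tuple of nseq 5 false] by rewrite !g0.
by [].
Qed.

(** The powers have some period [p] from [i] on, and [p * i.+1] is a multiple of [p] beyond [i]. The
    exponent is positive, so the idempotent kills what [D] kills. *)
Lemma finite_power_idempotent (A : finType) (R : pzRingType) (g : R -> A) (D : R) :
  injective g -> exists N, D ^+ N.+1 * D ^+ N.+1 = D ^+ N.+1.
Proof.
move=> gI; have : ~~ injectiveb [ffun i : 'I_#|A|.+1 => g (D ^+ i)].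
  apply/negP => /injectiveP/leq_card; by rewrite card_ord ltnn.
case/injectivePn => i [j ij]; rewrite !ffunE => /gI.
wlog lt_ij : i j ij / (i < j)%N => [H|DD].
  by have [] := ltngtP i j => [/H|/H|/val_inj];
    [apply|move=> h /esym; apply: h; rewrite eq_sym|move/eqP; rewrite (negbTE ij)].
pose p := (j - i)%N; have p0 : (0 < p)%N by rewrite subn_gt0.
have step m : (i <= m)%N -> D ^+ (m + p) = D ^+ m.
  by move=> im; rewrite -(subnKC im) addnAC (subnKC (ltnW lt_ij)) !exprD DD.
have per m t : (i <= m)%N -> D ^+ (m + p * t) = D ^+ m.
  move=> im; elim: t => [|t IH]; first by rewrite muln0 addn0.
  by rewrite mulnSr addnA step ?IH // (leq_trans im) ?leq_addr.
exists (p * i.+1).-1; rewrite prednK ?muln_gt0 ?p0 // -exprD per //.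
by apply: leq_trans (leqnSn i) _; rewrite leq_pmull.
Qed.

Section Tables.
Variables (n : nat) (gens : seq (code * nat)) (tb : table).
Hypothesis ok : table_ok n gens tb.
Local Notation k := (size tb.2).
Local Notation T := (left_mats tb).
Local Notation G := (gal n tb).

Lemma size_unitv m i : size (unitv m i) = m.
Proof. by rewrite size_toggle size_nseq. Qed.

Lemma size_of_bits m I : size (of_bits m I) = m.
Proof. by elim: I => [|i I IH] /=; rewrite ?size_nseq // size_toggle. Qed.

Definition conj_part k T (u e v : bitseq) := vmul k T u (vmul k T e v).

Lemma size_conj_part u e v : size (conj_part k T u e v) = k.
Proof. exact: size_vmul. Qed.

Lemma conj_partE u e v : G (conj_part k T u e v) = G u * G e * G v.
Proof. by rewrite -mulrA !(vmulE ok). Qed.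

Lemma local_big_sound e I J : local_ok k T e I -> big_ok k T e J ->
  local_idempotent (G e) /\ big_corner (G e).
Proof.
move=> /(local_sound ok)[ee loc] /(big_sound ok ee) big.
by split=> //; split=> //; exact: big_corner_neq0.
Qed.
End Tables.

Lemma augm_local_fixed n (f e : F2S n) : central_idempotent f -> augm f = 1 ->
  e * e = e -> corner_local e -> augm e = 1 -> f * e = e.
Proof.
move=> fi f1 ee loc e1; have [fe|//] := local_central_idem fi ee loc.
by have := augmM f e; rewrite fe f1 e1 mul1r /augm big1 => [/eqP//|g _]; rewrite ffunE.
Qed.

Lemma augm_local_killed n (f e : F2S n) : central_idempotent f -> augm f = 0 ->
  e * e = e -> corner_local e -> augm e = 1 -> f * e = 0.
Proof.
move=> fi f1 ee loc e1; have [//|fe] := local_central_idem fi ee loc.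
by have := augmM f e; rewrite fe f1 e1 mul0r => /eqP.
Qed.

(** * The computations *)

(* For a subgroup Q given by generators [gens_H], the other names end in P and the
   dimension of the simple module D whose projective cover is A e (in H6b, up to
   the choice among the simple modules of dimension 4):
   - e is the support of a primitive idempotent of the Hecke algebra and u e v a
     further idempotent isomorphic to e,
   - the double coset sums b_i with i in the list i_ generate the corner: e and
     the e b_i e span it; the e b_i e with i in the list j_ are independent,
   - s_ and p_ are the supports, in another Hecke algebra, of the sum of a larger
     subgroup and of an idempotent of its Hecke algebra.
   The subgroups are 1 in S_4, a 5-cycle in S_5, in S_6 generated by (0 1 2), by
   (0 1 2)(3 4 5) and by both (0 1 2) and (3 4 5), and in S_7 the last one, a
   7-cycle and the group of order 21 containing it. *)
Definition gens_H4 : seq (code * nat) := [::].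
Definition e_H4_P2 : seq nat := [:: 0; 3; 7; 8; 9; 11; 13; 16; 18; 19; 20; 22]%N.
Definition u_H4_P2 : seq nat := [:: 2; 4; 10; 14; 16; 17; 20; 23]%N.
Definition v_H4_P2 : seq nat := [:: 2; 5; 9; 10; 13; 15; 18; 20]%N.
Definition i_H4_P2 : seq nat := [:: 1; 2]%N.
Definition e_H4_P1 : seq nat := [:: 0; 2; 3; 6; 7; 8; 9; 10; 11; 12; 13; 14; 21; 22; 23]%N.
Definition i_H4_P1 : seq nat := [:: 1; 2; 6]%N.
Definition gens_H5 : seq (code * nat) := [:: ([:: 1; 2; 3; 4; 0], 5)]%N.
Definition i_H5_P1 : seq nat := [:: 1; 2; 3; 4; 5; 6; 7]%N.
Definition j_H5_P1 : seq nat := [:: 0; 1; 2; 3; 4]%N.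
Definition gens_H6a : seq (code * nat) := [:: ([:: 1; 2; 0; 3; 4; 5], 3)]%N.
Definition e_H6a_P4 : seq nat := [:: 0; 3; 6; 10; 13; 15; 16; 17; 20; 21; 22; 23; 25; 27; 28;
  29; 31; 32; 33; 34; 36; 37; 39; 41; 42; 44; 46; 47; 50; 51; 52; 53; 55; 59; 60; 61; 64; 65;
  68; 71; 75; 76; 78; 82]%N.
Definition u_H6a_P4 : seq nat := [:: 2; 5; 6; 9; 14; 17; 18; 22; 25; 26; 30; 31; 34; 35; 37;
  41; 43; 45; 46; 47; 48; 49; 51; 53; 54; 56; 57; 59; 61; 62; 63; 64; 68; 69; 70; 71; 72; 73;
  74; 76; 78; 79; 82; 83]%N.
Definition v_H6a_P4 : seq nat := [:: 6; 8; 10; 11; 12; 13; 14; 15; 19; 20; 25; 29; 30; 31; 33;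
  35; 38; 39; 40; 41; 42; 43; 44; 46; 51; 52; 55; 56; 57; 58; 61; 65; 66; 67; 70; 71; 72; 73;
  75; 77; 80; 81; 82; 83]%N.
Definition i_H6a_P4 : seq nat := [:: 1; 2; 6; 7; 9]%N.
Definition j_H6a_P4 : seq nat := [:: 0; 1; 2; 6; 7]%N.
Definition gens_H6b : seq (code * nat) := [:: ([:: 1; 2; 0; 4; 5; 3], 3)]%N.
Definition e_H6b_P4 : seq nat := [:: 0; 2; 6; 9; 18; 21; 23; 25; 32; 34; 35; 37; 39; 41; 42;
  43; 45; 46; 47; 48; 50; 52; 54; 55; 56; 57; 58; 59; 62; 63; 65; 67; 68; 70; 72; 73; 75; 77;
  78; 79; 80; 83; 86; 87]%N.
Definition u_H6b_P4 : seq nat := [:: 4; 7; 12; 15; 16; 20; 27; 28; 32; 35; 40; 43; 46; 49; 56;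
  60; 64; 67; 74; 78; 80; 82; 86; 87]%N.
Definition v_H6b_P4 : seq nat := [:: 2; 3; 4; 8; 11; 15; 19; 20; 27; 28; 39; 40; 45; 46; 47;
  48; 50; 53; 56; 59; 62; 65; 68; 69; 70; 72; 80; 83]%N.
Definition i_H6b_P4 : seq nat := [:: 2; 4; 5; 6; 7]%N.
Definition j_H6b_P4 : seq nat := [:: 0; 2; 4; 5; 6]%N.
Definition gens_H6c : seq (code * nat) := [:: ([:: 1; 2; 0; 3; 4; 5], 3); ([:: 0; 1; 2; 4; 5;
  3], 3)]%N.
Definition i_H6c_P1 : seq nat := [:: 1; 2; 3; 4; 5; 6; 7; 8; 9; 10; 11; 12; 13; 14; 15]%N.
Definition j_H6c_P1 : seq nat := [:: 0; 1; 2; 3; 4]%N.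
Definition gens_H7a : seq (code * nat) := [:: ([:: 1; 2; 0; 3; 4; 5; 6], 3); ([:: 0; 1; 2; 4;
  5; 3; 6], 3)]%N.
Definition e_H7a_P6 : seq nat := [:: 0; 2; 5; 6; 9; 11; 12; 15; 16; 17; 20; 23; 24; 28; 32; 33;
  36; 42; 48; 52; 57; 58; 66; 67; 68; 69; 70; 73; 75; 76]%N.
Definition u_H7a_P6 : seq nat := [:: 1; 2; 4; 5; 6; 7; 8; 9; 11; 15; 16; 19; 20; 21; 22; 23;
  24; 25; 27; 28; 29; 30; 32; 35; 36; 39; 41; 42; 45; 46; 48; 51; 52; 55; 57; 58; 61; 62; 66;
  67; 68; 70; 73; 75; 76; 77]%N.
Definition v_H7a_P6 : seq nat := [:: 1; 3; 7; 8; 14; 15; 17; 19; 21; 25; 27; 29; 30; 31; 37;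
  38; 41; 43; 47; 49; 50; 53; 54; 56; 59; 60; 63; 66; 67; 70; 71; 72; 73; 76]%N.
Definition i_H7a_P6 : seq nat := [:: 1; 2; 4; 5; 6; 10; 17]%N.
Definition j_H7a_P6 : seq nat := [:: 0; 1; 2; 4; 5]%N.
Definition e_H7a_P14 : seq nat := [:: 1; 5; 6; 7; 12; 14; 15; 17; 18; 19; 21; 24; 25; 26; 27;
  28; 32; 34; 37; 40; 45; 47; 48; 50; 52; 55; 56; 57; 58; 59; 61; 63; 64; 65; 67; 68; 69; 70;
  72; 73; 74; 76; 78; 79]%N.
Definition u_H7a_P14 : seq nat := [:: 2; 4; 5; 7; 8; 9; 10; 11; 12; 13; 14; 16; 17; 18; 19; 20;
  21; 22; 26; 28; 30; 33; 34; 36; 38; 41; 43; 45; 50; 51; 52; 54; 55; 56; 57; 58; 61; 62; 65;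
  66; 69; 71; 72; 73; 74; 76; 77; 78]%N.
Definition v_H7a_P14 : seq nat := [:: 5; 6; 7; 8; 9; 10; 12; 15; 17; 18; 21; 26; 28; 31; 32;
  33; 34; 35; 37; 38; 39; 40; 41; 43; 44; 47; 49; 52; 54; 58; 59; 60; 61; 62; 64; 65; 67; 68;
  72; 73; 74; 77]%N.
Definition i_H7a_P14 : seq nat := [:: 1; 2; 3; 4; 5]%N.
Definition e_H7a_P1 : seq nat := [:: 0; 2; 3; 4; 7; 8; 9; 14; 15; 16; 17; 22; 24; 27; 29; 30;
  31; 34; 35; 36; 38; 39; 41; 43; 44; 46; 48; 49; 50; 53; 55; 57; 58; 59; 62; 71; 73; 74; 75;
  76; 77; 78; 79]%N.
Definition i_H7a_P1 : seq nat := [:: 1; 2; 3; 4; 6; 32; 33]%N.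
Definition gens_H7b : seq (code * nat) := [:: ([:: 1; 2; 3; 4; 5; 6; 0], 7)]%N.
Definition e_H7b_P14 : seq nat := [:: 5; 6; 8; 10; 13; 14; 18; 21; 23; 26; 27; 28; 29; 31; 34;
  36; 37; 39; 40; 41; 42; 44; 45; 47; 48; 50; 51; 52; 54; 56; 59; 61; 62; 64; 69; 70; 71; 72;
  73; 75; 76; 77; 78; 79; 80; 83; 84; 86; 89; 92; 93; 96; 101; 102; 104; 106]%N.
Definition u_H7b_P14 : seq nat := [:: 1; 4; 6; 7; 10; 11; 14; 16; 17; 22; 24; 25; 26; 27; 28;
  29; 30; 31; 35; 36; 38; 39; 40; 41; 42; 43; 44; 45; 48; 51; 52; 54; 57; 59; 61; 64; 65; 66;
  67; 71; 72; 73; 75; 76; 77; 79; 85; 87; 88; 89; 91; 92; 101; 102; 104; 107]%N.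
Definition v_H7b_P14 : seq nat := [:: 1; 2; 4; 11; 17; 20; 27; 28; 30; 31; 32; 33; 41; 45; 49;
  52; 53; 54; 57; 59; 60; 61; 62; 64; 65; 67; 68; 69; 70; 72; 80; 92; 93; 96; 100; 101; 102;
  104; 105; 106]%N.
Definition i_H7b_P14 : seq nat := [:: 1; 2; 4; 5; 6]%N.
Definition e_H7b_P20 : seq nat := [:: 0; 2; 3; 7; 10; 12; 13; 16; 18; 19; 20; 22; 23; 24; 26;
  27; 28; 30; 31; 32; 34; 35; 36; 37; 38; 39; 40; 41; 42; 43; 45; 46; 47; 51; 52; 54; 55; 56;
  57; 60; 61; 63; 65; 66; 69; 70; 71; 73; 76; 77; 80; 81; 82; 83; 84; 85; 86; 88; 91; 92; 93;
  95; 96; 97; 99; 101; 106; 107]%N.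
Definition u_H7b_P20 : seq nat := [:: 2; 4; 5; 6; 14; 15; 16; 17; 19; 21; 25; 26; 29; 30; 31;
  32; 33; 34; 35; 36; 37; 38; 40; 41; 44; 45; 47; 51; 55; 56; 61; 63; 65; 66; 68; 69; 70; 71;
  72; 74; 79; 80; 82; 84; 85; 88; 90; 91; 93; 94; 96; 97; 99; 100; 103; 104]%N.
Definition v_H7b_P20 : seq nat := [:: 7; 8; 9; 10; 14; 18; 22; 25; 27; 29; 33; 34; 35; 37; 47;
  52; 54; 55; 56; 57; 58; 59; 63; 70; 72; 74; 79; 81; 84; 88; 90; 91; 92; 100; 102; 106]%N.
Definition i_H7b_P20 : seq nat := [:: 1; 2; 3]%N.
Definition gens_H7c : seq (code * nat) := [:: ([:: 1; 2; 3; 4; 5; 6; 0], 7); ([:: 0; 2; 4; 6;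
  1; 3; 5], 3)]%N.
Definition e_H7c_P8 : seq nat := [:: 0; 2; 3; 9; 11; 13; 14; 15; 17; 18]%N.
Definition u_H7c_P8 : seq nat := [:: 2; 3; 5; 6; 8; 9; 10; 12; 14; 15; 18; 19]%N.
Definition v_H7c_P8 : seq nat := [:: 2; 3; 5; 14; 17; 19]%N.
Definition i_H7c_P8 : seq nat := [:: 1; 2]%N.
Definition e_H7c_P1 : seq nat := [:: 0; 6; 9]%N.
Definition i_H7c_P1 : seq nat := [:: 1; 2; 4; 5; 8; 11; 15]%N.
Definition s_H6a : seq nat := [:: 0; 3; 4]%N.
Definition s_H6b : seq nat := [:: 0; 2; 3]%N.
Definition s_H7b : seq nat := [:: 0; 82; 103]%N.
Definition p_H7b_P1 : seq nat := [:: 0; 8; 10; 13; 14; 24; 35; 82; 103]%N.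
Definition class_reps : seq code := [:: [:: 1; 2; 3; 4; 5; 6; 0]; [:: 1; 2; 3; 4; 5; 0; 6]; [::
  1; 2; 3; 4; 0; 6; 5]; [:: 1; 2; 3; 4; 0; 5; 6]; [:: 1; 2; 3; 0; 5; 6; 4]; [:: 1; 2; 3; 0; 5;
  4; 6]; [:: 1; 2; 3; 0; 4; 5; 6]; [:: 1; 2; 0; 4; 5; 3; 6]; [:: 1; 2; 0; 4; 3; 6; 5]; [:: 1;
  2; 0; 4; 3; 5; 6]; [:: 1; 2; 0; 3; 4; 5; 6]; [:: 1; 0; 3; 2; 5; 4; 6]; [:: 1; 0; 3; 2; 4; 5;
  6]; [:: 1; 0; 2; 3; 4; 5; 6]; [:: 0; 1; 2; 3; 4; 5; 6]]%N.

Section SymmetricGroupChecks.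
Variables tb tbc : table.
Local Notation k := (size tb.2).
Local Notation T := (left_mats tb).
Local Notation b := (of_bits k).

Definition check4 :=
  [&& table_ok 4 gens_H4 tb, small_ok k T (b e_H4_P1) i_H4_P1,
    small_ok k T (b e_H4_P2) i_H4_P2 &
    eqv (unitv k 0) (xorv (b e_H4_P1)
      (xorv (b e_H4_P2) (conj_part k T (b u_H4_P2) (b e_H4_P2) (b v_H4_P2))))].

(** A 5-cycle has nonzero fixed points in no simple module but the trivial one, so the subgroup sum
    is already the idempotent of a single projective cover. The same happens for the subgroup of
    order 9 in S_6. *)
Definition check5 :=
  [&& table_ok 5 gens_H5 tb, local_ok k T (unitv k 0) i_H5_P1, augv tb (unitv k 0) &
    big_ok k T (unitv k 0) j_H5_P1].

Definition check6c :=
  [&& table_ok 6 gens_H6c tb, local_ok k T (unitv k 0) i_H6c_P1 &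
    big_ok k T (unitv k 0) j_H6c_P1].

Definition check6 gens s9 e4 u v I4 J4 :=
  let w := xorv (b s9) (xorv (b e4) (conj_part k T (b u) (b e4) (b v))) in
  let s := xorv (unitv k 0) w in
  let dv := class_vec 6 gens tb moves_two in
  [&& table_ok 6 gens tb, same_ok 6 tb (b s9) tbc (unitv (size tbc.2) 0),
    local_ok k T (b e4) I4, big_ok k T (b e4) J4, augv tb (unitv k 0), augv tb dv &
    zerov (vmul k T s dv)].
End SymmetricGroupChecks.

Definition half_swap : code := [:: 3; 4; 5; 0; 1; 2]%N.
Definition last_swap : code := [:: 0; 1; 2; 3; 5; 4]%N.

Definition unit_conj (t : code) (tb : table) (g : code) : bool :=
  nth false (unitv (size tb.2) 0) (dc tb.1 (cmp (cmp (cinv t) g) t)).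

(* Of the four subgroups of order 3 of the group generated by (0 1 2) and (3 4 5),
   [tba] and [tbb] give two, the other two are conjugate to these.  They cover each
   non-trivial element once, so over F_2 their sums and that of the whole group add
   up to 1. *)
Definition check6_sum (tba tbb tbc : table) :=
  let one := iota 0 6 in
  [&& validb 6 half_swap, validb 6 last_swap &
  all (fun g => eqb (eqs g one)
    (unit_conj one tbc g (+) (unit_conj one tba g (+) (unit_conj half_swap tba g (+)
      (unit_conj one tbb g (+) unit_conj last_swap tbb g))))) (all_codes 6)].

(** The subgroup sum splits into local idempotents for the simple modules of dimension 1, 14 and 6,
    with multiplicities 1, 2 and 2; only dimension 6 belongs to the non-principal block. *)
Definition check7a (tb1 : table) :=
  let k1 := size tb1.2 in
  let T1 := left_mats tb1 in
  let b1 := of_bits k1 in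
  let c14 := conj_part k1 T1 (b1 u_H7a_P14) (b1 e_H7a_P14) (b1 v_H7a_P14) in
  let c6 := conj_part k1 T1 (b1 u_H7a_P6) (b1 e_H7a_P6) (b1 v_H7a_P6) in
  [&& local_ok k1 T1 (b1 e_H7a_P1) i_H7a_P1, local_ok k1 T1 (b1 e_H7a_P14) i_H7a_P14,
      local_ok k1 T1 (b1 e_H7a_P6) i_H7a_P6, augv tb1 (b1 e_H7a_P1),
      big_ok k1 T1 (b1 e_H7a_P6) j_H7a_P6,
      link_ok k1 T1 (b1 e_H7a_P1) (b1 e_H7a_P14) 1 &
      eqv (unitv k1 0) (xorv (b1 e_H7a_P1) (xorv (xorv (b1 e_H7a_P14) c14) (xorv (b1 e_H7a_P6) c6)))].

(** Apart from the sum of the group of order 21, the summands belong to dimensions 14 and 20; the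
    latter provides the small corner of the principal block. *)
Definition check7b (tb2 : table) :=
  let k2 := size tb2.2 in
  let T2 := left_mats tb2 in
  let b2 := of_bits k2 in
  let d14 := conj_part k2 T2 (b2 u_H7b_P14) (b2 e_H7b_P14) (b2 v_H7b_P14) in
  let d20 := conj_part k2 T2 (b2 u_H7b_P20) (b2 e_H7b_P20) (b2 v_H7b_P20) in
  [&& local_ok k2 T2 (b2 e_H7b_P14) i_H7b_P14,
      local_ok k2 T2 (b2 e_H7b_P20) i_H7b_P20,
      small_ok k2 T2 (b2 e_H7b_P20) i_H7b_P20,
      link_ok k2 T2 (b2 p_H7b_P1) (b2 e_H7b_P14) 1, link_ok k2 T2 (b2 p_H7b_P1) (b2 e_H7b_P20) 1 &
      eqv (unitv k2 0) (xorv (b2 s_H7b) (xorv (xorv (b2 e_H7b_P14) d14) (xorv (b2 e_H7b_P20) d20)))].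

(** Splits the sum of the group of order 21 into dimensions 1, 8 and 8. The idempotent of the
    trivial module is certified here, where the Hecke algebra is smallest, and identified with its
    copy in the table of the 7-cycle. *)
Definition check7c (tb1 tb2 tb3 : table) :=
  let b1 := of_bits (size tb1.2) in
  let b2 := of_bits (size tb2.2) in
  let k3 := size tb3.2 in
  let T3 := left_mats tb3 in
  let b3 := of_bits k3 in
  let d8 := conj_part k3 T3 (b3 u_H7c_P8) (b3 e_H7c_P8) (b3 v_H7c_P8) in
  [&& [&& table_ok 7 gens_H7a tb1, table_ok 7 gens_H7b tb2 & table_ok 7 gens_H7c tb3],
   [&& local_ok k3 T3 (b3 e_H7c_P1) i_H7c_P1, local_ok k3 T3 (b3 e_H7c_P8) i_H7c_P8,
     augv tb3 (b3 e_H7c_P1) & eqv (unitv k3 0) (xorv (b3 e_H7c_P1) (xorv (b3 e_H7c_P8) d8))],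
    same_ok 7 tb2 (b2 s_H7b) tb3 (unitv k3 0), same_ok 7 tb2 (b2 p_H7b_P1) tb3 (b3 e_H7c_P1),
    cross_ok 7 gens_H7a tb1 tb3 (b1 e_H7a_P6) (b3 e_H7c_P8) (iota 0 7) &
    class_ok 7 class_reps gens_H7a gens_H7b tb1 tb2].

(** * Soundness of the checks *)

Lemma check4_sound tb : check4 tb -> small_decomposition (1 : F2S 4).
Proof.
case/and4P=> ok /(small_sound ok) P1 /(small_sound ok) P2 /eqvP unitE.
have -> : 1 = gal 4 tb (unitv (size tb.2) 0).
  rewrite -[RHS]mul1r; apply/ffunP => s; rewrite (mul_gal_unit ok) big_seq1.
  by rewrite -(enc1 4) encK invg1 mulg1.
rewrite unitE !galD ?size_xorv ?size_of_bits ?size_conj_part // (conj_partE ok).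
apply: decomposition_add; first exact: decomposition_one.
apply: decomposition_add; first exact: decomposition_one.
exact/decomposition_mul/decomposition_one.
Qed.

Lemma check5_sound tb (f : F2S 5) : check5 tb -> central_idempotent f -> augm f = 1 ->
  exists e, [/\ local_idempotent e, f * e = e & big_corner e].
Proof.
case/and4P=> ok loc aug big fi f1.
have [le be] := local_big_sound ok loc big; have [ee _ lc] := le.
exists (gal 5 tb (unitv (size tb.2) 0)); split=> //.
by apply: augm_local_fixed => //; rewrite (augm_gal ok) ?aug // size_unitv.
Qed.

Definition transpositions n : F2S n := [ffun s => (moves_two (enc s))%:R].

Lemma moves_twoE n (t : 'S_n) : moves_two (enc t) = ((\sum_(i | t i != i) 1)%N == 2).
Proof.
rewrite /moves_two size_enc eqnE -val_enum_ord count_map -sum1_count big_enum_cond.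
by congr (_ == _); apply: eq_bigl => i; rewrite /= nth_enc.
Qed.

Lemma transpositions_central n a : transpositions n * a = a * transpositions n.
Proof.
apply: class_central => s t; rewrite !ffunE !moves_twoE; congr ((_ == _)%:R).
rewrite [RHS](reindex_inj (@perm_inj _ s)); apply: eq_bigl => i.
by rewrite !permM -(inj_eq (@perm_inj _ s)) permKV.
Qed.

(* The sum q of Q is e_9 + e + u e v + s, with e_9 the sum of the larger group and
   D s = 0 for the sum D of the transpositions, hence f s = f D^(N+1) s = 0. *)
Lemma check6_sound gens tb tbc s9 e4 u v I4 J4 (f : block (F2S 6)) :
  table_ok 6 gens_H6c tbc -> check6 tb tbc gens s9 e4 u v I4 J4 ->
  principal_block f ->
  big_decomposition (gal 6 tbc (unitv (size tbc.2) 0)) ->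
  big_decomposition (block_idem f * gal 6 tb (unitv (size tb.2) 0)).
Proof.
move=> okc; rewrite /check6; set w := xorv (of_bits _ s9) _ => /and5P[ok same loc big] /and3P[aug1 augD].
set k := size tb.2 in w loc big aug1 augD *; set E := gal 6 tb (unitv k 0).
set dv := class_vec _ _ _ _ in augD *; move=> /(gal_zerov 6 tb) Ds pf d9.
have sw : size w = k by rewrite !size_xorv ?size_of_bits ?size_conj_part.
pose s := gal 6 tb (xorv (unitv k 0) w).
have DE : transpositions 6 * E = gal 6 tb dv.
  by apply: gal_class_vec => // [t|a]; [rewrite ffunE|exact: transpositions_central].
have D0 : transpositions 6 * s = 0.
  have <- : s * E = s by exact: (gal_mul1 ok).
  by rewrite mulrA transpositions_central -mulrA DE (vmulE ok).
have E1 : augm E = 1 by rewrite (augm_gal ok) ?aug1 // size_unitv.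
(* As [E] has augmentation 1, the augmentation of the sum of the 15 transpositions can be read off
   from its product with [E]. *)
have D1 : augm (transpositions 6) = 1.
  by rewrite -[LHS]mulr1 -E1 -augmM DE (augm_gal ok) ?augD // size_map.
set F := block_idem f; have f1 : augm F = 1 by exact: (augm_block f).1.
have Fs : F * s = 0.
  pose g (a : F2S 6) : {ffun 'S_6 -> 'F_2} := a.
  have [N NN] := finite_power_idempotent (transpositions 6) (g := g) (fun x y => id).
  have DC : central_idempotent (transpositions 6 ^+ N.+1).
    split=> // a; elim: N.+1 => [|m IH]; first by rewrite expr0 mulr1 mul1r.
    by rewrite exprS -mulrA IH !mulrA transpositions_central.
  have [FD|FD] := block_idem_central_mul f DC; last by rewrite /F -FD -mulrA exprSr -mulrA D0 !mulr0.
  have := congr1 (@augm _ _) FD; rewrite augmM f1 mul1r.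
  have -> : augm (transpositions 6 ^+ N.+1) = 1.
    by elim: N.+1 => [|m IH]; rewrite ?augm1 // exprS augmM D1 IH mulr1.
  by rewrite /augm big1 => [/eqP//|a _]; rewrite ffunE.
have le := local_big_sound ok loc big.
have -> : F * E = F * gal 6 tb w * 1.
  rewrite mulr1; apply/eqP; rewrite -subr_eq0 galg_opp -mulrDr -galD ?size_unitv //.
  exact/eqP.
apply: decomposition_mul; rewrite !galD ?size_xorv ?size_of_bits ?size_conj_part // (conj_partE ok).
apply: decomposition_add; first by rewrite (same_gal ok okc same).
apply: decomposition_add; first exact: decomposition_one.
exact/decomposition_mul/decomposition_one.
Qed.

Lemma check6_sum_sound tba tbb tbc (E := fun tb => gal 6 tb (unitv (size tb.2) 0)) :
  check6_sum tba tbb tbc ->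
  exists s t : 'S_6, 1 = E tbc + (E tba + (point s * E tba * point s^-1%g +
    (E tbb + point t * E tbb * point t^-1%g))).
Proof.
move=> /and3P[vs vt /allP H].
exists (decode 6 half_swap), (decode 6 last_swap); apply/ffunP => g.
have cE t tb : (unit_conj (enc t) tb (enc g))%:R = (point t * E tb * point t^-1%g) g :> 'F_2.
  by rewrite mul_point point_mul galE invgK mulgA /unit_conj -encV -!encM.
have cE1 tb : (unit_conj (iota 0 6) tb (enc g))%:R = E tb g :> 'F_2.
  by rewrite -(enc1 6) cE mul_point point_mul !invg1 mul1g mulg1.
have /eqP := H _ (enc_all g); rewrite -[half_swap in X in X -> _](decodeK vs).
rewrite -[last_swap in X in X -> _](decodeK vt) => /(congr1 (fun b : bool => b%:R : 'F_2)).
rewrite !F2_addb !cE1 !cE [LHS](_ : _ = (1 : F2S 6) g) => [->|]; first by rewrite !ffunE.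
rewrite ffunE; congr ((nat_of_bool _)%:R); apply/eqsP/eqP => [|->]; last exact: enc1.
by rewrite -(enc1 6) => /enc_inj.
Qed.

Section SevenSound.
Variables (tb1 tb2 tb3 : table) (b : block (F2S 7)).
Hypotheses (chka : check7a tb1) (chkb : check7b tb2) (chkc : check7c tb1 tb2 tb3).
Local Notation f := (block_idem b).

Lemma check7_principal : principal_block b ->
  exists e, [/\ local_idempotent e, f * e = e & ~ big_corner e].
Proof.
move=> /(augm_block b).1 f1.
have fi : central_idempotent f by have [] := block_idemP b.
case/and5P: chkc => /and3P[ok1 ok2 ok3] /and4P[loc1 _ aug1 _] _ same _.
case/and5P: chkb => _ loc20 small _ /andP[link _].
have [ee1 l1] := local_sound ok3 loc1; have [ee20 l20] := local_sound ok2 loc20.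
have [_ nbig] := small_sound ok2 small.
(* The link is computed in the table of the 7-cycle, while locality of the first idempotent is known
   from the table of the group of order 21. *)
have [a] := link_sound ok2 link; rewrite (same_gal ok2 ok3 same) => nz.
exists (gal 7 tb2 (of_bits (size tb2.2) e_H7b_P20)); split=> //.
  split=> //; apply: contra_neq nz => ->; exact: mulr0.
apply: (linked_fixed fi _ ee20 l20 nz); apply: augm_local_fixed => //.
by rewrite (augm_gal ok3) ?aug1 // size_of_bits.
Qed.

Lemma check7_non_principal : ~ principal_block b ->
  exists e, [/\ local_idempotent e, f * e = e & big_corner e].
Proof.
move=> /(augm_block b).2 f0; have [fi fn0 _] := block_idemP b.
case/and5P: chkc => /and3P[ok1 ok2 ok3] /and4P[locc1 locc8 augc1 /eqvP E3] same_s same_p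
  /andP[cross cls].
case/and5P: chka => loca1 loca14 loca6 auga1 /and3P[biga6 linka /eqvP E1].
case/and5P: chkb => locb14 locb20 _ linkb14 /andP[linkb20 /eqvP E2].
have [ea1 la1] := local_sound ok1 loca1; have [ea14 la14] := local_sound ok1 loca14.
have [[ea6 na6 la6] ba6] := local_big_sound ok1 loca6 biga6.
have [eb14 lb14] := local_sound ok2 locb14; have [eb20 lb20] := local_sound ok2 locb20.
have [ec1 lc1] := local_sound ok3 locc1; have [ec8 lc8] := local_sound ok3 locc8.
have fa1 : f * gal 7 tb1 (of_bits (size tb1.2) e_H7a_P1) = 0.
  by apply: augm_local_killed => //; rewrite (augm_gal ok1) ?auga1 // size_of_bits.
have fc1 : f * gal 7 tb3 (of_bits (size tb3.2) e_H7c_P1) = 0.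
  by apply: augm_local_killed => //; rewrite (augm_gal ok3) ?augc1 // size_of_bits.
have fb1 : f * gal 7 tb2 (of_bits (size tb2.2) p_H7b_P1) = 0.
  by rewrite (same_gal ok2 ok3 same_p).
have fa14 : f * gal 7 tb1 (of_bits (size tb1.2) e_H7a_P14) = 0.
  by have [a nz] := link_sound ok1 linka; apply: linked_killed nz.
have fb14 : f * gal 7 tb2 (of_bits (size tb2.2) e_H7b_P14) = 0.
  by have [a nz] := link_sound ok2 linkb14; apply: linked_killed nz.
have fb20 : f * gal 7 tb2 (of_bits (size tb2.2) e_H7b_P20) = 0.
  by have [a nz] := link_sound ok2 linkb20; apply: linked_killed nz.
have kills x y z : f * x = 0 -> f * (y * x * z) = 0.
  by move=> fx; rewrite !mulrA fi.2 -(mulrA y) fx mulr0 mul0r.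
exists (gal 7 tb1 (of_bits (size tb1.2) e_H7a_P6)); split=> //.
(* If [f] killed this idempotent too, it would kill every summand of both subgroup sums and be 0 as
   a class function. *)
have [fa6|//] := local_central_idem fi ea6 la6.
have fc8 : f * gal 7 tb3 (of_bits (size tb3.2) e_H7c_P8) = 0.
  (* The linking element is 1: the product of the two idempotents is nonzero because [cross_ok]
     finds its coefficient at the identity to be 1. *)
  apply: (@linked_killed _ _ fi _ 1 _ fa6 ec8 lc8); rewrite mulr1.
  apply/eqP => /(congr1 (fun a : F2S 7 => a 1%g)).
  rewrite (gal_cross ok1 (size_of_bits _ _)
    (w := fun g => nth false (of_bits (size tb3.2) e_H7c_P8) (dc tb3.1 g))
    (galE tb3 (of_bits (size tb3.2) e_H7c_P8)) (enc1 7)) [X in _ = X]ffunE.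
  by move: cross; rewrite /cross_ok => -> /eqP.
case/eqP: fn0; apply: (class_function_zero ok1 ok2 cls fi.2).
  rewrite E1 !galD ?size_xorv ?size_of_bits ?size_conj_part //.
  by rewrite !(conj_partE ok1) !mulrDr fa1 fa14 fa6 !kills ?addr0.
rewrite E2 !galD ?size_xorv ?size_of_bits ?size_conj_part //.
rewrite !(conj_partE ok2) !mulrDr fb14 fb20 !kills // ?addr0 (same_gal ok2 ok3 same_s).
rewrite E3 !galD ?size_xorv ?size_of_bits ?size_conj_part //.
by rewrite !(conj_partE ok3) !mulrDr fc1 fc8 kills ?addr0.
Qed.
End SevenSound.

Lemma checks6_sound tba tbb tbc (b : block (F2S 6)) : check6c tbc ->
  check6 tba tbc gens_H6a s_H6a e_H6a_P4 u_H6a_P4 v_H6a_P4 i_H6a_P4 j_H6a_P4 ->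
  check6 tbb tbc gens_H6b s_H6b e_H6b_P4 u_H6b_P4 v_H6b_P4 i_H6b_P4 j_H6b_P4 ->
  check6_sum tba tbb tbc -> principal_block b -> big_decomposition (block_idem b).
Proof.
case/and3P=> okc locc bigc chka chkb /check6_sum_sound[s [t E1]] pb.
have d9 : big_decomposition (gal 6 tbc (unitv (size tbc.2) 0)).
  exact/decomposition_one/(local_big_sound okc locc bigc).
have da := check6_sound okc chka pb d9; have db := check6_sound okc chkb pb d9.
have conj x (r : 'S_6) : block_idem b * (point r * x * point r^-1%g) =
    point r * (block_idem b * x) * point r^-1%g.
  by rewrite !mulrA block_idemC.
rewrite -[block_idem b]mulr1 E1 !mulrDr !conj.
apply: decomposition_add; first by rewrite -[_ * _]mulr1; exact: decomposition_mul.
apply: decomposition_add => //.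
apply: decomposition_add; first exact: decomposition_mul.
by apply: decomposition_add => //; exact: decomposition_mul.
Qed.

(** * Evaluation of the checks *)

Definition table4 := mk_table 4 gens_H4.
Definition table5 := mk_table 5 gens_H5.
Definition table6a := mk_table 6 gens_H6a.
Definition table6b := mk_table 6 gens_H6b.
Definition table6c := mk_table 6 gens_H6c.
Definition table7a := mk_table 7 gens_H7a.
Definition table7b := mk_table 7 gens_H7b.
Definition table7c := mk_table 7 gens_H7c.

Lemma check4_true : check4 table4. Proof. by vm_compute. Qed.
Lemma check5_true : check5 table5. Proof. by vm_compute. Qed.
Lemma check6c_true : check6c table6c. Proof. by vm_compute. Qed.
Lemma check6a_true : check6 table6a table6c gens_H6a s_H6a e_H6a_P4 u_H6a_P4 v_H6a_P4
  i_H6a_P4 j_H6a_P4.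
Proof. by vm_compute. Qed.
Lemma check6b_true : check6 table6b table6c gens_H6b s_H6b e_H6b_P4 u_H6b_P4 v_H6b_P4
  i_H6b_P4 j_H6b_P4.
Proof. by vm_compute. Qed.
Lemma check6_sum_true : check6_sum table6a table6b table6c. Proof. by vm_compute. Qed.
Lemma check7a_true : check7a table7a. Proof. by vm_compute. Qed.
Lemma check7b_true : check7b table7b. Proof. by vm_compute. Qed.
Lemma check7c_true : check7c table7a table7b table7c. Proof. by vm_compute. Qed.

Theorem mainTheorem2 :
  [/\ (forall b5 : block (F2S 5), principal_block b5 ->
         ~ morita_equivalent (F2S 4) (block_alg b5)) /\
      (forall b7 : block (F2S 7), ~ principal_block b7 ->
         ~ morita_equivalent (F2S 4) (block_alg b7)),
      forall Y4 : intpart 4 -> lmodType (F2S 4), young_modules Y4 ->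
        (forall Y5 : intpart 5 -> lmodType (F2S 5), young_modules Y5 ->
         forall b5 : block (F2S 5), principal_block b5 ->
           ~ morita_equivalent (schur_algebra Y4) (schur_block Y5 b5)) /\
        (forall Y7 : intpart 7 -> lmodType (F2S 7), young_modules Y7 ->
         forall b7 : block (F2S 7), ~ principal_block b7 ->
           ~ morita_equivalent (schur_algebra Y4) (schur_block Y7 b7)),
      forall (b6 : block (F2S 6)) (b7 : block (F2S 7)),
        principal_block b6 -> principal_block b7 ->
        ~ morita_equivalent (block_alg b6) (block_alg b7) &
      forall (Y6 : intpart 6 -> lmodType (F2S 6))
             (Y7 : intpart 7 -> lmodType (F2S 7)),
        young_modules Y6 -> young_modules Y7 ->
        forall (b6 : block (F2S 6)) (b7 : block (F2S 7)),
        principal_block b6 -> principal_block b7 ->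
        ~ morita_equivalent (schur_block Y6 b6) (schur_block Y7 b7)].
Proof.
apply: main_from_facts.
- exact: check4_sound check4_true.
- move=> b /(augm_block b).1; apply: check5_sound check5_true _.
  by have [] := block_idemP b.
- by move=> b; exact: check7_non_principal check7a_true check7b_true check7c_true.
- by move=> b; exact: checks6_sound check6c_true check6a_true check6b_true check6_sum_true.
- by move=> b; exact: check7_principal check7b_true check7c_true.
Qed.
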